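(* Let $1\le d<n$, $\mathrm{rch}_{\min}>0$, $0<f_{\min}\le f_{\max}/4$, $L\ge0$, $\tau>0$, $\alpha<1$, and $\varepsilon\le\mathrm{rch}_{\min}/(2^{34}d^2)$. Assume $2^{d+1}\sigma_d f_{\min}\mathrm{rch}_{\min}^d\le1$. Then any randomized SQ algorithm estimating $M=\mathrm{Supp}(D)$ over the fixed point model $\mathcal{D}^{n,d}_{\mathrm{rch}_{\min}}(f_{\min},f_{\max},L;0)$ with respect to $d_H$ with precision $\varepsilon$ and probability of success at least $1-\alpha$ must make at least $$q\ge\left(\frac{n}{\omega_d f_{\min}\mathrm{rch}_{\min}^d}\left(\frac{\mathrm{rch}_{\min}}{2^{21}\varepsilon}\right)^{d/2}+\log(1-\alpha)\right)\Big/\log(1+1/\tau)$$ queries to $\mathrm{STAT}(\tau)$.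
   Context: Notation: $\omega_d$ is the volume of the unit ball of $\mathbb{R}^d$ and $\sigma_d$ the $d$-dimensional volume of the unit sphere of $\mathbb{R}^{d+1}$. $\mathrm{d}(z,K)=\inf_{p\in K}\|p-z\|$. The medial axis of a closed $K\subseteq\mathbb{R}^n$ is the set of points having at least two distinct nearest points in $K$, and the reach $\mathrm{rch}_K$ is the infimum of $\mathrm{d}(z,K)$ over the medial axis. $\mathcal{M}^{n,d}_{\rho}$ is the set of compact connected $d$-dimensional $C^2$ submanifolds of $\mathbb{R}^n$ without boundary with reach $\ge\rho$. $\mathcal{D}^{n,d}_{\mathrm{rch}_{\min}}(f_{\min},f_{\max},L)$ is the set of Borel probability distributions $D$ on $\mathbb{R}^n$ with support $M\in\mathcal{M}^{n,d}_{\mathrm{rch}_{\min}}$ having a density $f$ w.r.t. the $d$-dimensional Hausdorff measure restricted to $M$ with $f_{\min}\le f\le f_{\max}$ on $M$ and $f$ $L$-Lipschitz on $M$; the fixed point model $\mathcal{D}^{n,d}_{\mathrm{rch}_{\min}}(f_{\min},f_{\max},L;0)$ consists of those with $0\in M$. $d_H(K,K')=\sup_x|\mathrm{d}(x,K)-\mathrm{d}(x,K')|$. SQ framework: a $\mathrm{STAT}(\tau)$ oracle for $D$ answers each query $r:\mathbb{R}^n\to[-1,1]$ (measurable) with an arbitrary adversarial real $a$ such that $|a-\mathbb{E}_{D}[r]|\le\tau$. A deterministic SQ algorithm chooses each query adaptively as a function of previous answers and outputs a function of all answers. A randomized SQ algorithm is a probability distribution over deterministic SQ algorithms; it estimates $\mathrm{Supp}(D)$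 over a model with precision $\varepsilon$ and probability of success $1-\alpha$ if for every $D$ in the model and every valid $\mathrm{STAT}(\tau)$ oracle for $D$, with probability at least $1-\alpha$ over the draw of the algorithm its output $\hat M$ satisfies $d_H(\mathrm{Supp}(D),\hat M)\le\varepsilon$. *)

(* Defs.v *)
From HB Require Import structures.
From mathcomp Require Import all_boot all_order all_algebra.
From mathcomp Require Import all_classical all_reals all_analysis.

Set Implicit Arguments.
Unset Strict Implicit.
Unset Printing Implicit Defensive.

Import Order.TTheory GRing.Theory Num.Theory.
Import numFieldNormedType.Exports.

Local Open Scope classical_set_scope.
Local Open Scope ring_scope.

(* Points of R^n are row vectors 'rV[R]_n.  The library topology on 'rV[R]_n
   (sup norm) coincides with the Euclidean topology; all metric quantities
   below use the Euclidean norm [enorm]. *)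

Definition enorm {R : realType} {n : nat} (x : 'rV[R]_n) : R :=
  Num.sqrt (\sum_(i < n) x ord0 i ^+ 2).

Definition dist_set {R : realType} {n : nat} (z : 'rV[R]_n) (K : set 'rV[R]_n)
  : \bar R :=
  ereal_inf [set (enorm (p - z))%:E | p in K].

Definition medial_axis {R : realType} {n : nat} (K : set 'rV[R]_n)
  : set 'rV[R]_n :=
  [set z | exists p q, [/\ K p, K q, p <> q,
     (enorm (p - z))%:E = dist_set z K & (enorm (q - z))%:E = dist_set z K]].

Definition reach {R : realType} {n : nat} (K : set 'rV[R]_n) : \bar R :=
  ereal_inf [set dist_set z K | z in medial_axis K].

Definition C1_on {R : realType} {m p : nat} (V : set 'rV[R]_m)
  (g : 'rV[R]_m -> 'rV[R]_p) : Prop :=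
  (forall x, V x -> differentiable g x) /\
  (forall v : 'rV[R]_m, {within V, continuous ('D_v g)}).

Definition C2_on {R : realType} {m p : nat} (V : set 'rV[R]_m)
  (g : 'rV[R]_m -> 'rV[R]_p) : Prop :=
  C1_on V g /\ (forall v : 'rV[R]_m, C1_on V ('D_v g)).

(** M is a d-dimensional C^2 (embedded) submanifold of R^n without boundary:
    every point of M has an open neighbourhood U such that M `&` U is the image
    of an open set V of R^d by a C^2 immersion phi which is a homeomorphism
    from V onto M `&` U. *)
Definition C2_submanifold {R : realType} {n : nat} (d : nat)
  (M : set 'rV[R]_n) : Prop :=
  forall p, M p -> exists (U : set 'rV[R]_n) (V : set 'rV[R]_d)
                          (phi : 'rV[R]_d -> 'rV[R]_n),
    [/\ open U, U p, open V & C2_on V phi] /\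
    [/\ (forall x y, V x -> V y -> phi x = phi y -> x = y),
        phi @` V = M `&` U,
        (forall x, V x -> forall v, 'd phi x v = 0 -> v = 0) &
        (forall W, open W -> W `<=` V ->
           exists O : set 'rV[R]_n, open O /\ phi @` W = O `&` (M `&` U))].

Definition manifold_class {R : realType} {n : nat} (d : nat) (rho : R)
  (M : set 'rV[R]_n) : Prop :=
  [/\ compact M, connected M, C2_submanifold d M & (rho%:E <= reach M)%E].

Fixpoint ball_vol (R : realType) (d : nat) : R :=
  match d with
  | 0 => 1
  | 1 => 2
  | S (S k as k1) => (2 * pi / (k1.+1)%:R) * ball_vol R k
  end.

(** sigma_d = d-dim volume of the unit sphere of R^(d+1) = (d+1) omega_(d+1) *)
Definition sphere_area (R : realType) (d : nat) : R :=
  (d.+1)%:R * ball_vol R d.+1.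

(** Euclidean diameter (0 for the empty set) *)
Definition ediam {R : realType} {n : nat} (C : set 'rV[R]_n) : \bar R :=
  ereal_sup ([set 0%E] `|`
             [set e | exists x y, [/\ C x, C y & e = (enorm (x - y))%:E]]).

Definition hausdorff_pre {R : realType} {n : nat} (d : nat) (delta : R)
  (A : set 'rV[R]_n) : \bar R :=
  ereal_inf [set (\sum_(0 <= i <oo)
                    ((ball_vol R d * (fine (ediam (C i)) / 2) ^+ d)%:E))%E
            | C in [set C : nat -> set 'rV[R]_n |
                      A `<=` \bigcup_i C i /\
                      forall i, (ediam (C i) <= delta%:E)%E]].

Definition hausdorff {R : realType} {n : nat} (d : nat) (A : set 'rV[R]_n)
  : \bar R :=
  ereal_sup [set hausdorff_pre d delta A | delta in [set delta : R | 0 < delta]].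

(** integral of a nonnegative function g over M w.r.t. H^d restricted to M,
    via the layer-cake formula  int g dH = int_0^oo H^d(M `&` {g > t}) dt *)
Definition hint {R : realType} {n : nat} (d : nat) (M : set 'rV[R]_n)
  (g : 'rV[R]_n -> R) : \bar R :=
  (\int[lebesgue_measure]_(t in [set t : R | (0 < t)%R])
      hausdorff d (M `&` [set x | (t < g x)%R]))%E.

Definition expect {R : realType} {n : nat} (d : nat) (M : set 'rV[R]_n)
  (f : 'rV[R]_n -> R) (r : 'rV[R]_n -> R) : R :=
  fine (hint d M (fun x => Num.max (r x) 0 * f x))
  - fine (hint d M (fun x => Num.max (- r x) 0 * f x)).

(** The fixed point model D^{n,d}_rch(fmin, fmax, L; 0): the distribution D
    is given by its support M and its density f w.r.t. H^d restricted to M. *)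
Definition in_model {R : realType} {n : nat} (d : nat) (rch fmin fmax L : R)
  (M : set 'rV[R]_n) (f : 'rV[R]_n -> R) : Prop :=
  [/\ manifold_class d rch M, M 0,
      (forall x, M x -> fmin <= f x <= fmax),
      (forall x y, M x -> M y -> `|f x - f y| <= L * enorm (x - y)) &
      hint d M f = 1%E].

Definition borel_set {R : realType} {n : nat} (A : set 'rV[R]_n) : Prop :=
  <<s [set O : set 'rV[R]_n | open O] >> A.

Definition valid_query {R : realType} {n : nat} (r : 'rV[R]_n -> R) : Prop :=
  (forall x, -1 <= r x <= 1) /\
  (forall U : set R, open U -> borel_set (r @^-1` U)).

(** deterministic SQ algorithm: next query and output as functions of the
    answers received so far *)
Record sq_alg (R : realType) (n : nat) := SQAlg {
  sq_query : seq R -> ('rV[R]_n -> R);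
  sq_output : seq R -> set 'rV[R]_n }.

Definition sq_alg_valid {R : realType} {n : nat} (A : sq_alg R n) : Prop :=
  forall h, valid_query (sq_query A h).

(** an adversarial oracle answers a query knowing the whole transcript *)
Definition oracle (R : realType) (n : nat) :=
  seq (('rV[R]_n -> R) * R) -> ('rV[R]_n -> R) -> R.

Definition valid_oracle {R : realType} {n : nat} (d : nat) (M : set 'rV[R]_n)
  (f : 'rV[R]_n -> R) (tau : R) (O : oracle R n) : Prop :=
  forall h r, valid_query r -> `|O h r - expect d M f r| <= tau.

Fixpoint transcript {R : realType} {n : nat} (A : sq_alg R n) (O : oracle R n)
  (k : nat) : seq (('rV[R]_n -> R) * R) :=
  match k with
  | 0 => [::]
  | k'.+1 => let h := transcript A O k' in
             let r := sq_query A (map snd h) in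
             rcons h (r, O h r)
  end.

Definition sq_run {R : realType} {n : nat} (A : sq_alg R n) (O : oracle R n)
  (q : nat) : set 'rV[R]_n :=
  sq_output A (map snd (transcript A O q)).

Definition hausdorff_dist {R : realType} {n : nat} (K K' : set 'rV[R]_n)
  : \bar R :=
  ereal_sup [set `|(dist_set x K - dist_set x K')%E|%E | x in [set: 'rV[R]_n]].

(** A randomized SQ algorithm (a probability P on Omega, drawing the
    deterministic q-query algorithm A w) estimates Supp(D) over the fixed
    point model with precision eps and probability of success 1 - alpha,
    using q queries to STAT(tau). *)
Definition rand_sq_estimates {R : realType} {n : nat} (d : nat)
  (rch fmin fmax L : R) (q : nat) (eps tau alpha : R)
  {dO : measure_display} {Omega : measurableType dO}
  (P : probability Omega R) (A : Omega -> sq_alg R n) : Prop :=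
  (forall w, sq_alg_valid (A w)) /\
  forall (M : set 'rV[R]_n) (f : 'rV[R]_n -> R),
    in_model d rch fmin fmax L M f ->
    forall O : oracle R n, valid_oracle d M f tau O ->
      exists E : set Omega,
        [/\ measurable E,
            (forall w, E w -> (hausdorff_dist M (sq_run (A w) O q) <= eps%:E)%E) &
            ((1 - alpha)%:E <= P E)%E].

(* Main.v *)
(* A family of manifolds of the model, pairwise so far apart that no set is
   within eps of two of them, has at most (1 + 1/tau)^q / (1 - alpha) members:
   the oracle may round every expectation, which lies in [-1, 1], to the nearest
   of the K <= 1 + 1/tau centres of a grid of half-width tau, so a deterministic
   algorithm has at most K^q outputs, and for a fixed draw of the algorithm each
   output serves at most one member.

   The members are spheres of radius r > rch with bumps of height 10 eps and
   radius 40 sqrt(eps rch) at separated sites.  The displacement at a site is a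
   vector of the unit ball of the (n - d)-dimensional normal space taken from a
   code of 4^(n - d) points at mutual distance > 1/4; since a competing surface is
   tangent to the sphere up to second order, distinct code words stay distinct at
   scale eps.  The radius is fixed by H^d(sphere of radius r) = 15 / (16 fmin),
   which makes the constant density admissible.

   No Lebesgue measure on R^n is used.  Volume arguments go through one
   statement: if a combination of indicators of balls is nonnegative everywhere,
   so is the same combination of r_i^n; it is proved by slicing, reducing to
   dimension one.  It yields packing and covering counts and, with a greedy
   covering, the bound on the Hausdorff measure of the sphere. *)
Require Import Defs.
From HB Require Import structures.
From mathcomp Require Import all_boot all_order all_algebra.
From mathcomp Require Import all_classical all_reals all_analysis.
From mathcomp Require Import ring lra zify.
Import Order.TTheory GRing.Theory Num.Theory.
Import numFieldNormedType.Exports.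
Local Open Scope classical_set_scope.
Local Open Scope ring_scope.

Set Implicit Arguments.
Unset Strict Implicit.
Unset Printing Implicit Defensive.

(** * Euclidean norm and inner product *)

(** Everything is scaled to the unit sphere, with [rho] = rch / r and [u] = sqrt (eps / rch): a bump
    has height 10 [u]^2 [rho] and radius 40 [u] [rho], hence slope 3 [u], which is negligible, and
    second-order coefficient 1 / (20 [rho]), which does not shrink with eps. This curvature is paid
    for by the slack r >= 9/8 rch. The hypothesis on the sphere area gives that slack: its factor
    2^(d+1) absorbs (9/8)^d and the polynomial loss in the covering bound for H^d of the sphere. The
    exact value of that measure is never computed; r is defined through it, and only its positivity
    and an upper bound enter.

    The factor n is a product of two counts. A net of the sphere with separation s has at least (d +
    1) / (2 s)^d sites, and the code contributes (n - d) ln 4 per site to the logarithm; (d + 1) (n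
    - d) >= n. The constant 2^21 dominates 1440^2, where 1440 = 160 * 9: 160 comes from the
    separation 80 [u] [rho], and 9^d absorbs the factor (d + 1)^2 of the covering bound. *)

Lemma ler_of_sqr (R : realDomainType) (a b : R) : 0 <= b -> a ^+ 2 <= b ^+ 2 -> a <= b.
Proof.
move=> b0 h; have [/ltW a0|a0] := ltP a 0; first exact: le_trans b0.
by rewrite ler_sqr in h; rewrite ?nnegrE.
Qed.

Section Euclid.
Context {R : realType}.

Definition dotp {n} (x y : 'rV[R]_n) : R := \sum_(i < n) x ord0 i * y ord0 i.

Context {n : nat}.
Implicit Types (x y z : 'rV[R]_n) (a b : R).

Lemma dotpC x y : dotp x y = dotp y x.
Proof. by apply: eq_bigr => i _; rewrite mulrC. Qed.

Lemma dotpDl x y z : dotp (x + y) z = dotp x z + dotp y z.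
Proof. by rewrite /dotp -big_split; apply: eq_bigr => i _; rewrite !mxE mulrDl. Qed.

Lemma dotpZl a x z : dotp (a *: x) z = a * dotp x z.
Proof. by rewrite /dotp mulr_sumr; apply: eq_bigr => i _; rewrite !mxE mulrA. Qed.

Lemma dotpNl x z : dotp (- x) z = - dotp x z.
Proof. by rewrite -scaleN1r dotpZl mulN1r. Qed.

Lemma dotpBl x y z : dotp (x - y) z = dotp x z - dotp y z.
Proof. by rewrite dotpDl dotpNl. Qed.

Lemma dotpDr x y z : dotp z (x + y) = dotp z x + dotp z y.
Proof. by rewrite !(dotpC z) dotpDl. Qed.

Lemma dotpZr a x z : dotp z (a *: x) = a * dotp z x.
Proof. by rewrite !(dotpC z) dotpZl. Qed.

Lemma dotpNr x z : dotp z (- x) = - dotp z x.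
Proof. by rewrite !(dotpC z) dotpNl. Qed.

Lemma dotpBr x y z : dotp z (x - y) = dotp z x - dotp z y.
Proof. by rewrite dotpDr dotpNr. Qed.

Lemma dotp0l z : dotp 0 z = 0.
Proof. by rewrite /dotp big1 // => i _; rewrite mxE mul0r. Qed.

Lemma dotp0r z : dotp z 0 = 0.
Proof. by rewrite dotpC dotp0l. Qed.

Definition dotpE := (dotpDl, dotpDr, dotpBl, dotpBr, dotpZl, dotpZr, dotpNl,
  dotpNr, dotp0l, dotp0r).

Lemma dotp_sqrD x y : dotp (x + y) (x + y) = dotp x x + 2 * dotp x y + dotp y y.
Proof. by rewrite !dotpDl !dotpDr (dotpC y x); ring. Qed.

Lemma dotp_ge0 x : 0 <= dotp x x.
Proof. by apply: sumr_ge0 => i _; rewrite -expr2 sqr_ge0. Qed.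

Lemma enormE x : enorm x = Num.sqrt (dotp x x).
Proof. by rewrite /enorm; congr Num.sqrt; apply: eq_bigr => i _; rewrite expr2. Qed.

Lemma enorm_sq x : enorm x ^+ 2 = dotp x x.
Proof. by rewrite enormE sqr_sqrtr // dotp_ge0. Qed.

Lemma enorm_ge0 x : 0 <= enorm x.
Proof. by rewrite sqrtr_ge0. Qed.

Lemma dotp_eq0 x : dotp x x = 0 -> x = 0.
Proof.
move=> x0; apply/rowP => i; rewrite mxE.
have h (j : 'I_n) : true -> 0 <= x ord0 j * x ord0 j by rewrite -expr2 sqr_ge0.
by have /(_ i isT)/eqP := psumr_eq0P h x0; rewrite mulf_eq0 orbb => /eqP.
Qed.

Lemma enorm_eq0 x : enorm x = 0 -> x = 0.
Proof. by move=> x0; apply: dotp_eq0; rewrite -enorm_sq x0 expr0n. Qed.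

Lemma enorm0 : enorm (0 : 'rV[R]_n) = 0.
Proof. by rewrite enormE dotp0l sqrtr0. Qed.

Lemma enorm_gt0 x : x != 0 -> 0 < enorm x.
Proof.
by move=> x0; rewrite lt_def enorm_ge0 andbT; apply: contra x0 => /eqP/enorm_eq0 ->.
Qed.

Lemma enormZ a x : enorm (a *: x) = `|a| * enorm x.
Proof. by rewrite !enormE dotpZl dotpZr mulrA -expr2 sqrtrM ?sqr_ge0// sqrtr_sqr. Qed.

Lemma enormN x : enorm (- x) = enorm x.
Proof. by rewrite -scaleN1r enormZ normrN1 mul1r. Qed.

Lemma enormB x y : enorm (x - y) = enorm (y - x).
Proof. by rewrite -opprB enormN. Qed.

Lemma dotp_le x y : dotp x y <= enorm x * enorm y.
Proof.
have [->|x0] := eqVneq x 0; first by rewrite dotp0l enorm0 mul0r.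
have [->|y0] := eqVneq y 0; first by rewrite dotp0r enorm0 mulr0.
have xp := enorm_gt0 x0; have yp := enorm_gt0 y0.
have := dotp_ge0 (enorm y *: x - enorm x *: y).
rewrite !dotpE -!enorm_sq (dotpC y x) => h.
rewrite -(ler_pM2l (mulr_gt0 xp yp)); nra.
Qed.

Lemma dotp_norm_le x y : `|dotp x y| <= enorm x * enorm y.
Proof. by rewrite ler_norml lerNl -dotpNl -{1}(enormN x) !dotp_le. Qed.

Lemma enormD x y : enorm (x + y) <= enorm x + enorm y.
Proof.
rewrite -ler_sqr ?nnegrE ?addr_ge0 ?enorm_ge0// enorm_sq sqrrD !enorm_sq !dotpE.
have := dotp_le x y; rewrite (dotpC y x); lra.
Qed.

Lemma enorm_sub x y z : enorm (x - z) <= enorm (x - y) + enorm (y - z).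
Proof. by have := enormD (x - y) (y - z); rewrite addrA subrK. Qed.

Lemma enormBl x y : enorm x - enorm y <= enorm (x - y).
Proof. by rewrite lerBlDr -{1}(subrK y x) enormD. Qed.

Lemma enorm_sum I (r : seq I) (P : pred I) (F : I -> 'rV[R]_n) :
  enorm (\sum_(i <- r | P i) F i) <= \sum_(i <- r | P i) enorm (F i).
Proof.
elim/big_rec2: _ => [|i y x _ h]; first by rewrite enorm0.
by apply: le_trans (enormD _ _) _; rewrite lerD2l.
Qed.

Lemma coord_le_enorm x i : `|x ord0 i| <= enorm x.
Proof.
rewrite -ler_sqr ?nnegrE ?enorm_ge0// enorm_sq real_normK ?num_real//.
rewrite /dotp (bigD1 i)//= -expr2 lerDl.
by apply: sumr_ge0 => j _; rewrite -expr2 sqr_ge0.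
Qed.

End Euclid.

Section EuclidBlocks.
Context {R : realType}.

Lemma dotp_row_mx m n (a c : 'rV[R]_m) (b e : 'rV[R]_n) :
  dotp (row_mx a b) (row_mx c e) = dotp a c + dotp b e.
Proof.
rewrite /dotp big_split_ord/=; congr (_ + _); apply: eq_bigr => i _.
  by rewrite !row_mxEl.
by rewrite !row_mxEr.
Qed.

Lemma enorm_row_mx0 m n (a : 'rV[R]_m) : enorm (row_mx a (0 : 'rV[R]_n)) = enorm a.
Proof. by rewrite !enormE dotp_row_mx dotp0l addr0. Qed.

Lemma row_mxB m n (a c : 'rV[R]_m) (b e : 'rV[R]_n) :
  row_mx a b - row_mx c e = row_mx (a - c) (b - e).
Proof. by rewrite opp_row_mx add_row_mx. Qed.

Lemma dotp_scalar (s t : R) : dotp (s%:M : 'rV_1) t%:M = s * t.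
Proof. by rewrite /dotp big_ord1 !mxE eqxx !mulr1n. Qed.

End EuclidBlocks.

(** * Volume inequalities for balls *)

Section Slices.
Context {R : realType}.
Notation mu := (@lebesgue_measure R).

(** The primitive turns the comparison of integrals of slices into monotonicity of a differentiable
    function. Vanishing outside [-1, 1] makes [phi] integrable on half-lines, as the fundamental
    theorem of calculus asks. *)
Lemma compact_support_primitive (phi : R -> R) :
  continuous phi -> (forall x, 1 <= `|x| -> phi x = 0) ->
  exists F : R -> R, forall x : R, is_derive x (1:R) F (phi x).
Proof.
move=> cphi phi0.
have iphi (u : R) : mu.-integrable `]-oo, u] (EFin \o phi).
  have : mu.-integrable setT (EFin \o phi).
    have -> : EFin \o phi = (EFin \o phi) \_ `[(-1 : R), 1].
      apply/funext => x /=; rewrite patchE; case: ifPn => //.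
      rewrite notin_setE/= in_itv/= => /negP h; rewrite phi0//.
      by rewrite leNgt; apply: contra h => /ltW; rewrite ler_norml.
    apply: (iffLR (@integrable_mkcond _ _ R mu `[(-1 : R), 1] (EFin \o phi) _)) => //.
    apply: continuous_compact_integrable; first exact: segment_compact.
    exact: continuous_subspaceT.
  by apply: integrableS.
exists (fun x => (\int[mu]_(t in `]-oo, x]) (phi t))%R) => x.
have xx : x < x + 1 by rewrite ltrDl.
have [dF F'] := continuous_FTC1 xx (iphi _) (ltNyr x) (cphi x).
by apply: (DeriveDef dF); rewrite -derive1E F'.
Qed.

Lemma is_derive_bigsum (I : Type) (l : seq I) (f df : I -> R -> R) (t : R) :
  (forall i, is_derive t (1:R) (f i) (df i t)) ->
  is_derive t (1:R) (fun t => \sum_(i <- l) f i t) (\sum_(i <- l) df i t).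
Proof.
move=> h; elim: l => [|i l IH].
  rewrite big_nil (_ : (fun _ => _) = cst 0); first exact: is_derive_cst.
  by apply/funext => x; rewrite big_nil.
rewrite big_cons (_ : (fun _ => _) = f i + (fun t => \sum_(i <- l) f i t)).
  exact: is_deriveD.
by apply/funext => x; rewrite big_cons.
Qed.

Lemma is_derive_nondecreasing (f df : R -> R) (a b : R) :
  (forall x : R, is_derive x (1:R) f (df x)) ->
  (forall x, a < x < b -> 0 <= df x) -> a <= b -> f a <= f b.
Proof.
move=> fdf df0 ab.
have cf : {within `[a, b], continuous f}.
  apply: continuous_subspaceT => x; apply/differentiable_continuous.
  by apply/derivable1_diffP; have [] := fdf x.
have [->//|ab'] := eqVneq a b.
have {}ab : a < b by rewrite lt_neqAle ab'.
have [c' cab' e'] := MVT ab (fun x _ => fdf x) cf.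
rewrite -subr_ge0 e' mulr_ge0 ?subr_ge0 ?(ltW ab)//.
by apply: df0 => //; rewrite in_itv/= in cab'.
Qed.

Lemma is_derive_eq0 (f df : R -> R) (a b : R) :
  (forall x : R, is_derive x (1:R) f (df x)) ->
  (forall x, a < x < b -> df x = 0) -> a <= b -> f b = f a.
Proof.
move=> fdf df0 ab.
have cf : {within `[a, b], continuous f}.
  apply: continuous_subspaceT => x; apply/differentiable_continuous.
  by apply/derivable1_diffP; have [] := fdf x.
have [->//|ab'] := eqVneq a b.
have {}ab : a < b by rewrite lt_neqAle ab'.
have [c' cab' e'] := MVT ab (fun x _ => fdf x) cf.
by apply/eqP; rewrite -subr_eq0 e' df0 ?mul0r//; rewrite in_itv/= in cab'.
Qed.

(** Each summand is a rescaled copy of the profile [phi] u = sqrt (1 - u^2)^(s+1): its integral is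
    [r i]^(s+2) times the integral of [phi], a positive constant common to all i. The sum of the
    primitives is nondecreasing, and its total increment is the claimed sum times that constant. *)
Lemma bump_nonneg_sum (s : nat) (I : eqType) (l : seq I) (a c r : I -> R) :
  (forall i, 0 <= r i) ->
  (forall t, 0 <= \sum_(i <- l) a i * Num.sqrt (r i ^+ 2 - (t - c i) ^+ 2) ^+ s.+1) ->
  0 <= \sum_(i <- l) a i * r i ^+ s.+2.
Proof.
move=> r0 h.
pose phi (u : R) : R := Num.sqrt (1 - u ^+ 2) ^+ s.+1.
have cphi : continuous phi.
  move=> x; apply: (@continuous_comp _ _ _ (fun u : R => Num.sqrt (1 - u ^+ 2)) (fun u => u ^+ s.+1)).
    apply: (@continuous_comp _ _ _ (fun u : R => 1 - u ^+ 2) Num.sqrt); last exact: sqrt_continuous.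
    by apply: cvgB; [exact: cvg_cst|exact: exprn_continuous].
  exact: exprn_continuous.
have phi0 x : 1 <= `|x| -> phi x = 0.
  move=> x1; rewrite /phi ler0_sqrtr ?expr0n// subr_le0 -[leRHS]real_normK ?num_real//.
  by rewrite exprn_ege1.
have phi_ge0 x : 0 <= phi x by rewrite /phi exprn_ge0 ?sqrtr_ge0.
have [F dF] := compact_support_primitive cphi phi0.
have F1 u : 1 <= u -> F u = F 1.
  move=> u1; apply: (is_derive_eq0 dF) => // x /andP[x1 _].
  by rewrite phi0// ger0_norm ltW//; apply: lt_trans x1.
have FN1 u : u <= -1 -> F u = F (-1).
  move=> u1; apply/esym; apply: (is_derive_eq0 dF) => // x /andP[_ x1].
  rewrite phi0//; have x0 : x <= 0 by rewrite ltW// (lt_trans x1)// ltrN10.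
  by rewrite ler0_norm// lerNr ltW.
(* The integral of [phi] is positive because [phi] is positive on [-1/2, 1/2]. *)
have J0 : 0 < F 1 - F (-1).
  rewrite subr_gt0.
  have cF : {within `[(-1/2 : R), 1/2], continuous F}.
    apply: continuous_subspaceT => x; apply/differentiable_continuous.
    by apply/derivable1_diffP; have [] := dF x.
  have half : (-1/2 : R) < 1/2 by lra.
  have [x] := MVT half (fun x _ => dF x) cF.
  rewrite in_itv/= => /andP[x1 x2] e.
  have p : 0 < phi x * (1/2 - -1/2).
    rewrite mulr_gt0 ?subr_gt0// exprn_gt0// sqrtr_gt0; nra.
  have l1 : F (-1) <= F (-1/2) by apply: (is_derive_nondecreasing dF) => //; lra.
  have l2 : F (1/2) <= F 1 by apply: (is_derive_nondecreasing dF) => //; lra.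
  lra.
pose G t := \sum_(i <- l) a i * (r i ^+ s.+2 * F ((t - c i) / r i)).
pose dG t := \sum_(i <- l) a i * Num.sqrt (r i ^+ 2 - (t - c i) ^+ 2) ^+ s.+1.
have GdG (t : R) : is_derive t (1:R) G (dG t).
  apply: (@is_derive_bigsum _ _ (fun i t => a i * (r i ^+ s.+2 * F ((t - c i) / r i)))
    (fun i t => a i * Num.sqrt (r i ^+ 2 - (t - c i) ^+ 2) ^+ s.+1)) => i.
  (* For [r i] = 0 the factor [r i ^+ s.+2] and the square root both vanish. *)
  have [ri0|ri0] := eqVneq (r i) 0.
    rewrite ri0 !expr0n/= sub0r ler0_sqrtr ?oppr_le0 ?sqr_ge0// expr0n/= mulr0.
    rewrite (_ : (fun _ => _) = cst 0); first exact: is_derive_cst.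
    by apply/funext => x; rewrite mul0r mulr0.
  have rp : 0 < r i by rewrite lt_def ri0 r0.
  have d1 : is_derive t (1:R) (fun t : R => (t - c i) / r i) (r i)^-1.
    have := is_deriveZ (r i)^-1 (is_deriveB (is_derive_id t (1:R)) (is_derive_cst (c i) t (1:R))).
    rewrite subr0; congr (is_derive _ _ _ _).
      by apply/funext => x /=; rewrite mulrC.
    by rewrite /GRing.scale/= mulr1.
  have d2 := @is_derive1_comp R F (fun t : R => (t - c i) / r i) t _ _ (dF ((t - c i) / r i)) d1.
  have := is_deriveZ (a i * r i ^+ s.+2) d2.
  congr (is_derive _ _ _ _).
    by apply/funext => x /=; rewrite /GRing.scale/= mulrA.
  transitivity (a i * r i ^+ s.+2 * (phi ((t - c i) / r i) * (r i)^-1)) => //.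
  rewrite -[LHS]mulrA; congr (_ * _); rewrite /phi.
  have -> : r i ^+ 2 - (t - c i) ^+ 2 = r i ^+ 2 * (1 - ((t - c i) / r i) ^+ 2).
    by field.
  rewrite sqrtrM ?sqr_ge0// sqrtr_sqr ger0_norm//.
  move: (Num.sqrt (1 - _)) => w; rewrite exprMn.
  have -> : r i ^+ s.+2 = r i ^+ s.+1 * r i by rewrite exprSr.
  by rewrite -mulrA; congr (_ * _); rewrite mulrCA mulfV// mulr1.
(* At [T] and [-T] all supports are left behind, so each [F] has reached its end values. *)
have [T [T0 hT]] : exists T, 0 <= T /\ forall i, i \in l -> `|c i| + r i <= T.
  exists (\sum_(i <- l) (`|c i| + r i)); split.
    by apply: sumr_ge0 => i _; rewrite addr_ge0.
  move=> i il; rewrite (big_rem i)//= lerDl.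
  by apply: sumr_ge0 => j _; rewrite addr_ge0.
have : G (-T) <= G T.
  by apply: (is_derive_nondecreasing GdG) => [x _|]; [exact: h|lra].
rewrite -subr_ge0 /G -sumrB.
have -> : \sum_(i <- l) (a i * (r i ^+ s.+2 * F ((T - c i) / r i)) -
    a i * (r i ^+ s.+2 * F ((- T - c i) / r i))) =
   (\sum_(i <- l) a i * r i ^+ s.+2) * (F 1 - F (-1)).
  rewrite mulr_suml; apply: eq_big_seq => i /hT ciT.
  have [ri0|ri0] := eqVneq (r i) 0; first by rewrite ri0 expr0n/= !(mul0r,mulr0) subrr.
  have rp : 0 < r i by rewrite lt_def ri0 r0.
  have := ler_norm (c i); have := ler_norm (- c i); rewrite normrN => c1 c2.
  rewrite F1; last by rewrite ler_pdivlMr// mul1r; lra.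
  rewrite [F ((-T - c i) / r i)]FN1; last by rewrite ler_pdivrMr//; lra.
  by ring.
by rewrite pmulr_lge0.
Qed.

(** Dimension one: an indicator is discontinuous and has no primitive valid everywhere, so the sum
    is integrated directly, an interval of radius [r i] contributing 2 [r i]. *)
Lemma interval_nonneg_sum (I : Type) (l : seq I) (a c r : I -> R) :
  (forall i, 0 <= r i) ->
  (forall t : R, 0 <= \sum_(i <- l) a i * (`|t - c i| <= r i)%R%:R) ->
  0 <= \sum_(i <- l) a i * r i.
Proof.
move=> r0 h.
pose f i (t : R) : R := a i * \1_(`[c i - r i, c i + r i]) t.
have fE i t : f i t = a i * (`|t - c i| <= r i)%R%:R.
  rewrite /f indicE; congr (_ * _%:R); congr nat_of_bool.
  apply/idP/idP; rewrite inE/= in_itv/= ler_distl//.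
have i1 i : mu.-integrable setT (EFin \o \1_(`[c i - r i, c i + r i])).
  exact: integrable_indic_itv.
have i2 i : mu.-integrable setT (EFin \o f i).
  exact: (integrableZl _ (a i) (i1 i)).
have [fi fE2] : mu.-integrable setT (fun t => (\sum_(i <- l) f i t)%:E) /\
   (\int[mu]_t (\sum_(i <- l) f i t)%:E = (2 * \sum_(i <- l) a i * r i)%:E)%E.
  elim: l {h} => [|i l [IH1 IH2]].
    split.
      have -> : (fun t => (\sum_(i <- [::]) f i t)%:E) = cst 0%E :> (R -> \bar R).
        by apply/funext => t; rewrite big_nil.
      exact: integrable0.
    by under eq_integral do rewrite big_nil; rewrite integral0 big_nil mulr0.
  pose g (t : R) : \bar R := (\sum_(j <- l) f j t)%:E.
  have E : (fun t => (\sum_(j <- i :: l) f j t)%:E) = (fun t => (f i t)%:E + g t)%E.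
    by apply/funext => t /=; rewrite big_cons EFinD.
  split; first by rewrite E; apply: integrableD => //; exact: i2.
  rewrite E integralD//; last exact: i2.
  rewrite /g IH2 big_cons mulrDr EFinD; congr (_ + _)%E.
  under eq_integral do rewrite /f EFinM.
  rewrite integralZl//; last exact: i1.
  rewrite integral_indic//= setIT lebesgue_measure_itv/=.
  have [ri|ri] := ltP (c i - r i) (c i + r i).
    by rewrite lte_fin ri -EFinD -EFinM; congr _%:E; ring.
  have -> : r i = 0 by have := r0 i; lra.
  by rewrite lte_fin !addr0 subr0 ltxx mule0 !mulr0.
have : (0 <= \int[mu]_t (\sum_(i <- l) f i t)%:E)%E.
  apply: integral_ge0 => t _; rewrite lee_fin.
  by under eq_bigr do rewrite fE; exact: h.
by rewrite fE2 lee_fin pmulr_rge0.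
Qed.

End Slices.

Section BallSums.
Context {R : realType}.

(** For s > 0 the square root already vanishes outside the interval; for s = 0 its power is the
    constant 1 and the indicator alone carries the slice. *)
Lemma slice_nonneg_sum (s : nat) (I : eqType) (l : seq I) (a c r : I -> R) :
  (forall i, 0 <= r i) ->
  (forall t : R, 0 <= \sum_(i <- l) a i * ((`|t - c i| <= r i)%R%:R *
                     Num.sqrt (r i ^+ 2 - (t - c i) ^+ 2) ^+ s)) ->
  0 <= \sum_(i <- l) a i * r i ^+ s.+1.
Proof.
case: s => [|s] r0 h.
  apply: (@interval_nonneg_sum R _ l a c r r0) => t.
  by have := h t; under eq_bigr do rewrite expr0 mulr1.
apply: (@bump_nonneg_sum R s _ l a c r r0) => t.
have := h t; congr (_ <= _); apply: eq_bigr => i _; congr (_ * _).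
have [_|ri] := leP `|t - c i| (r i); first by rewrite mul1r.
rewrite mul0r ler0_sqrtr ?expr0n// subr_le0 -[leRHS]real_normK ?num_real//.
by rewrite ler_sqr ?nnegrE// ltW.
Qed.

Lemma ball_nonneg_sum (D : nat) (I : eqType) (l : seq I) (a : I -> R)
    (x : I -> 'rV[R]_D) (r : I -> R) :
  (forall i, 0 <= r i) ->
  (forall y, 0 <= \sum_(i <- l) a i * (enorm (y - x i) <= r i)%R%:R) ->
  0 <= \sum_(i <- l) a i * r i ^+ D.
Proof.
elim: D a x r => [|D IH] a x r r0 h.
  have := h 0; congr (_ <= _); apply: eq_bigr => i _; rewrite expr0.
  by rewrite /enorm big_ord0 sqrtr0 r0.
pose c i : R := @lsubmx R 1 1 D (x i) ord0 ord0.
apply: (@slice_nonneg_sum D I l a c r r0) => t.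
(* [Num.sqrt] is 0 at negative arguments, so an empty slice would be read as a ball of radius 0; the
   indicator in [a'] removes it. *)
pose a' i : R := a i * (`|t - c i| <= r i)%R%:R.
pose x' i := @rsubmx R 1 1 D (x i).
pose r' i : R := Num.sqrt (r i ^+ 2 - (t - c i) ^+ 2).
have := IH a' x' r' (fun i => sqrtr_ge0 _).
under [X in _ -> 0 <= X]eq_bigr do rewrite mulrA.
apply => y.
have := h (row_mx (t%:M : 'rV_1) y); congr (_ <= _); apply: eq_bigr => i _.
rewrite /a' -mulrA; congr (_ * _).
have Ex : x i = row_mx (c i)%:M (x' i) by rewrite -mx11_scalar hsubmxK.
have -> : (row_mx (t%:M : 'rV_1) y : 'rV_(D.+1)) - x i = row_mx (t - c i)%:M (y - x' i).
  have <- : t%:M - (c i)%:M = (t - c i)%:M :> 'rV[R]_1.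
    by apply/matrixP => j k; rewrite !mxE mulrnBl.
  rewrite {1}Ex; exact: (@row_mxB R 1 D).
have E : enorm (row_mx (t - c i)%:M (y - x' i)) ^+ 2 =
    (t - c i) ^+ 2 + enorm (y - x' i) ^+ 2.
  by rewrite !enorm_sq dotp_row_mx dotp_scalar expr2.
rewrite -natrM mulnb; congr (_ %:R); congr nat_of_bool.
rewrite -ler_sqr ?nnegrE ?enorm_ge0// E.
have r'E : (t - c i) ^+ 2 <= r i ^+ 2 -> r' i ^+ 2 = r i ^+ 2 - (t - c i) ^+ 2.
  by move=> h1; rewrite /r' sqr_sqrtr ?subr_ge0.
have r'0 : 0 <= r' i by exact: sqrtr_ge0.
apply/idP/andP => [h1|[h1 h2]].
  have q0 := sqr_ge0 (enorm (y - x' i)).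
  have h3 : (t - c i) ^+ 2 <= r i ^+ 2 by apply: le_trans h1; rewrite lerDl.
  split; first by rewrite -ler_sqr ?nnegrE// real_normK ?num_real.
  by apply: (ler_of_sqr r'0); rewrite r'E// lerBrDl.
have h3 : (t - c i) ^+ 2 <= r i ^+ 2.
  by move: h1; rewrite -ler_sqr ?nnegrE// real_normK ?num_real.
have : enorm (y - x' i) ^+ 2 <= r' i ^+ 2 by rewrite ler_sqr ?nnegrE// enorm_ge0.
by rewrite r'E// lerBrDl.
Qed.

Implicit Types D : nat.

Lemma ball_sum_le D (s t : seq (R * 'rV[R]_D * R)) :
  (forall p, p \in s -> 0 <= p.2) -> (forall p, p \in t -> 0 <= p.2) ->
  (forall y, \sum_(p <- s) p.1.1 * (enorm (y - p.1.2) <= p.2)%R%:R <=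
             \sum_(p <- t) p.1.1 * (enorm (y - p.1.2) <= p.2)%R%:R) ->
  \sum_(p <- s) p.1.1 * p.2 ^+ D <= \sum_(p <- t) p.1.1 * p.2 ^+ D.
Proof.
move=> s0 t0 h; rewrite -subr_ge0.
pose I := (R * 'rV[R]_D * R)%type.
pose neg (p : I) : I := (- p.1.1, p.1.2, p.2).
(* [ball_nonneg_sum] wants nonnegative radii on the whole index type, hence [Num.max 0]; on the two
   lists it changes nothing. *)
have main := @ball_nonneg_sum D I (t ++ map neg s) (fun p => p.1.1)
   (fun p => p.1.2) (fun p => Num.max 0 p.2).
have E (f g : I -> R) : (forall p, p \in s -> f (neg p) = - g p) ->
    (forall p, p \in t -> f p = g p) ->
   \sum_(p <- t ++ map neg s) f p = \sum_(p <- t) g p - \sum_(p <- s) g p.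
  move=> fn fg; rewrite big_cat big_map -sumrN; congr (_ + _).
    by apply: eq_big_seq.
  by apply: eq_big_seq.
rewrite (E _ (fun p => p.1.1 * p.2 ^+ D)) in main; last 2 first.
- by move=> p /s0 ps /=; rewrite max_r// mulNr.
- by move=> p /t0 ps /=; rewrite max_r.
apply: main => [i|y]; first by rewrite le_max lexx.
rewrite (E _ (fun p => p.1.1 * (enorm (y - p.1.2) <= p.2)%R%:R)); last 2 first.
- by move=> p /s0 ps /=; rewrite max_r// mulNr.
- by move=> p /t0 ps /=; rewrite max_r.
by rewrite subr_ge0.
Qed.

Lemma sum_indic_count (T : Type) (X : seq T) (P : pred T) :
  \sum_(x <- X) (P x)%:R = (count P X)%:R :> R.
Proof. by rewrite -sum1_count [in RHS]big_mkcond natr_sum; apply: eq_bigr => x _; case: (P x). Qed.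

Lemma sum_const_size (T : Type) (X : seq T) (c : R) : \sum_(x <- X) c = (size X)%:R * c.
Proof. by rewrite big_const_seq count_predT iter_addr addr0 mulr_natl. Qed.

(** The indicator of the shell a < |y| <= b, written as a difference of two balls and multiplied by
    [m], dominates the sum of the indicators of the balls about [X]. *)
Lemma ball_le_count D (X : seq 'rV[R]_D) (a b m r : R) :
  0 <= a -> 0 <= b -> 0 <= r ->
  (forall y, enorm y <= b -> a < enorm y ->
     (count (fun x => (enorm (y - x) <= r)%R) X)%:R <= m) ->
  (forall y, (exists2 x, x \in X & enorm (y - x) <= r) ->
      a < enorm y <= b) -> a <= b -> 0 <= m ->
  (size X)%:R * r ^+ D <= m * (b ^+ D - a ^+ D).
Proof.
move=> a0 b0 r0 hm hX ab m0.
have := @ball_sum_le D [seq (1, x, r) | x <- X] [:: (m, 0, b); (- m, 0, a)].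
rewrite big_map !big_cons !big_nil/= addr0 mulNr -mulrBr.
under eq_bigr do rewrite mul1r.
rewrite sum_const_size; apply.
- by move=> p /mapP[x _ ->].
- by move=> p; rewrite !inE => /orP[]/eqP->.
move=> y; rewrite big_map !big_cons !big_nil/= !subr0 addr0.
under eq_bigr do rewrite mul1r.
rewrite sum_indic_count.
have [/hasP[x xX xy]|/hasPn nX] := boolP (has (fun x => enorm (y - x) <= r) X).
  have /andP[ay yb] : a < enorm y <= b by apply: hX; exists x.
  by rewrite yb (leNgt (enorm y) a) ay mulr1 mulr0 addr0; exact: hm.
rewrite (_ : count _ _ = 0%N); last first.
  by apply/eqP; rewrite -leqn0 leqNgt -has_count; apply/hasPn.
have [ya|ya] := leP (enorm y) a; first by rewrite (le_trans ya ab) !mulr1 addrN.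
by rewrite mulr0 addr0 mulr_ge0.
Qed.

Lemma cover_ball_count D (X : seq 'rV[R]_D) (a b r : R) :
  0 <= a -> 0 <= b -> 0 <= r -> a <= b ->
  (forall y, a < enorm y -> enorm y <= b -> exists2 x, x \in X & enorm (y - x) <= r) ->
  b ^+ D - a ^+ D <= (size X)%:R * r ^+ D.
Proof.
move=> a0 b0 r0 ab h.
have -> : (size X)%:R * r ^+ D = \sum_(p <- [seq ((1 : R), x, r) | x <- X]) p.1.1 * p.2 ^+ D.
  by rewrite big_map -sum_const_size; apply: eq_bigr => x _; rewrite mul1r.
have -> : b ^+ D - a ^+ D =
    \sum_(p <- [:: ((1 : R), (0 : 'rV[R]_D), b); (- 1, 0, a)]) p.1.1 * p.2 ^+ D.
  by rewrite !big_cons big_nil/= mul1r mulN1r addr0.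
apply: ball_sum_le.
- by move=> p; rewrite !inE => /orP[]/eqP->.
- by move=> p /mapP[x _ ->].
move=> y; rewrite big_map !big_cons !big_nil/= !subr0 addr0 mul1r mulN1r.
under eq_bigr do rewrite mul1r.
rewrite sum_indic_count.
have [ya|ya] := leP (enorm y) a; first by rewrite (le_trans ya ab) addrN.
have [yb|yb] := leP (enorm y) b; last by rewrite subr0.
have [x xX xy] := h y ya yb.
by rewrite subr0 ler1n -has_count; apply/hasP; exists x.
Qed.

Lemma cover_ball_sum D (s : seq ('rV[R]_D * R)) (b : R) :
  0 <= b -> (forall p, p \in s -> 0 <= p.2) ->
  (forall y, enorm y <= b -> exists2 p, p \in s & enorm (y - p.1) <= p.2) ->
  b ^+ D <= \sum_(p <- s) p.2 ^+ D.
Proof.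
move=> b0 s0 h.
have -> : \sum_(p <- s) p.2 ^+ D = \sum_(p <- [seq ((1 : R), p.1, p.2) | p <- s]) p.1.1 * p.2 ^+ D.
  by rewrite big_map; apply: eq_bigr => x _; rewrite mul1r.
have -> : b ^+ D = \sum_(p <- [:: ((1 : R), (0 : 'rV[R]_D), b)]) p.1.1 * p.2 ^+ D.
  by rewrite big_cons big_nil/= mul1r addr0.
apply: ball_sum_le.
- by move=> p; rewrite !inE => /eqP->.
- by move=> p /mapP[x /s0 xs ->].
move=> y; rewrite big_map !big_cons !big_nil/= !subr0 addr0 mul1r.
under eq_bigr do rewrite mul1r.
rewrite (@sum_indic_count _ s (fun p => enorm (y - p.1) <= p.2)).
have [yb|yb] := leP (enorm y) b => //.
have [x xX xy] := h y yb.
by rewrite ler1n -has_count; apply/hasP; exists x.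
Qed.

End BallSums.

(** * Coverings and separated sets *)

Section PowerEstimates.
Context {R : realFieldType}.
Implicit Types (a b t x p : R) (n m : nat).

Lemma bernoulli_ge x n : -1 <= x -> 1 + n%:R * x <= (1 + x) ^+ n.
Proof.
move=> x1; elim: n => [|n IH]; first by rewrite mul0r addr0 expr0.
rewrite exprS; have h : 0 <= 1 + x by lra.
apply: le_trans (ler_wpM2l h IH); rewrite -natr1.
have : 0 <= n%:R * (x * x) by rewrite mulr_ge0// -expr2 sqr_ge0.
nra.
Qed.

Lemma expr1D_le x n : 0 <= x -> x <= 1 -> n%:R * x < 1 ->
  (1 + x) ^+ n <= (1 - n%:R * x)^-1.
Proof.
move=> x0 x1 nx; have q : 0 < 1 - n%:R * x by lra.
rewrite -[leRHS]mul1r ler_pdivlMr//.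
have h : 1 - n%:R * x <= (1 - x) ^+ n.
  by have := @bernoulli_ge (- x) n; rewrite mulrN; apply; lra.
have h1 : 0 <= (1 + x) ^+ n by rewrite exprn_ge0//; lra.
apply: le_trans (ler_wpM2l h1 h) _.
rewrite -exprMn exprn_ile1//; nra.
Qed.

Lemma half_power p m : 0 <= p -> p <= 1 -> 1 <= m%:R * p -> (1 - p) ^+ m <= 2^-1.
Proof.
move=> p0 p1 mp.
have h : 2 <= (1 + p) ^+ m by have := @bernoulli_ge p m; lra.
have h1 : 0 <= (1 - p) ^+ m by rewrite exprn_ge0//; lra.
have : (1 - p) ^+ m * (1 + p) ^+ m <= 1 by rewrite -exprMn exprn_ile1//; nra.
nra.
Qed.

Lemma subr_expr_le a b n : 0 <= a -> a <= b ->
  b ^+ n.+1 - a ^+ n.+1 <= n.+1%:R * b ^+ n * (b - a).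
Proof.
move=> a0 ab; have b0 : 0 <= b by lra.
elim: n => [|n IH]; first by rewrite expr0 mulr1 mul1r.
have an : a ^+ n.+1 <= b ^+ n.+1 by rewrite lerXn2r.
rewrite [b ^+ n.+2]exprS [a ^+ n.+2]exprS -natr1 !mulrDl mul1r.
have := ler_wpM2l a0 IH.
have : 0 <= (b - a) * (n.+1%:R * b ^+ n * (b - a)).
  by rewrite !mulr_ge0 ?exprn_ge0// subr_ge0.
rewrite [b ^+ n.+1]exprS; nra.
Qed.

(** The induction carries along (1 + t)^n + (1 - t)^n >= 2, which supplies the increment of the
    difference. *)
Lemma shell_ge t n : 0 <= t -> t <= 1 ->
  2 * n%:R * t <= (1 + t) ^+ n - (1 - t) ^+ n.
Proof.
move=> t0 t1.
suff : 2 * n%:R * t <= (1 + t) ^+ n - (1 - t) ^+ n /\ 2 <= (1 + t) ^+ n + (1 - t) ^+ n by case.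
elim: n => [|n [IH1 IH2]]; first by rewrite mulr0 mul0r !expr0 subrr; split.
have nt : 0 <= n%:R * t by rewrite mulr_ge0.
by rewrite !exprS -natr1; split; nra.
Qed.

End PowerEstimates.

Section Coverings.
Context {R : realType}.

Definition separated_seq {D} (s : R) (X : seq 'rV[R]_D) :=
  pairwise (fun x y => s < enorm (x - y)) X.

(** If no separated set were maximal, each could be enlarged by one point, eventually beyond the
    bound [B]. *)
Lemma maximal_separated D (S : set 'rV[R]_D) (s : R) (B : nat) :
  (forall X, separated_seq s X -> (forall x, x \in X -> S x) -> (size X <= B)%N) ->
  exists X, [/\ separated_seq s X, forall x, x \in X -> S x &
    forall y, S y -> exists2 x, x \in X & enorm (y - x) <= s].
Proof.
move=> hB; apply: contrapT => hn.
suff : forall n, exists X, [/\ separated_seq s X, forall x, x \in X -> S x & size X = n].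
  by move=> /(_ B.+1)[X [sX XS sz]]; have := hB X sX XS; rewrite sz ltnn.
elim=> [|n [X [sX XS sz]]]; first by exists [::].
apply: contrapT => hn'; apply: hn; exists X; split=> // y Sy.
apply: contrapT => hy; apply: hn'; exists (y :: X); split.
- rewrite /separated_seq pairwise_cons -/(separated_seq s X) sX andbT.
  apply/allP => x xX; rewrite ltNge; apply/negP => yx; apply: hy; by exists x.
- by move=> x; rewrite inE => /predU1P[->|/XS].
- by rewrite /= sz.
Qed.

Lemma separated_count_le1 D (t : R) (X : seq 'rV[R]_D) (y : 'rV[R]_D) :
  separated_seq (2 * t) X -> (count (fun x => (enorm (y - x) <= t)%R) X <= 1)%N.
Proof.
elim: X => // x X IH; rewrite /separated_seq pairwise_cons => /andP[/allP xX /IH h] /=.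
have [yx|] := leP (enorm (y - x)) t; last by rewrite add0n.
rewrite add1n ltnS leqNgt -has_count; apply/hasPn => z /xX xz.
rewrite -ltNge; have := enorm_sub x y z; rewrite (enormB x y); lra.
Qed.

Lemma separated_nth D (s : R) (X : seq 'rV[R]_D) i j : separated_seq s X ->
  (i < size X)%N -> (j < size X)%N -> i != j -> s < enorm (X`_i - X`_j).
Proof.
move=> /(pairwiseP 0) h iX jX; rewrite neq_ltn => /orP[ij|ji]; first exact: h.
by rewrite enormB; exact: h.
Qed.

Variable d : nat.
Let D := d.+1.

(** The balls of radius t about points of the sphere fill at most [m] times a shell of width 2 t.
    That shell is bounded by its width times D (1 + t)^d, and cancelling one factor t leaves the
    exponent d. *)
Lemma sphere_count_le (X : seq 'rV[R]_D) (m t : R) :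
  0 < t -> t < 1 -> 0 <= m -> (forall x, x \in X -> enorm x = 1) ->
  (forall y, (count (fun x => (enorm (y - x) <= t)%R) X)%:R <= m) ->
  (size X)%:R * t ^+ d <= m * (2 * D%:R * (1 + t) ^+ d).
Proof.
move=> t0 t1 m0 X1 hm.
have t1d : 0 <= (1 + t) ^+ d by rewrite exprn_ge0//; lra.
rewrite -(ler_pM2r t0) -[leLHS]mulrA -exprSr.
apply/ler_addgt0Pr => e e0.
pose K := m * (D%:R * (1 + t) ^+ d) + 1.
have K0 : 0 < K by rewrite ltr_wpDl// !mulr_ge0.
(* [ball_le_count] speaks of a shell open on the inside, so the inner radius is lowered by [f],
   small enough that the additional volume is at most [e]. *)
pose f := Num.min (1 - t) (e / K).
have f0 : 0 < f by rewrite lt_min divr_gt0// subr_gt0 t1.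
have f1 : f <= 1 - t by rewrite ge_min lexx.
have fe : K * f <= e by rewrite mulrC -ler_pdivlMr// ge_min lexx orbT.
have a0 : 0 <= 1 - t - f by lra.
have b0 : 0 <= 1 + t by lra.
have ab : 1 - t - f <= 1 + t by lra.
apply: le_trans (@ball_le_count R D X _ _ m t a0 b0 (ltW t0) (fun y _ _ => hm y) _ ab m0) _.
  move=> y [x /X1 x1 yx]; have := enormBl x (x - y); have := enormD (y - x) x.
  by rewrite subKr subrK x1 (enormB x y) => h1 h2; apply/andP; split; lra.
have := ler_wpM2l m0 (subr_expr_le d a0 ab).
have -> : 1 + t - (1 - t - f) = 2 * t + f by ring.
rewrite -/D; move: fe; rewrite /K; move: (_ - (1 - t - f) ^+ _) => u.
move: t1d; move: (_ ^+ d) => v v0 fe h.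
apply: le_trans h _; nra.
Qed.

Lemma separated_sphere_size (X : seq 'rV[R]_D) (t : R) :
  0 < t -> t < 1 -> (forall x, x \in X -> enorm x = 1) -> separated_seq (2 * t) X ->
  (size X)%:R * t ^+ d <= 2 * D%:R * (1 + t) ^+ d.
Proof.
move=> t0 t1 X1 sX; rewrite -[leRHS]mul1r; apply: sphere_count_le => // y.
by rewrite -[leRHS]/(1%:R) ler_nat separated_count_le1.
Qed.

(** Averaging: the largest count over all centres, attained because counts are bounded by [size X],
    serves as the [m] of [sphere_count_le]. *)
Lemma popular_center (X : seq 'rV[R]_D) (t : R) :
  0 < t -> t < 1 -> (forall x, x \in X -> enorm x = 1) ->
  exists y, (size X)%:R * t ^+ d <=
    (count (fun x => (enorm (y - x) <= t)%R) X)%:R * (2 * D%:R * (1 + t) ^+ d).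
Proof.
move=> t0 t1 X1; pose c y := count (fun x => (enorm (y - x) <= t)%R) X.
pose P (n : nat) := `[< exists y, c y = n >].
have Pex : exists n, P n by exists (c 0); apply/asboolP; exists 0.
have Pub n : P n -> (n <= size X)%N by move=> /asboolP[y <-]; exact: count_size.
case: (ex_maxnP Pex Pub) => m /asboolP[y cy] hm; exists y; rewrite -/(c y) cy.
apply: sphere_count_le => // z; rewrite ler_nat; apply: hm; apply/asboolP; by exists z.
Qed.

(** Each new centre is popular among the points still uncovered, hence covers at least a fraction
    [p] of them. *)
Lemma greedy_centers (X : seq 'rV[R]_D) (t p : R) (T : nat) :
  0 < t -> t < 1 -> (forall x, x \in X -> enorm x = 1) ->
  0 <= p -> p <= 1 -> p * (2 * D%:R * (1 + t) ^+ d) <= t ^+ d ->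
  exists Y : seq 'rV[R]_D, size Y = T /\
    (count (fun x => all (fun y => (t < enorm (y - x))%R) Y) X)%:R <=
      (1 - p) ^+ T * (size X)%:R.
Proof.
move=> t0 t1 X1 p0 p1 hp; elim: T => [|T [Y [sY hY]]].
  by exists [::]; split=> //=; rewrite expr0 mul1r ler_nat count_size.
pose X' := [seq x <- X | all (fun y => (t < enorm (y - x))%R) Y].
have X'1 x : x \in X' -> enorm x = 1 by rewrite mem_filter => /andP[_ /X1].
have [y hy] := popular_center t0 t1 X'1.
exists (y :: Y); split=> /=; first by rewrite sY.
pose Q x := all (fun y => (t < enorm (y - x))%R) Y.
have E : count (fun x => (t < enorm (y - x))%R && Q x) X =
   (size X' - count (fun x => (enorm (y - x) <= t)%R) X')%N.
  rewrite -(count_predC (fun x => (enorm (y - x) <= t)%R) X') addKn count_filter.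
  by apply: eq_count => x /=; rewrite ltNge.
rewrite E natrB ?count_size//.
have w0 : 0 < 2 * D%:R * (1 + t) ^+ d by rewrite !mulr_gt0// exprn_gt0//; lra.
have hc : p * (size X')%:R <= (count (fun x => (enorm (y - x) <= t)%R) X')%:R.
  rewrite -(ler_pM2r w0); apply: le_trans hy.
  by rewrite mulrAC mulrC ler_wpM2l.
rewrite exprS -mulrA; rewrite -size_filter -/X' in hY.
apply: le_trans (_ : (1 - p) * (size X')%:R <= _); first lra.
by rewrite ler_wpM2l// subr_ge0.
Qed.

Lemma sphere_cover (delta : R) : (0 < d)%N -> 0 < delta ->
  exists s : seq ('rV[R]_D * R),
    [/\ forall p, p \in s -> 0 < p.2 <= delta,
        forall y, enorm y = 1 -> exists2 p, p \in s & enorm (y - p.1) <= p.2 &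
        \sum_(p <- s) p.2 ^+ d <= 11 / 5 * D%:R ^+ 2].
Proof.
(* Greedily chosen balls of radius rho cover all but a fraction 2^-d of a
   maximal separated set [X] at the much finer scale [l]; the leftover points
   of [X] are covered one by one. *)
move=> d0 delta0.
have dR : 1 <= d%:R :> R by rewrite ler1n.
(* With d [rho] <= 1/80 the distortion [w] = (1 + 3 [rho])^d stays below 21/20. *)
pose rho : R := Num.min delta (80 * d%:R)^-1.
have d80 : 0 < 80 * d%:R :> R by lra.
have rho0 : 0 < rho by rewrite lt_min delta0 invr_gt0.
have rhod : rho <= delta by rewrite ge_min lexx.
have rho80 : rho * (80 * d%:R) <= 1 by rewrite -ler_pdivlMr// mul1r ge_min lexx orbT.
have rho1 : rho <= 80^-1 by nra.
(* A centre within [t] of a net point x covers everything within 2 [l] = [rho]^2 of x at radius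
   [rho], since [t] + [rho]^2 = [rho]. *)
pose t := (1 - rho) * rho.
have t0 : 0 < t by rewrite mulr_gt0//; lra.
have tr : t <= rho by rewrite /t; nra.
have t1 : t < 1 by lra.
pose w : R := (1 + 3 * rho) ^+ d.
have w21 : w <= 21/20.
  apply: le_trans (expr1D_le _ _ _) _; [lra|lra|nra|].
  by rewrite invf_ple ?posrE; nra.
have wq : ((1 + rho) / (1 - rho)) ^+ d <= w.
  rewrite lerXn2r ?nnegrE; [|rewrite divr_ge0//; lra|lra|].
    by [].
  by rewrite ler_pdivrMr; nra.
have w1 : (1 + rho) ^+ d <= w by rewrite lerXn2r ?nnegrE; lra.
pose l := rho * rho / 2.
have l0 : 0 < l by rewrite divr_gt0// mulr_gt0.
have lr : l <= rho by rewrite /l; nra.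
have l1 : l < 1 by lra.
pose S : set 'rV[R]_D := [set x | enorm x = 1].
have [B hB] : exists B : nat, 2 * D%:R * (1 + l) ^+ d / l ^+ d <= B%:R.
  exists (Num.truncn (2 * D%:R * (1 + l) ^+ d / l ^+ d)).+1.
  apply/ltW/truncnS_gt.
have [|X [sX XS maxX]] := @maximal_separated D S (2 * l) B.
  move=> X sX X1; have := separated_sphere_size l0 l1 X1 sX.
  rewrite -ler_pdivlMr ?exprn_gt0// => h.
  by rewrite -(ler_nat R) (le_trans h).
have D0 : 0 < D%:R :> R by rewrite ltr0n.
pose c := 2 * D%:R * (1 + t) ^+ d.
have c0 : 0 < c by rewrite !mulr_gt0// exprn_gt0//; lra.
pose p := t ^+ d / c.
have p0 : 0 < p by rewrite divr_gt0// exprn_gt0.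
have p1 : p <= 1.
  rewrite ler_pdivrMr// mul1r /c.
  have h1 : t ^+ d <= 1 by rewrite exprn_ile1//; lra.
  have h2 : 1 <= (1 + t) ^+ d by rewrite exprn_ege1//; lra.
  have h3 : 1 <= D%:R :> R by rewrite ler1n.
  nra.
pose m := (Num.truncn p^-1).+1.
have mp : 1 <= m%:R * p by rewrite -ler_pdivrMr// mul1r ltW// truncnS_gt.
have mle : m%:R <= p^-1 + 1.
  by rewrite /m -natr1 lerD2r truncn_le invr_ge0 ltW.
have pc : p * c <= t ^+ d by rewrite /p divfK ?gt_eqF.
have [Y [sY hY]] := @greedy_centers X t p (d * m) t0 t1 XS (ltW p0) p1 pc.
pose Z := [seq x <- X | all (fun y => (t < enorm (y - x))%R) Y].
exists ([seq (y, rho) | y <- Y] ++ [seq (z, 2 * l) | z <- Z]); split.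
- move=> q; rewrite mem_cat => /orP[]/mapP[x _ ->] /=; first by rewrite rho0.
  by rewrite mulr_gt0//= (le_trans _ rhod)// /l; nra.
- move=> y /maxX[x xX yx].
  have [aY|] := boolP (all (fun y => t < enorm (y - x)) Y).
    exists (x, 2 * l) => //; rewrite mem_cat; apply/orP; right.
    by apply/mapP; exists x => //; rewrite mem_filter aY.
  rewrite -has_predC => /hasP[z zY /=]; rewrite -leNgt => zx.
  exists (z, rho) => /=; first by rewrite mem_cat; apply/orP; left; apply/mapP; exists z.
  apply: le_trans (enorm_sub _ x _) _; rewrite (enormB x z).
  apply: le_trans (lerD yx zx) _; rewrite /l /t; lra.
rewrite big_cat !big_map/= !sum_const_size sY.
have cost1 : (d * m)%:R * rho ^+ d <= d%:R * (2 * D%:R * w) + d%:R / 80.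
  rewrite natrM -mulrA -mulrDr ler_wpM2l//.
  have rd : rho ^+ d <= 80^-1.
    have rho_le1 : rho <= 1 by lra.
    by apply: le_trans rho1; rewrite -[leRHS]expr1; apply: ler_wiXn2l => //; rewrite ltW.
  apply: le_trans (ler_wpM2r _ mle) _; first by rewrite exprn_ge0// ltW.
  rewrite mulrDl mul1r lerD//.
  have -> : p^-1 * rho ^+ d = 2 * D%:R * ((1 + t) / (1 - rho)) ^+ d.
    rewrite /p /c /t exprMn expr_div_n invf_div; field.
    by rewrite !expf_neq0 ?gt_eqF//; lra.
  rewrite ler_wpM2l ?mulr_ge0//; apply: le_trans wq.
  clear - t0 tr rho0 rho1; rewrite lerXn2r ?nnegrE ?divr_ge0//; try lra.
  by rewrite ler_pM2r ?invr_gt0; lra.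
have cost2 : (size Z)%:R * (2 * l) ^+ d <= 2 * D%:R * w.
  have hX := separated_sphere_size l0 l1 XS sX.
  rewrite -size_filter -/Z in hY.
  rewrite exprMn mulrA.
  have hZ : (size Z)%:R * 2 ^+ d <= (size X)%:R :> R.
    have half : (1 - p) ^+ (d * m) <= (2 ^+ d)^-1.
      rewrite mulnC exprM -exprVn lerXn2r ?nnegrE ?exprn_ge0 ?subr_ge0//.
      by apply: half_power => //; exact: ltW.
    rewrite -ler_pdivlMr ?exprn_gt0// mulrC; apply: le_trans hY _.
    by rewrite ler_wpM2r.
  apply: le_trans (_ : (size X)%:R * l ^+ d <= _).
    by rewrite ler_wpM2r// exprn_ge0// ltW.
  apply: le_trans hX _; rewrite ler_wpM2l ?mulr_ge0//.
  by clear - l0 lr rho0; rewrite lerXn2r ?nnegrE; lra.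
(* The two costs add up to 2 D^2 [w] + d/80, and [w] <= 21/20 brings this below 11/5 D^2. *)
apply: le_trans (lerD cost1 cost2) _.
have E : D%:R = d%:R + 1 :> R by rewrite natr1.
rewrite E.
have : (d%:R + 1) * (d%:R + 1) * w <= (d%:R + 1) * (d%:R + 1) * (21 / 20).
  by rewrite ler_wpM2l// mulr_ge0; lra.
nra.
Qed.

End Coverings.

(** * Hausdorff measure *)

Section EuclideanTopology.
Context {R : realType} {n : nat}.
Implicit Types x y z : 'rV[R]_n.

Lemma continuous_enorm : continuous (@enorm R n).
Proof.
move=> x; apply: (@continuous_comp _ _ _ (fun x : 'rV[R]_n => \sum_(i < n) x ord0 i ^+ 2) Num.sqrt);
  last exact: sqrt_continuous.
elim: (index_enum _) => [|i s IH].
  rewrite (_ : (fun _ => _) = cst 0); first exact: cst_continuous.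
  by apply/funext => y; rewrite big_nil.
rewrite (_ : (fun _ => _) = (fun x : 'rV[R]_n => x ord0 i ^+ 2) +
    (fun x : 'rV[R]_n => \sum_(i <- s) x ord0 i ^+ 2)); last first.
  by apply/funext => y; rewrite big_cons.
apply: continuousD => //; apply: (@continuous_comp _ _ _ (fun x : 'rV[R]_n => x ord0 i) (fun u => u ^+ 2)).
  exact: coord_continuous.
exact: exprn_continuous.
Qed.

Lemma open_eball x (r : R) : open [set y | enorm (y - x) < r].
Proof.
have -> : [set y | enorm (y - x) < r] = (fun y => enorm (y - x)) @^-1` [set u | u < r] by [].
apply: open_comp; last exact: open_lt.
move=> y _; apply: (@continuous_comp _ _ _ (fun y => y - x) (@enorm R n)); last exact: continuous_enorm.
by apply: continuousB; [exact: cvg_id|exact: cst_continuous].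
Qed.

Lemma enorm_bounded_closed_compact (A : set 'rV[R]_n) (M : R) :
  (forall x, A x -> enorm x <= M) -> closed A -> compact A.
Proof.
move=> AM clA; apply: bounded_closed_compact => //.
exists (Num.max M 0); split; first exact: num_real.
move=> M' MM' x Ax /=.
rewrite /Num.norm/= mx_normrE; apply: bigmax_le => [|[i j] _ /=].
  by rewrite (le_trans _ (ltW MM'))// le_max lexx orbT.
rewrite (ord1 i) (le_trans (coord_le_enorm _ _))// (le_trans (AM _ Ax))//.
by rewrite (le_trans _ (ltW MM'))// le_max lexx.
Qed.

Lemma closed_eball (r : R) : closed [set x : 'rV[R]_n | enorm x <= r].
Proof.
apply: (@closed_comp _ _ (@enorm R n) [set u | u <= r]); last exact: closed_le.
by move=> x _; exact: continuous_enorm.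
Qed.

Lemma compact_eball (r : R) : compact [set x : 'rV[R]_n | enorm x <= r].
Proof. by apply: (@enorm_bounded_closed_compact _ r) => //; exact: closed_eball. Qed.

End EuclideanTopology.

Section Hausdorff.
Context {R : realType}.
Local Open Scope ereal_scope.

Lemma ball_vol_gt0 (d : nat) : (0 < ball_vol R d)%R.
Proof.
suff : (0 < ball_vol R d)%R /\ (0 < ball_vol R d.+1)%R by case.
elim: d => [|d [IH1 IH2]]; first by split; rewrite /= ltr01 || rewrite /= ltr0n.
by split=> //=; rewrite mulr_gt0// divr_gt0 ?mulr_gt0 ?pi_gt0// ltr0n.
Qed.

Context {n : nat}.
Implicit Types A C : set 'rV[R]_n.

Lemma ediam_ge0 C : 0 <= ediam C.
Proof. by apply: ereal_sup_ubound; left. Qed.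

Lemma ediam_le C (r : R) : (0 <= r)%R ->
  (forall x y, C x -> C y -> (enorm (x - y) <= r)%R) -> ediam C <= r%:E.
Proof.
move=> r0 h; apply: ge_ereal_sup => _ [->|[x [y [Cx Cy ->]]]]; first by rewrite lee_fin.
by rewrite lee_fin h.
Qed.

Lemma enorm_le_ediam C x y (r : R) : C x -> C y -> ediam C <= r%:E ->
  (enorm (x - y) <= fine (ediam C))%R.
Proof.
move=> Cx Cy Cr; rewrite -lee_fin fineK.
  by apply: ereal_sup_ubound; right; exists x, y.
by rewrite fin_real// (lt_le_trans _ (ediam_ge0 C))// (le_lt_trans Cr)// ltry.
Qed.

Lemma fine_ediam_ge0 C : (0 <= fine (ediam C))%R.
Proof. by rewrite fine_ge0// ediam_ge0. Qed.

Lemma fine_ediam_le C (r : R) : (0 <= r)%R ->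
  (forall x y, C x -> C y -> (enorm (x - y) <= r)%R) -> (fine (ediam C) <= r)%R.
Proof.
move=> r0 h; have Cr := ediam_le r0 h; rewrite -lee_fin fineK//.
by rewrite fin_real// (lt_le_trans _ (ediam_ge0 C))// (le_lt_trans Cr)// ltry.
Qed.

Variable d : nat.

Definition diam_weight {m} (C : set 'rV[R]_m) : R :=
  (ball_vol R d * (fine (ediam C) / 2) ^+ d)%R.

Lemma diam_weight_ge0 {m} (C : set 'rV[R]_m) : (0 <= diam_weight C)%R.
Proof.
apply: mulr_ge0; first exact/ltW/ball_vol_gt0.
rewrite exprn_ge0// divr_ge0//.
by rewrite fine_ge0//; apply: ereal_sup_ubound; left.
Qed.

Lemma hausdorff_ge_pre A (delta : R) : (0 < delta)%R ->
  hausdorff_pre d delta A <= hausdorff d A.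
Proof. by move=> d0; apply: ereal_sup_ubound; exists delta. Qed.

Lemma hausdorff_ge0 A : 0 <= hausdorff d A.
Proof.
apply: le_trans (hausdorff_ge_pre A ltr01).
apply: le_ereal_inf_tmp => _ [C _ <-]; apply: nneseries_ge0 => i _ _.
by rewrite lee_fin; exact: diam_weight_ge0.
Qed.

Lemma sum_nth_le (s : seq R) (N : nat) : (forall x, x \in s -> (0 <= x)%R) ->
  (\sum_(0 <= i < N) s`_i <= \sum_(x <- s) x)%R.
Proof.
elim: s N => [|x s IH] N s0.
  by rewrite big_nil big1// => i _; rewrite nth_nil.
have IH' := IH ^~ (fun y (ys : y \in s) => s0 y (mem_behead (s := x :: s) ys)).
case: N => [|N].
  by rewrite big_geq//; rewrite big_seq; apply: sumr_ge0 => y /s0.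
by rewrite big_nat_recl//= big_cons lerD2l.
Qed.

(** A finite cover becomes a sequence by padding with the empty set, whose weight 0^d vanishes
    because d > 0. Diameters are at most twice the radii, hence the scale delta / 2. *)
Lemma hausdorff_le_cover A (B : R) : (0 < d)%N ->
  (forall delta : R, (0 < delta)%R -> exists s : seq (set 'rV[R]_n * R),
    [/\ forall p, p \in s -> (0 <= p.2 <= delta)%R,
        forall p x y, p \in s -> p.1 x -> p.1 y -> (enorm (x - y) <= 2 * p.2)%R,
        forall x, A x -> exists2 p, p \in s & p.1 x &
        (\sum_(p <- s) p.2 ^+ d <= B)%R]) ->
  hausdorff d A <= (ball_vol R d * B)%:E.
Proof.
move=> d0 h; apply: ge_ereal_sup => _ [delta delta0 <-].
have [s [s1 s2 s3 s4]] := h (delta / 2)%R (divr_gt0 delta0 (ltr0Sn _ 1)).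
have wd (p : set 'rV[R]_n * R) : p \in s -> (fine (ediam p.1) <= 2 * p.2)%R.
  move=> ps; apply: fine_ediam_le; last by move=> x y; exact: s2.
  by have /andP[p0 _] := s1 _ ps; rewrite mulr_ge0.
have e0 : ediam (set0 : set 'rV[R]_n) = 0.
  apply/eqP; rewrite eq_le ediam_ge0 andbT.
  by apply: (@ediam_le _ 0%R).
pose C i := nth set0 (map fst s) i.
apply: le_trans (_ : \sum_(0 <= i <oo) (diam_weight (C i))%:E <= _).
  apply: ereal_inf_lbound; exists C => //; split.
    move=> x /s3[p ps px]; exists (index p s) => //.
    by rewrite /C (nth_map p) ?index_mem// nth_index.
  move=> i; rewrite /C; have [si|si] := ltnP i (size s); last first.
    by rewrite nth_default ?size_map// e0 lee_fin ltW.
  rewrite (nth_map (set0, 0%R))//; set p := nth _ _ _.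
  have ps : p \in s by exact: mem_nth.
  have /andP[p0 pd] := s1 _ ps.
  apply: ediam_le => [|x y px py]; first exact: ltW.
  by apply: le_trans (s2 _ _ _ ps px py) _; rewrite mulrC -ler_pdivlMr.
apply: lime_le; first by apply: is_cvg_nneseries => i _ _; rewrite lee_fin diam_weight_ge0.
near=> N.
rewrite sumEFin lee_fin.
apply: le_trans (_ : \sum_(0 <= i < N) [seq (ball_vol R d * p.2 ^+ d)%R | p <- s]`_i <= _)%R.
  apply: ler_sum => i _; have [si|si] := ltnP i (size s); last first.
    rewrite [leRHS]nth_default ?size_map// /C nth_default ?size_map//.
    by rewrite /diam_weight e0/= mul0r expr0n gtn_eqF// mulr0.
  rewrite /C !(nth_map (set0, 0%R))//; set p := nth _ _ _.
  have ps : p \in s by exact: mem_nth.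
  rewrite /diam_weight ler_pM2l ?ball_vol_gt0//.
  have /andP[p0 _] := s1 _ ps.
  rewrite lerXn2r ?nnegrE ?divr_ge0 ?fine_ediam_ge0//.
  by rewrite ler_pdivrMr// mulrC wd.
apply: le_trans (sum_nth_le _ _) _.
  move=> _ /mapP[p /s1/andP[p0 _] ->].
  by apply: mulr_ge0; [exact/ltW/ball_vol_gt0|rewrite exprn_ge0].
by rewrite big_map -mulr_sumr ler_pM2l// ball_vol_gt0.
Unshelve. all: by end_near. Qed.

Lemma hausdorff_set0 : (0 < d)%N -> hausdorff d (set0 : set 'rV[R]_n) = 0.
Proof.
move=> d0; apply/eqP; rewrite eq_le hausdorff_ge0 andbT.
have -> : 0 = (ball_vol R d * 0)%:E by rewrite mulr0.
apply: hausdorff_le_cover => // delta _.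
by exists [::]; split=> //; rewrite big_nil.
Qed.

End Hausdorff.

Section HausdorffMaps.
Context {R : realType} {n m : nat}.
Local Open Scope ereal_scope.
Variable d : nat.

(** The image is covered by the images of the [C i] restricted to [A], where [f] is known to be
    Lipschitz. *)
Lemma hausdorff_lipschitz (f : 'rV[R]_n -> 'rV[R]_m) (A : set 'rV[R]_n) (L : R) :
  (0 < L)%R ->
  (forall x y, A x -> A y -> (enorm (f x - f y) <= L * enorm (x - y))%R) ->
  hausdorff d (f @` A) <= (L ^+ d)%:E * hausdorff d A.
Proof.
move=> L0 fL; apply: ge_ereal_sup => _ [delta delta0 <-].
have dL : (0 < delta / L)%R by rewrite divr_gt0.
apply: le_trans (_ : _ <= (L ^+ d)%:E * hausdorff_pre d (delta / L) A) _; last first.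
  apply: lee_wpmul2l; first by rewrite lee_fin exprn_ge0// ltW.
  exact: hausdorff_ge_pre.
have Ld : (0 < L ^+ d)%R by rewrite exprn_gt0.
rewrite -lee_pdivrMl//; apply: le_ereal_inf_tmp => _ [C [AC Cd] <-].
rewrite lee_pdivrMl//.
pose C' i := f @` (C i `&` A).
have C'd i : (fine (ediam (C' i)) <= L * fine (ediam (C i)))%R.
  apply: fine_ediam_le; first by rewrite mulr_ge0 ?fine_ediam_ge0// ltW.
  move=> _ _ [x [Cx Ax] <-] [y [Cy Ay] <-].
  apply: le_trans (fL _ _ Ax Ay) _; rewrite ler_pM2l//.
  exact: enorm_le_ediam (Cd i).
apply: le_trans (_ : \sum_(0 <= i <oo) (diam_weight d (C' i))%:E <= _).
  apply: ereal_inf_lbound; exists C' => //; split.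
    by move=> _ [x Ax <-]; have [i _ Cx] := AC x Ax; exists i => //; exists x.
  move=> i; apply: ediam_le; first exact: ltW.
  move=> _ _ [x [Cx Ax] <-] [y [Cy Ay] <-].
  apply: le_trans (fL _ _ Ax Ay) _; rewrite mulrC -ler_pdivlMr//.
  rewrite -lee_fin; apply: le_trans (Cd i); apply: ereal_sup_ubound.
  by right; exists x, y.
rewrite -nneseriesZl; last by move=> i _; rewrite lee_fin; exact: diam_weight_ge0.
apply: lee_nneseries => [i _ _|i _]; first by rewrite lee_fin diam_weight_ge0.
rewrite -EFinM lee_fin mulrCA ler_pM2l ?ball_vol_gt0// -exprMn.
have L0' := ltW L0.
rewrite lerXn2r ?nnegrE ?mulr_ge0 ?divr_ge0 ?fine_ediam_ge0//.
by rewrite mulrA ler_pM2r// invr_gt0.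
Qed.

End HausdorffMaps.

Section HausdorffLower.
Context {R : realType} {d : nat}.
Local Open Scope ereal_scope.

Lemma expr_add_le (a b : R) (k : nat) : (0 <= a)%R -> (0 <= b)%R ->
  ((a + b) ^+ k <= 2 ^+ k * (a ^+ k + b ^+ k))%R.
Proof.
move=> a0 b0; wlog ab : a b a0 b0 / (a <= b)%R.
  move=> h; have [ab|/ltW ba] := leP a b; first exact: h.
  by rewrite addrC [(_ + b ^+ k)%R]addrC; exact: h.
apply: le_trans (_ : (2 * b) ^+ k <= _)%R.
  by rewrite lerXn2r ?nnegrE ?addr_ge0 ?mulr_ge0//; lra.
by rewrite exprMn ler_wpM2l ?exprn_ge0// lerDr exprn_ge0.
Qed.

(** The sets of a cover are enclosed in slightly larger open balls; compactness leaves finitely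
    many, to which the volume comparison [cover_ball_sum] applies. *)
Lemma hausdorff_eball_gt0 (A : set 'rV[R]_d) : (0 < d)%N ->
  (forall x, (enorm x <= 1)%R -> A x) -> 0 < hausdorff d A.
Proof.
move=> d0 hA.
pose c : R := (ball_vol R d * (2 * 4 ^+ d)^-1)%R.
have c0 : (0 < c)%R by rewrite mulr_gt0 ?ball_vol_gt0// invr_gt0 mulr_gt0 ?exprn_gt0.
apply: lt_le_trans (_ : c%:E <= _); first by rewrite lte_fin.
apply: le_trans (hausdorff_ge_pre d A ltr01).
apply: le_ereal_inf_tmp => _ [C [AC Cd] <-].
(* As (a + b)^d <= 2^d (a^d + b^d), the enlargements cost at most 2^d times the sum of the [e i],
   that is 1/2; half of the unit volume is left for the diameters. *)
pose e i : R := (2 ^- i * 2 ^- (d + 2))%R.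
have e0 i : (0 < e i)%R by rewrite mulr_gt0// invr_gt0 exprn_gt0.
have e1 i : (e i <= 1)%R.
  by rewrite mulr_ile1 ?invr_ge0 ?exprn_ge0// invf_le1 ?exprn_gt0// exprn_ege1// ler1n.
pose x i : 'rV[R]_d := xget 0%R (C i).
pose di i := fine (ediam (C i)).
have xC i y : C i y -> (enorm (y - x i) <= di i)%R.
  move=> Cy; apply: enorm_le_ediam (Cd i) => //.
  by rewrite /x; apply: (@xgetPex _ 0%R (C i)); exists y.
have := @compact_eball R d 1; rewrite compact_cover => cov.
have [||D' _ D'cov] := cov nat setT (fun i => [set y | (enorm (y - x i) < di i + e i)%R]).
- by move=> i _; exact: open_eball.
- move=> y /= y1; have [i _ Ci] := AC y (hA y y1); exists i => //=.
  by apply: le_lt_trans (xC _ _ Ci) _; rewrite ltrDl.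
pose N := (\max_(i <- finmap.enum_fset D') i).+1.
have DN i : i \in finmap.enum_fset D' -> (i < N)%N.
  by move=> iD; rewrite ltnS; exact: leq_bigmax_seq.
pose s := [seq (x i, (di i + e i)%R) | i <- iota 0 N].
have di0 i : (0 <= di i)%R by exact: fine_ediam_ge0.
have h1 : (1 ^+ d <= \sum_(p <- s) p.2 ^+ d)%R.
  apply: cover_ball_sum => //.
    by move=> _ /mapP[i _ ->] /=; rewrite addr_ge0// ltW.
  move=> y y1; have [i iD yi] := D'cov y y1.
  exists (x i, (di i + e i)%R) => /=; last exact: ltW.
  by apply/mapP; exists i => //; rewrite mem_iota/=; exact: DN.
rewrite big_map expr1n /= in h1.
have h2 : (\sum_(i <- iota 0 N) (di i + e i) ^+ d <=
    2 ^+ d * \sum_(i <- iota 0 N) di i ^+ d + 2^-1)%R.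
  apply: le_trans (_ : \sum_(i <- iota 0 N) 2 ^+ d * (di i ^+ d + e i) <= _)%R.
    apply: ler_sum => i _; apply: le_trans (expr_add_le _ _ _) _ => //; first exact: ltW.
    rewrite ler_wpM2l ?exprn_ge0// lerD2l -[leRHS]expr1.
    by apply: ler_wiXn2l => //; exact: ltW.
  rewrite -mulr_sumr big_split/= mulrDr lerD2l /e -mulr_suml exprD invfM.
  rewrite mulrCA !mulrA mulfK ?expf_neq0//.
  suff -> : (\sum_(i <- iota 0 N) 2 ^- i = 2 - 2 * 2 ^- N :> R)%R.
    by have : (0 <= 2 ^- N :> R)%R by [rewrite invr_ge0 exprn_ge0]; lra.
  elim: (N) => [|k IH]; first by rewrite big_nil expr0 invr1 mulr1 subrr.
  rewrite -addn1 iotaD big_cat/= IH big_cons big_nil add0n addr0 exprD expr1 invfM.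
  by field; rewrite expf_neq0.
have h3 : (c <= \sum_(0 <= i < N) diam_weight d (C i))%R.
  rewrite /c -mulr_sumr ler_pM2l ?ball_vol_gt0//.
  have -> : (\sum_(0 <= i < N) (fine (ediam (C i)) / 2) ^+ d =
     2 ^- d * \sum_(i <- iota 0 N) di i ^+ d)%R.
    rewrite /index_iota subn0 mulr_sumr; apply: eq_bigr => i _.
    by rewrite exprMn exprVn mulrC.
  have p2 : (0 < 2 ^+ d :> R)%R by rewrite exprn_gt0.
  rewrite invfM (_ : 4 = 2 * 2 :> R)%R; last by ring.
  rewrite exprMn invfM mulrCA ler_pM2l ?invr_gt0// -(ler_pM2l p2).
  rewrite mulrCA mulfV ?gt_eqF// mulr1; lra.
apply: le_trans (_ : (\sum_(0 <= i < N) diam_weight d (C i))%:E <= _).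
  by rewrite lee_fin.
rewrite -sumEFin; apply: nneseries_lim_ge => i _ _.
by rewrite lee_fin; exact: diam_weight_ge0.
Qed.

End HausdorffLower.

(** * Ratio of the volumes of unit balls in consecutive dimensions *)

Section BallVolume.
Context {R : realType}.

Lemma sin_le_id (x : R) : 0 <= x -> sin x <= x.
Proof.
move=> x0; rewrite -subr_ge0.
have -> : (0 : R) = (fun x : R => x - sin x) 0 by rewrite /= sin0 subr0.
apply: (@is_derive_nondecreasing R (fun x : R => x - sin x) (fun x => 1 - cos x)) => //.
Qed.

(** The square of sin (pi/4) is 1/2, and it is at most (pi/4)^2. *)
Lemma pi_sq_ge8 : 8 <= pi ^+ 2 :> R.
Proof.
have := cos_pihalf R; have -> : pi / 2 = (pi / 4) *+ 2 :> R by rewrite mulr2n; field.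
rewrite cos_mulr2n => c0.
have p0 : 0 <= pi / 4 :> R by rewrite divr_ge0 ?pi_ge0.
have := sin_le_id p0; have := cos2Dsin2 (pi / 4 : R).
have : 0 <= sin (pi / 4) :> R.
  by apply: sin_ge0_pi; rewrite p0/=; have := pi_ge0 R; lra.
nra.
Qed.

Lemma ball_volSS (d : nat) : ball_vol R d.+2 = 2 * pi / d.+2%:R * ball_vol R d.
Proof. by []. Qed.

(** It trades [ball_vol R d], the normalisation of H^d, for [ball_vol R d.+1], which the hypothesis
    on [sphere_area] controls. Two-step induction along the recursion, through (d + 1) (d + 3) <= (d
    + 2)^2; the second base case is exactly pi^2 >= 8. *)
Lemma ball_vol_ratio (d : nat) :
  4 * ball_vol R d ^+ 2 <= d.+1%:R * ball_vol R d.+1 ^+ 2.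
Proof.
suff : 4 * ball_vol R d ^+ 2 <= d.+1%:R * ball_vol R d.+1 ^+ 2 /\
   4 * ball_vol R d.+1 ^+ 2 <= d.+2%:R * ball_vol R d.+2 ^+ 2 by case.
elim: d => [|d [IH1 IH2]].
  split; first by rewrite /= ; lra.
  by rewrite ball_volSS /=; have := pi_sq_ge8; rewrite !exprMn; nra.
split=> //; rewrite !ball_volSS.
have E (a b : R) : (2 * pi / a * b) ^+ 2 = (2 ^+ 2 * pi ^+ 2) * a ^- 2 * b ^+ 2.
  by rewrite !exprMn exprVn.
rewrite !E.
have p2 : 0 < 2 ^+ 2 * pi ^+ 2 :> R by rewrite mulr_gt0 ?exprn_gt0 ?pi_gt0.
have v0 : 0 <= ball_vol R d.+1 ^+ 2 by rewrite exprn_ge0// ltW// ball_vol_gt0.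
move: IH1 p2 v0; move: (ball_vol R d ^+ 2) (ball_vol R d.+1 ^+ 2) (2 ^+ 2 * pi ^+ 2) => u v w IH1 w0 v0.
have e3 : d.+3%:R * (w * d.+3%:R ^- 2 * v) = w * (v / d.+3%:R) :> R by field.
have -> : 4 * (w * d.+2%:R ^- 2 * u) = w * (4 * u / d.+2%:R ^+ 2) :> R by field.
rewrite e3 ler_pM2l// ler_pdivrMr ?exprn_gt0// mulrAC ler_pdivlMr//.
have -> : d.+3%:R = d.+1%:R + 2 :> R by rewrite -addn2 natrD.
have -> : d.+2%:R = d.+1%:R + 1 :> R by rewrite -addn1 natrD.
have : 0 <= d.+1%:R :> R by [].
move: (d.+1%:R) IH1 => m IH1 m0; nra.
Qed.

End BallVolume.

Section FirstCoordinate.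
Context {R : realType} {d : nat}.

Definition pole_mx (t : R) (y : 'rV[R]_d) : 'rV[R]_d.+1 := row_mx (t%:M : 'rV_1) y.
Definition pole_l (x : 'rV[R]_d.+1) : R := (@lsubmx R 1 1 d x) ord0 ord0.
Definition pole_r (x : 'rV[R]_d.+1) : 'rV[R]_d := @rsubmx R 1 1 d x.

Lemma pole_mxK (x : 'rV[R]_d.+1) : pole_mx (pole_l x) (pole_r x) = x.
Proof. by rewrite /pole_mx /pole_l /pole_r -mx11_scalar hsubmxK. Qed.

Lemma pole_mxKr (t : R) (y : 'rV[R]_d) : pole_r (pole_mx t y) = y.
Proof. exact: row_mxKr. Qed.

Lemma pole_mxKl (t : R) (y : 'rV[R]_d) : pole_l (pole_mx t y) = t.
Proof. by rewrite /pole_l /pole_mx (@row_mxKl R 1 1 d) mxE eqxx mulr1n. Qed.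

Lemma dotp_pole (s t : R) (y z : 'rV[R]_d) :
  dotp (pole_mx s y) (pole_mx t z) = s * t + dotp y z.
Proof. by rewrite -dotp_scalar; exact: (@dotp_row_mx R 1 d). Qed.

End FirstCoordinate.

(** * Hausdorff measure of the unit sphere *)

Section Sphere.
Context {R : realType} {d k : nat}.

(** The ambient dimension is d + 1 + k, so the normal spaces of the sphere have dimension k + 1. *)
Definition usphere : set 'rV[R]_(d.+1 + k) :=
  [set row_mx x 0 | x in [set x : 'rV[R]_d.+1 | enorm x = 1]].

Lemma usphere_hausdorff_le : (0 < d)%N ->
  (hausdorff d usphere <= (ball_vol R d * (11 / 5 * d.+1%:R ^+ 2))%:E)%E.
Proof.
move=> d0; apply: hausdorff_le_cover => // delta delta0.
have [s [s1 s2 s3]] := @sphere_cover R d delta d0 delta0.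
exists [seq ([set row_mx x 0 | x in [set x | enorm (x - p.1) <= p.2]], p.2) | p <- s]; split.
- by move=> _ /mapP[p /s1/andP[p0 pd] ->] /=; rewrite ltW.
- move=> _ x y /mapP[p ps ->] /= [x' x'p <-] [y' y'p <-].
  rewrite row_mxB subrr enorm_row_mx0; apply: le_trans (enorm_sub _ p.1 _) _.
  by rewrite (enormB p.1); lra.
- move=> _ [x x1 <-]; have [p ps xp] := s2 x x1.
  exists ([set row_mx x 0 | x in [set x | enorm (x - p.1) <= p.2]], p.2).
    by apply/mapP; exists p.
  by exists x.
by rewrite big_map.
Qed.

(** Forgetting the first and the last k coordinates is 1-Lipschitz and maps the sphere onto the unit
    ball of R^d. *)
Lemma usphere_hausdorff_gt0 : (0 < d)%N -> (0 < hausdorff d usphere)%E.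
Proof.
move=> d0.
pose f (z : 'rV[R]_(d.+1 + k)) : 'rV[R]_d := pole_r (lsubmx z).
have : (0 < hausdorff d (f @` usphere))%E.
  apply: hausdorff_eball_gt0 => // y y1.
  have y2 : dotp y y <= 1 by rewrite -enorm_sq exprn_ile1// enorm_ge0.
  pose t := Num.sqrt (1 - dotp y y).
  exists (row_mx (pole_mx t y) 0); last by rewrite /f row_mxKl pole_mxKr.
  exists (pole_mx t y) => //=.
  by rewrite enormE dotp_pole -expr2 sqr_sqrtr ?subr_ge0// subrK sqrtr1.
move=> h; apply: lt_le_trans h _.
rewrite -[leRHS]mul1e -(expr1n _ d); apply: hausdorff_lipschitz => // _ _ [x _ <-] [y _ <-].
rewrite /f mul1r row_mxB subrr enorm_row_mx0 !row_mxKl.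
have -> : pole_r x - pole_r y = pole_r (x - y) by apply/rowP => i; rewrite !mxE.
rewrite -{2}(pole_mxK (x - y)); apply: ler_of_sqr; first exact: enorm_ge0.
by rewrite !enorm_sq dotp_pole lerDr -expr2 sqr_ge0.
Qed.

Lemma usphere_hausdorff : (0 < d)%N -> exists h : R,
  [/\ 0 < h, h <= ball_vol R d * (11 / 5 * d.+1%:R ^+ 2) & hausdorff d usphere = h%:E].
Proof.
move=> d0; have := usphere_hausdorff_gt0 d0; have := usphere_hausdorff_le d0.
case: (hausdorff d usphere) => [h| |] //; rewrite lee_fin lte_fin => h1 h2.
by exists h.
Qed.

End Sphere.

(** * The packing bound for statistical queries *)

Lemma subr_unit_bound (R : realDomainType) (u v : R) :
  0 <= u -> u <= 1 -> 0 <= v -> v <= 1 -> -1 <= u - v <= 1.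
Proof. by move=> u0 u1 v0 v1; apply/andP; split; lra. Qed.

Section Expectations.
Context {R : realType} {n d : nat}.
Local Open Scope ereal_scope.
Implicit Types (M A B : set 'rV[R]_n) (f g : 'rV[R]_n -> R).

Lemma hausdorff_subset A B : A `<=` B -> hausdorff d A <= hausdorff d B.
Proof.
move=> AB; apply: ge_ereal_sup => _ [delta delta0 <-]; apply: le_trans (hausdorff_ge_pre d B delta0).
apply: le_ereal_inf_tmp => _ [C [BC Cd] <-]; apply: ereal_inf_lbound.
by exists C => //; split=> //; exact: subset_trans BC.
Qed.

Lemma hint_ge0 M f : 0 <= hint d M f.
Proof. by apply: integral_ge0 => t _; exact: hausdorff_ge0. Qed.

(** Unfolding the integral as a supremum over simple functions below the integrand reduces
    monotonicity to inclusion of superlevel sets. *)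
Lemma hint_le M f g : (forall x, M x -> (f x <= g x)%R) -> hint d M f <= hint d M g.
Proof.
move=> fg; rewrite /hint !ge0_integralE; try by move=> t _; exact: hausdorff_ge0.
apply: ge_ereal_sup => _ [h hf <-]; apply: ereal_sup_ubound; exists h => // t.
apply: le_trans (hf t) _; rewrite !patchE; case: ifP => // _.
apply: hausdorff_subset => x [Mx tx]; split=> //=; exact: lt_le_trans (fg x Mx).
Qed.

(** Each of the two integrals in [expect] lies in [0, 1] by comparison with that of [f], so their
    difference lies in [-1, 1] without additivity of [hint]. *)
Lemma expect_bound M f (r : 'rV[R]_n -> R) :
  (forall x, M x -> 0 <= f x)%R -> hint d M f = 1 ->
  (forall x, -1 <= r x <= 1)%R -> (-1 <= expect d M f r <= 1)%R.
Proof.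
move=> f0 f1 r1.
have part (g : 'rV[R]_n -> R) : (forall x, g x <= 1)%R ->
    (0 <= fine (hint d M (fun x => Num.max (g x) 0 * f x)) <= 1)%R.
  move=> g1; have h0 := hint_ge0 M (fun x => Num.max (g x) 0 * f x)%R.
  have h1 : hint d M (fun x => Num.max (g x) 0 * f x)%R <= 1.
    rewrite -f1; apply: hint_le => x Mx; rewrite -[leRHS]mul1r ler_wpM2r ?f0//.
    by rewrite ge_max g1 ler01.
  rewrite fine_ge0//= -lee_fin fineK// fin_real// (lt_le_trans _ h0)//.
  exact: le_lt_trans h1 (ltry _).
have /andP[a0 a1] := part r (fun x => (andP (r1 x)).2).
have /andP[b0 b1] : (0 <= fine (hint d M (fun x => Num.max (- r x) 0 * f x)) <= 1)%R.
  by apply: (part (fun x => - r x)%R) => x; rewrite lerNl; have /andP[] := r1 x.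
exact (subr_unit_bound a0 a1 b0 b1).
Qed.

End Expectations.

Section Rounding.
Context {R : realType}.
Variable K : nat.

(** Centres of the K + 1 cells of width 2 / (K + 1) that cut up [-1, 1]. *)
Definition grid_value (j : 'I_K.+1) : R := -1 + (2 * j%:R + 1) / K.+1%:R.

(** The [minn] puts the right end e = 1 into the last cell. *)
Definition grid_index (e : R) : 'I_K.+1 := inord (minn (Num.truncn ((e + 1) * K.+1%:R / 2)) K).

Lemma grid_valueP (e : R) : -1 <= e <= 1 ->
  `|grid_value (grid_index e) - e| <= K.+1%:R^-1.
Proof.
move=> /andP[e1 e2]; rewrite /grid_value /grid_index inordK ?ltnS ?geq_minr//.
set w := (e + 1) * K.+1%:R / 2; set j := minn _ _.
have K0 : 0 < K.+1%:R :> R by [].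
have w0 : 0 <= w by rewrite /w divr_ge0// mulr_ge0//; lra.
have wK : w <= K.+1%:R by rewrite /w ler_pdivrMr// mulrC ler_pM2l//; lra.
have /andP[t1 t2] := truncn_itv w0.
have [jw wj] : j%:R <= w /\ w <= j%:R + 1.
  rewrite /j; have [tK|Kt] := leqP (Num.truncn w) K.
    by rewrite natr1; split=> //; exact: ltW.
  rewrite natr1; split=> //; apply: le_trans t1; by rewrite ler_nat ltnW.
have -> : -1 + (2 * j%:R + 1) / K.+1%:R - e = K.+1%:R^-1 * (2 * (j%:R - w) + 1).
  by rewrite /w; field.
rewrite normrM gtr0_norm ?invr_gt0// -[leRHS]mulr1 ler_pM2l ?invr_gt0//.
by rewrite ler_norml; apply/andP; split; lra.
Qed.

End Rounding.

Section Packing.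
Context {R : realType} {n d : nat} {rch fmin fmax L : R} {q : nat} {eps tau alpha : R}.
Context {dO : measure_display} {Omega : measurableType dO}.
Context {P : probability Omega R} {A : Omega -> sq_alg R n}.
Context {I : finType} {M : I -> set 'rV[R]_n} {f : I -> 'rV[R]_n -> R}.

Hypothesis estimates : rand_sq_estimates d rch fmin fmax L q eps tau alpha P A.
Hypothesis fmin_ge0 : 0 <= fmin.
Hypothesis model : forall i, in_model d rch fmin fmax L (M i) (f i).
Hypothesis apart : forall i j K, i != j -> (hausdorff_dist (M i) K <= eps%:E)%E ->
  (hausdorff_dist (M j) K <= eps%:E)%E -> False.

Variable K : nat.
Hypothesis tauK : K.+1%:R^-1 <= tau.

Let rounding_oracle (i : I) : oracle R n :=
  fun _ r => grid_value (grid_index K (expect d (M i) (f i) r)).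

Let rounding_oracle_valid i : valid_oracle d (M i) (f i) tau (rounding_oracle i).
Proof.
move=> h r [r1 _]; apply: le_trans (grid_valueP _ _) _.
  have [_ _ fb _ f1] := model i.
  apply: expect_bound => // x Mx; have /andP[+ _] := fb x Mx.
  exact: le_trans.
exact: tauK.
Qed.

Let transcript_answers (B : sq_alg R n) i k : exists t : k.-tuple 'I_K.+1,
  map snd (transcript B (rounding_oracle i) k) = map (@grid_value R K) t.
Proof.
elim: k => [|k [t IH]]; first by exists [tuple].
exists [tuple of rcons t (grid_index K
   (expect d (M i) (f i) (sq_query B (map snd (transcript B (rounding_oracle i) k)))))].
by rewrite /= !map_rcons IH.
Qed.

Let good (w : Omega) (i : I) :=
  `[< (hausdorff_dist (M i) (sq_run (A w) (rounding_oracle i) q) <= eps%:E)%E >].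

Let good_card w : (#|[set i | good w i]%SET| <= K.+1 ^ q)%N.
Proof.
pose code i := sval (cid (transcript_answers (A w) i q)).
rewrite -[X in (_ <= X ^ q)%N]card_ord -card_tuple -(@card_in_imset _ _ code).
  exact: max_card.
move=> i j; rewrite !finset.in_set => /asboolP hi /asboolP hj cij.
apply: contrapT => /eqP ij; apply: (apart ij hi).
suff -> : sq_run (A w) (rounding_oracle i) q = sq_run (A w) (rounding_oracle j) q by [].
have hi' := svalP (cid (transcript_answers (A w) i q)).
have hj' := svalP (cid (transcript_answers (A w) j q)).
have e := congr1 (fun t : q.-tuple 'I_K.+1 => map (@grid_value R K) t) cij.
exact (congr1 (sq_output (A w)) (etrans hi' (etrans e (esym hj')))).
Qed.

(** Double counting: the expected number of members served is at least |I| (1 - alpha) and at most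
    the number of answer sequences. The set of draws that serve a member is not known to be
    measurable, so the integration runs over the measurable events [E i] inside it. *)
Lemma grid_packing_bound : #|I|%:R * (1 - alpha) <= (K.+1 ^ q)%:R.
Proof.
have [_ est] := estimates.
have succ i := est _ _ (model i) _ (rounding_oracle_valid i).
pose E i := sval (cid (succ i)).
have mE i : measurable (E i) by have [] := svalP (cid (succ i)).
have gE i w : E i w -> good w i.
  by move=> Ew; apply/asboolP; have [_ + _] := svalP (cid (succ i)); exact.
have PE i : ((1 - alpha)%:E <= P (E i))%E by have [] := svalP (cid (succ i)).
have up : (\sum_(i <- index_enum I) P (E i) <= (K.+1 ^ q)%:R%:E)%E.
  have -> : (\sum_(i <- index_enum I) P (E i) =
      \int[P]_w \sum_(i <- index_enum I) (\1_(E i) w)%:E)%E.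
    rewrite ge0_integral_sum//; last by move=> i; exact/measurable_realfun.measurable_EFinP.
    by apply: eq_bigr => i _; rewrite integral_indic// setIT.
  apply: le_trans (_ : \int[P]_w (cst (K.+1 ^ q)%:R%:E w) <= _)%E; last first.
    by rewrite integral_cst//= probability_setT mule1.
  apply: ge0_le_integral => //.
  - by move=> w _; apply: sume_ge0 => i _; rewrite lee_fin.
  - by apply: emeasurable_sum => i; exact/measurable_realfun.measurable_EFinP.
  move=> w _; rewrite sumEFin lee_fin.
  apply: le_trans (_ : \sum_i (good w i)%:R <= _).
    apply: ler_sum => i _; rewrite indicE ler_nat; case: (boolP (w \in E i)) => //.
    by rewrite inE => /gE ->.
  rewrite -natr_sum ler_nat; apply: leq_trans (good_card w).
  have -> : #|[set i | good w i]%SET| = (\sum_(i : I) good w i)%N; last by [].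
  rewrite -sum1_card big_mkcond; apply: eq_bigr => i _.
  by rewrite finset.in_set; case: (good w i).
have low : ((#|I|%:R * (1 - alpha))%:E <= \sum_(i <- index_enum I) P (E i))%E.
  apply: le_trans (_ : \sum_(i <- index_enum I) (1 - alpha)%:E <= _)%E.
    by rewrite sumEFin lee_fin sumr_const mulr_natl.
  by apply: lee_sum => i _.
by have := le_trans low up; rewrite lee_fin.
Qed.

End Packing.

Lemma sq_packing_bound {R : realType} {n d : nat} {rch fmin fmax L : R} {q : nat}
    {eps tau alpha : R} {dO : measure_display} {Omega : measurableType dO}
    {P : probability Omega R} {A : Omega -> sq_alg R n}
    {I : finType} {M : I -> set 'rV[R]_n} {f : I -> 'rV[R]_n -> R} :
  rand_sq_estimates d rch fmin fmax L q eps tau alpha P A ->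
  0 < tau -> 0 <= fmin ->
  (forall i, in_model d rch fmin fmax L (M i) (f i)) ->
  (forall i j K, i != j -> (hausdorff_dist (M i) K <= eps%:E)%E ->
     (hausdorff_dist (M j) K <= eps%:E)%E -> False) ->
  #|I|%:R * (1 - alpha) <= (1 + tau^-1) ^+ q.
Proof.
move=> est tau0 fmin0 model apart.
have tauK : (Num.truncn tau^-1).+1%:R^-1 <= tau.
  by rewrite -[leRHS]invrK lef_pV2 ?posrE ?invr_gt0// ltW// truncnS_gt.
apply: le_trans (grid_packing_bound est fmin0 model apart tauK) _.
rewrite natrX lerXn2r ?nnegrE ?addr_ge0 ?invr_ge0 ?(ltW tau0)//.
by rewrite -natr1 addrC lerD2l truncn_le invr_ge0 ltW.
Qed.

(** * Bumps *)

Section CubicBump.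
Context {R : realFieldType}.
Implicit Types s t h p : R.

(** The cube is the least power for which the positive part is of class C^2; [cube_plus] of 1 - t^2
    is the radial profile of a bump. *)
Definition cube_plus (u : R) : R := Num.max u 0 ^+ 3.

(** The function 1 - t^2, cut off at 0, has slope at most 2, and the cube on [0, 1] has slope at
    most 3. *)
Lemma cube_plus_lip s t h : 0 <= s -> 0 <= t -> `|t - s| <= h ->
  `|cube_plus (1 - t ^+ 2) - cube_plus (1 - s ^+ 2)| <= 6 * h.
Proof.
rewrite ler_norml => s0 t0 /andP[h1 h2].
have key (a b : R) : 0 <= a -> a <= 1 -> 0 <= b -> b <= 1 -> `|b - a| <= 2 * h ->
    `|b ^+ 3 - a ^+ 3| <= 6 * h.
  move=> a0 a1 b0 b1 ab.
  have -> : b ^+ 3 - a ^+ 3 = (b - a) * (b ^+ 2 + b * a + a ^+ 2) by ring.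
  have q : `|b ^+ 2 + b * a + a ^+ 2| <= 3 by rewrite ger0_norm; nra.
  rewrite normrM; have -> : 6 * h = 2 * h * 3 by ring.
  exact: ler_pM.
have m0 (u : R) : 0 <= Num.max (1 - u ^+ 2) 0 by rewrite le_max lexx orbT.
have m1 (u : R) : Num.max (1 - u ^+ 2) 0 <= 1.
  by rewrite ge_max ler01 andbT lerBlDr lerDl sqr_ge0.
apply: key => //.
have mE (u : R) : 0 <= u -> Num.max (1 - u ^+ 2) 0 = if u <= 1 then 1 - u ^+ 2 else 0.
  move=> u0; case: ifPn => [u1|]; first by rewrite max_l// subr_ge0 exprn_ile1.
  by rewrite -ltNge => /ltW u1; rewrite max_r// subr_le0 exprn_ege1.
rewrite !mE//; case: (leP t 1) => t1; case: (leP s 1) => s1; rewrite ler_norml.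
- have r1 : 0 <= h by lra.
  have r2 : 0 <= (h - (t - s)) * (s + t) by rewrite mulr_ge0; lra.
  have r3 : 0 <= (h + (t - s)) * (s + t) by rewrite mulr_ge0; lra.
  have r4 : 0 <= h * (2 - (s + t)) by rewrite mulr_ge0; lra.
  apply/andP; split; nra.
- have r1 : 0 <= (1 - t) * (1 + t) by rewrite mulr_ge0; lra.
  have r2 : 0 <= (1 - t) * (1 - t) by rewrite mulr_ge0; lra.
  apply/andP; split; nra.
- have r1 : 0 <= (1 - s) * (1 + s) by rewrite mulr_ge0; lra.
  have r2 : 0 <= (1 - s) * (1 - s) by rewrite mulr_ge0; lra.
  apply/andP; split; nra.
- apply/andP; split; lra.
Qed.

(** Here s and t are the scaled distances of two points from the centre, h is their mutual distance
    and p the scalar product of the first position vector with the step, so the quadratic relation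
    is the law of cosines. The cases separate points inside and outside the support. *)
Lemma cube_plus_taylor s t h p : 0 <= s -> 0 <= t -> 0 <= h ->
  t ^+ 2 = s ^+ 2 + 2 * p + h ^+ 2 -> `|t - s| <= h -> `|p| <= s * h ->
  `|cube_plus (1 - t ^+ 2) - cube_plus (1 - s ^+ 2) +
     6 * Num.max (1 - s ^+ 2) 0 ^+ 2 * p| <= 4 * h ^+ 2.
Proof.
rewrite !ler_norml => s0 t0 h0 tE /andP[h1 h2] /andP[p1 p2].
have hh : (t - s) ^+ 2 <= h ^+ 2 by nra.
rewrite /cube_plus; case: (leP (1 - s ^+ 2) 0) => ss; case: (leP (1 - t ^+ 2) 0) => tt.
- rewrite !expr0n/= !subrr mulr0 mul0r addr0; apply/andP; split; nra.
- have s1 : 1 <= s by nra.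
  have t1 : t <= 1 by nra.
  have q1 : (1 - t) ^+ 2 <= h ^+ 2 by nra.
  have q2 : (1 - t ^+ 2) ^+ 3 <= 4 * (1 - t) ^+ 2.
    have -> : (1 - t ^+ 2) ^+ 3 = (1 - t) ^+ 2 * ((1 - t ^+ 2) * (1 + t) ^+ 2) by ring.
    rewrite mulrC ler_wpM2r ?sqr_ge0//; nra.
  have q3 : 0 <= (1 - t ^+ 2) ^+ 3 by rewrite exprn_ge0// ltW.
  rewrite !expr0n/= !mulr0 mul0r subr0 addr0; apply/andP; split; nra.
- have s1 : s <= 1 by nra.
  have t1 : 1 <= t by nra.
  have A0 : 0 <= 1 - s ^+ 2 by exact: ltW.
  have A1 : 1 - s ^+ 2 <= 1 by nra.
  have B0 : 0 <= t ^+ 2 - 1 by nra.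
  have q0 : (1 - s ^+ 2) ^+ 2 <= 1 by rewrite exprn_ile1.
  have pE : p = ((1 - s ^+ 2) + (t ^+ 2 - 1) - h ^+ 2) / 2 by lra.
  rewrite expr0n/= sub0r; apply/andP; split.
    have -> : - (1 - s ^+ 2) ^+ 3 + 6 * (1 - s ^+ 2) ^+ 2 * p =
        2 * (1 - s ^+ 2) ^+ 3 + 3 * ((1 - s ^+ 2) ^+ 2 * (t ^+ 2 - 1)) -
          3 * ((1 - s ^+ 2) ^+ 2 * h ^+ 2).
      by rewrite pE; field.
    have r1 : 0 <= (1 - s ^+ 2) ^+ 3 by rewrite exprn_ge0.
    have r2 : 0 <= (1 - s ^+ 2) ^+ 2 * (t ^+ 2 - 1) by rewrite mulr_ge0 ?sqr_ge0.
    have r3 : (1 - s ^+ 2) ^+ 2 * h ^+ 2 <= h ^+ 2 by rewrite ler_piMl ?sqr_ge0.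
    have r4 := sqr_ge0 h; lra.
  have r1 : 0 <= (1 - s ^+ 2) ^+ 3 by rewrite exprn_ge0.
  have r2 : (1 - s ^+ 2) ^+ 2 * p <= (1 - s ^+ 2) ^+ 2 * (s * h).
    by rewrite ler_wpM2l ?sqr_ge0.
  have r3 : (1 - s) * h <= h ^+ 2 by rewrite expr2 ler_wpM2r//; lra.
  have r4 : (1 - s ^+ 2) ^+ 2 * (s * h) =
      (s * (1 - s) * (1 + s) ^+ 2) * ((1 - s) * h) by ring.
  (* A step leaving the support has 1 - s <= h; together with p <= s h this bounds 6 (1 - s^2)^2 p
     by 6 times 2/3 h^2, whence the 4. The two squares below certify the bound 2/3. *)
  have r5 : s * (1 - s) * (1 + s) ^+ 2 <= 2 / 3.
    have : 0 <= (s ^+ 2 + s / 2 - 7 / 10) ^+ 2 by exact: sqr_ge0.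
    have : 0 <= (s - 1) ^+ 2 by exact: sqr_ge0.
    have -> : s * (1 - s) * (1 + s) ^+ 2 = s + s ^+ 2 - s ^+ 3 - s ^+ 4 by ring.
    have -> : (s ^+ 2 + s / 2 - 7 / 10) ^+ 2 = s ^+ 4 + s ^+ 3 - 23/20 * s ^+ 2
        - 7 / 10 * s + 49 / 100 by field.
    have -> : (s - 1) ^+ 2 = s ^+ 2 - 2 * s + 1 by ring.
    lra.
  have r6 : 0 <= s * (1 - s) * (1 + s) ^+ 2.
    by rewrite !mulr_ge0 ?exprn_ge0//; lra.
  have r7 : (s * (1 - s) * (1 + s) ^+ 2) * ((1 - s) * h) <= 2 / 3 * h ^+ 2.
    by apply: ler_pM => //; rewrite mulr_ge0//; lra.
  have -> : 6 * (1 - s ^+ 2) ^+ 2 * p = 6 * ((1 - s ^+ 2) ^+ 2 * p) by ring.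
  lra.
have s1 : s <= 1 by nra.
have t1 : t <= 1 by nra.
have A0 : 0 <= 1 - s ^+ 2 by exact: ltW.
have B0 : 0 <= 1 - t ^+ 2 by exact: ltW.
have q0 : (1 - s ^+ 2) ^+ 2 <= 1 by rewrite exprn_ile1//; nra.
have pE : p = (t ^+ 2 - s ^+ 2 - h ^+ 2) / 2 by lra.
have -> : (1 - t ^+ 2) ^+ 3 - (1 - s ^+ 2) ^+ 3 + 6 * (1 - s ^+ 2) ^+ 2 * p =
    (t - s) ^+ 2 * ((s + t) ^+ 2 * (3 - t ^+ 2 - 2 * s ^+ 2)) -
    3 * ((1 - s ^+ 2) ^+ 2 * h ^+ 2).
  by rewrite pE; field.
have r2 : 0 <= (s + t) ^+ 2 * (3 - t ^+ 2 - 2 * s ^+ 2).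
  by rewrite mulr_ge0 ?sqr_ge0//; nra.
have r3 : (1 - s ^+ 2) ^+ 2 * h ^+ 2 <= h ^+ 2 by rewrite ler_piMl ?sqr_ge0.
have r4 : 0 <= (1 - s ^+ 2) ^+ 2 * h ^+ 2 by rewrite mulr_ge0 ?sqr_ge0.
have r5 : (s + t) ^+ 2 * (3 - t ^+ 2 - 2 * s ^+ 2) <= 4.
  (* The difference of the two sides is (t - 2 s)^2 / 3. *)
  have e1 : 3 - t ^+ 2 - 2 * s ^+ 2 <= 3 - 2 / 3 * (s + t) ^+ 2.
    have := sqr_ge0 (t - 2 * s); nra.
  apply: le_trans (ler_wpM2l (sqr_ge0 _) e1) _.
  have := sqr_ge0 ((s + t) ^+ 2 - 9 / 4); move: ((s + t) ^+ 2) => w; nra.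
have r6 : (t - s) ^+ 2 * ((s + t) ^+ 2 * (3 - t ^+ 2 - 2 * s ^+ 2)) <= h ^+ 2 * 4.
  by apply: ler_pM => //; exact: sqr_ge0.
have r7 : 0 <= (t - s) ^+ 2 * ((s + t) ^+ 2 * (3 - t ^+ 2 - 2 * s ^+ 2)).
  by rewrite mulr_ge0 ?sqr_ge0.
have r8 := sqr_ge0 h.
by apply/andP; split; lra.
Qed.

End CubicBump.

Section Bump.
Context {R : realType} {n : nat}.
Variable (delta : R) (c : 'rV[R]_n).
Hypothesis delta_gt0 : 0 < delta.
Implicit Types x y w : 'rV[R]_n.

Definition bump x : R := cube_plus (1 - (enorm (x - c) / delta) ^+ 2).

(** The differential of [bump] at x, applied to w, in closed form; the reach estimate uses its
    linearity, its size and the quadratic remainder. *)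
Definition dbump x w : R :=
  - (6 * Num.max (1 - (enorm (x - c) / delta) ^+ 2) 0 ^+ 2 * (dotp (x - c) w / delta ^+ 2)).

Let nrm x := enorm (x - c) / delta.

Let nrm_ge0 x : 0 <= nrm x.
Proof. by rewrite divr_ge0 ?enorm_ge0// ltW. Qed.

Let nrm_ge1 x : delta <= enorm (x - c) -> 1 <= nrm x.
Proof. by move=> h; rewrite ler_pdivlMr// mul1r. Qed.

Let nrm_lip x y : `|nrm y - nrm x| <= enorm (y - x) / delta.
Proof.
have di : 0 <= delta^-1 by rewrite invr_ge0 ltW.
rewrite /nrm -mulrBl normrM (ger0_norm di).
rewrite ler_pM2r ?invr_gt0// ler_norml; apply/andP; split.
  by rewrite lerNl opprB lerBlDr; have := enorm_sub x y c; rewrite (enormB x y).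
by rewrite lerBlDr; exact: enorm_sub.
Qed.

Lemma bump_out x : delta <= enorm (x - c) -> bump x = 0.
Proof.
move=> /nrm_ge1 h; rewrite /bump /cube_plus -/(nrm x) max_r ?expr0n//.
by rewrite subr_le0 exprn_ege1.
Qed.

Lemma dbump_out x w : delta <= enorm (x - c) -> dbump x w = 0.
Proof.
move=> /nrm_ge1 h; rewrite /dbump -/(nrm x) max_r ?expr0n/= ?mulr0 ?mul0r ?oppr0//.
by rewrite subr_le0 exprn_ege1.
Qed.

Lemma bump_center : bump c = 1.
Proof. by rewrite /bump /cube_plus subrr enorm0 mul0r expr0n subr0 max_l// expr1n. Qed.

Lemma bump_itv x : 0 <= bump x <= 1.
Proof.
rewrite /bump /cube_plus exprn_ge0 ?le_max ?lexx ?orbT//=.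
rewrite exprn_ile1 ?le_max ?lexx ?orbT// ge_max ler01 andbT lerBlDr lerDl.
by rewrite sqr_ge0.
Qed.

Lemma bump_lip x y : `|bump y - bump x| <= 6 / delta * enorm (y - x).
Proof.
rewrite mulrAC -mulrA.
exact: (cube_plus_lip (nrm_ge0 x) (nrm_ge0 y) (nrm_lip x y)).
Qed.

Lemma dbump_bound x w : `|dbump x w| <= 6 / delta * enorm w.
Proof.
have [xd|h] := ltP (enorm (x - c)) delta; last first.
  by rewrite dbump_out// normr0 !mulr_ge0 ?invr_ge0 ?enorm_ge0 ?(ltW delta_gt0).
rewrite /dbump normrN normrM.
set m := Num.max _ _.
have m0 : 0 <= m by rewrite le_max lexx orbT.
have m1 : m <= 1 by rewrite ge_max ler01 andbT lerBlDr lerDl sqr_ge0.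
rewrite ger0_norm ?mulr_ge0 ?sqr_ge0//.
have hd : `|dotp (x - c) w / delta ^+ 2| <= enorm w / delta.
  rewrite normrM normfV (ger0_norm (sqr_ge0 delta)).
  rewrite ler_pdivrMr ?exprn_gt0// expr2 mulrA divfK ?gt_eqF//.
  apply: le_trans (dotp_norm_le _ _) _; rewrite mulrC.
  by apply: ler_wpM2l; [exact: enorm_ge0|exact: ltW xd].
have -> : 6 / delta * enorm w = 6 * (enorm w / delta) by rewrite mulrAC mulrA.
apply: ler_pM => //; first by rewrite mulr_ge0 ?sqr_ge0.
by rewrite ler_piMr// exprn_ile1.
Qed.

Lemma bump_taylor x y :
  `|bump y - bump x - dbump x (y - x)| <= 4 / delta ^+ 2 * enorm (y - x) ^+ 2.
Proof.
have d0 : delta != 0 by rewrite gt_eqF.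
have -> : 4 / delta ^+ 2 * enorm (y - x) ^+ 2 = 4 * (enorm (y - x) / delta) ^+ 2.
  by field.
have -> : bump y - bump x - dbump x (y - x) = cube_plus (1 - nrm y ^+ 2) -
    cube_plus (1 - nrm x ^+ 2) + 6 * Num.max (1 - nrm x ^+ 2) 0 ^+ 2 *
      (dotp (x - c) (y - x) / delta ^+ 2).
  by rewrite /dbump opprK.
apply: cube_plus_taylor => //.
- by rewrite divr_ge0 ?enorm_ge0// ltW.
- rewrite /nrm !expr_div_n !enorm_sq.
  have -> : y - c = (x - c) + (y - x) by rewrite [RHS]addrC addrA subrK.
  rewrite (dotp_sqrD (x - c) (y - x)).
  by field.
rewrite /nrm normrM normfV (ger0_norm (sqr_ge0 delta)) mulrACA -invfM -expr2.
by rewrite ler_pM2r ?invr_gt0 ?exprn_gt0// dotp_norm_le.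
Qed.

End Bump.

Section Displacement.
Context {R : realType} {n : nat} {I : finType}.
Variables (delta lam : R) (c v : I -> 'rV[R]_n).
Hypothesis delta_gt0 : 0 < delta.
Hypothesis lam_ge0 : 0 <= lam.
Hypothesis c_sep : forall i j, i != j -> 2 * delta < enorm (c i - c j).
Hypothesis v_le1 : forall i, enorm (v i) <= 1.
Implicit Types x y w : 'rV[R]_n.

Definition displace x : 'rV[R]_n := \sum_i (lam * bump delta (c i) x) *: v i.

Definition ddisplace x w : 'rV[R]_n := \sum_i (lam * dbump delta (c i) x w) *: v i.

Let near_le1 x : \sum_i (enorm (x - c i) < delta)%R%:R <= 1 :> R.
Proof.
have [[i xi]|h] := pselect (exists i, enorm (x - c i) < delta).
  rewrite (bigD1 i)//= xi big1 ?addr0// => j ji.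
  case: ltP => // xj; have := c_sep ji; have := enorm_sub (c j) x (c i).
  rewrite (enormB (c j) x); lra.
rewrite big1// => i _; case: ltP => // xi; case: h; by exists i.
Qed.

(** Supports are disjoint, so only the bump near x and the bump near y contribute, hence the factor
    2; [sum_bound1], with a single point, does without it. *)
Let sum_bound (a : I -> R) (C : R) x y : 0 <= C -> (forall i, `|a i| <= C) ->
  (forall i, delta <= enorm (x - c i) -> delta <= enorm (y - c i) -> a i = 0) ->
  enorm (\sum_i a i *: v i) <= 2 * C.
Proof.
move=> C0 aC a0; apply: le_trans (enorm_sum _ _ _) _.
apply: le_trans (_ : \sum_i (C * (enorm (x - c i) < delta)%R%:R +
    C * (enorm (y - c i) < delta)%R%:R) <= _).
  apply: ler_sum => i _; rewrite enormZ.
  apply: le_trans (_ : `|a i| <= _); first by rewrite ler_piMr.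
  have := aC i; case: ltP => xi; case: ltP => yi; rewrite ?mulr1 ?mulr0; try lra.
  by rewrite a0// normr0 addr0.
rewrite big_split/= -!mulr_sumr.
have := ler_wpM2l C0 (near_le1 x); have := ler_wpM2l C0 (near_le1 y); lra.
Qed.

Let sum_bound1 (a : I -> R) (C : R) x : 0 <= C -> (forall i, `|a i| <= C) ->
  (forall i, delta <= enorm (x - c i) -> a i = 0) ->
  enorm (\sum_i a i *: v i) <= C.
Proof.
move=> C0 aC a0; apply: le_trans (enorm_sum _ _ _) _.
apply: le_trans (_ : \sum_i C * (enorm (x - c i) < delta)%R%:R <= _).
  apply: ler_sum => i _; rewrite enormZ.
  apply: le_trans (_ : `|a i| <= _); first by rewrite ler_piMr.
  have := aC i; case: ltP => xi; rewrite ?mulr1 ?mulr0//.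
  by rewrite a0// normr0.
by rewrite -mulr_sumr; have := ler_wpM2l C0 (near_le1 x); rewrite mulr1.
Qed.

Lemma displace_le x : enorm (displace x) <= lam.
Proof.
apply: (sum_bound1 (x := x)) => // i; last by move=> h; rewrite bump_out ?mulr0.
have /andP[b0 b1] := bump_itv delta (c i) x.
by rewrite normrM !ger0_norm// ler_piMr.
Qed.

Lemma displace_center i : displace (c i) = lam *: v i.
Proof.
rewrite /displace (bigD1 i)//= bump_center mulr1 big1 ?addr0// => j ji.
rewrite bump_out ?mulr0 ?scale0r// ltW// (lt_trans _ (c_sep _)) 1?eq_sym//.
by rewrite ltr_pMl// ltr1n.
Qed.

Lemma displace_lip x y :
  enorm (displace y - displace x) <= 12 * lam / delta * enorm (y - x).
Proof.
have -> : displace y - displace x =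
    \sum_i (lam * (bump delta (c i) y - bump delta (c i) x)) *: v i.
  by rewrite -sumrB; apply: eq_bigr => i _; rewrite -scalerBl mulrBr.
have -> : 12 * lam / delta * enorm (y - x) = 2 * (lam * (6 / delta * enorm (y - x))).
  by field; rewrite gt_eqF.
apply: (sum_bound (x := x) (y := y)).
- by rewrite !mulr_ge0 ?enorm_ge0 ?invr_ge0// ltW.
- by move=> i; rewrite normrM ger0_norm// ler_wpM2l// bump_lip.
- by move=> i xi yi; rewrite !bump_out// subrr mulr0.
Qed.

(** Stated with twice the available constant, so that a single slope constant serves both [displace]
    and its differential. *)
Lemma ddisplace_le x w : enorm (ddisplace x w) <= 12 * lam / delta * enorm w.
Proof.
apply: le_trans (_ : lam * (6 / delta * enorm w) <= _).
  apply: (sum_bound1 (x := x)).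
  - by rewrite !mulr_ge0 ?enorm_ge0 ?invr_ge0// ltW.
  - by move=> i; rewrite normrM ger0_norm// ler_wpM2l// dbump_bound.
  - by move=> i xi; rewrite dbump_out// mulr0.
have -> : 12 * lam / delta * enorm w = 2 * (lam * (6 / delta * enorm w)).
  by field; rewrite gt_eqF.
have : 0 <= lam * (6 / delta * enorm w).
  by rewrite !mulr_ge0 ?enorm_ge0 ?invr_ge0// ltW.
by move: (lam * _) => u; lra.
Qed.

Lemma ddisplaceD x w w' : ddisplace x (w + w') = ddisplace x w + ddisplace x w'.
Proof.
rewrite /ddisplace -big_split; apply: eq_bigr => i _ /=; rewrite -scalerDl; congr (_ *: _).
by rewrite /dbump dotpDr; ring.
Qed.

Lemma ddisplaceZ x (a : R) w : ddisplace x (a *: w) = a *: ddisplace x w.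
Proof.
rewrite /ddisplace scaler_sumr; apply: eq_bigr => i _; rewrite scalerA; congr (_ *: _).
by rewrite /dbump dotpZr; ring.
Qed.

Lemma displace_taylor x y :
  enorm (displace y - displace x - ddisplace x (y - x)) <=
    8 * lam / delta ^+ 2 * enorm (y - x) ^+ 2.
Proof.
have -> : displace y - displace x - ddisplace x (y - x) =
    \sum_i (lam * (bump delta (c i) y - bump delta (c i) x - dbump delta (c i) x (y - x))) *: v i.
  by rewrite -!sumrB; apply: eq_bigr => i _; rewrite -!scalerBl !mulrBr.
have -> : 8 * lam / delta ^+ 2 * enorm (y - x) ^+ 2 =
    2 * (lam * (4 / delta ^+ 2 * enorm (y - x) ^+ 2)).
  by field; rewrite gt_eqF.
apply: (sum_bound (x := x) (y := y)).
- by apply: mulr_ge0 => //; apply: mulr_ge0; [rewrite divr_ge0 ?sqr_ge0|exact: sqr_ge0].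
- by move=> i; rewrite normrM ger0_norm// ler_wpM2l// bump_taylor.
- by move=> i xi yi; rewrite !bump_out// dbump_out// subrr subr0 mulr0.
Qed.

End Displacement.

(** * Functions of class C^2 *)

Section SmoothFunctions.
Context {R : realType} {m : nat}.
Implicit Types (f g : 'rV[R]_m -> R) (h dh : R -> R).

Lemma continuous_mul f g : continuous f -> continuous g -> continuous (fun x => f x * g x).
Proof. by move=> cf cg x; exact: (cvgM (cf x) (cg x)). Qed.

Lemma continuous_add f g : continuous f -> continuous g -> continuous (fun x => f x + g x).
Proof. by move=> cf cg x; exact: (cvgD (cf x) (cg x)). Qed.

(** Scalar functions on the whole space: charts are treated coordinate by coordinate, where class
    C^2 is stable under sums, products, inverses and composition. *)
Definition C1f f : Prop :=
  (forall x, differentiable f x) /\ (forall v : 'rV[R]_m, continuous ('D_v f)).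

Definition C2f f : Prop := C1f f /\ forall v : 'rV[R]_m, C1f ('D_v f).

Lemma C1f_continuous f : C1f f -> continuous f.
Proof. by move=> [df _] x; exact: differentiable_continuous. Qed.

Lemma C1f_cst (a : R) : C1f (cst a).
Proof.
split=> [x|v]; first exact: differentiable_cst.
have -> : 'D_v (cst a) = cst 0 :> ('rV[R]_m -> R) by apply/funext => x; rewrite derive_cst.
exact: cst_continuous.
Qed.

Lemma C2f_cst (a : R) : C2f (cst a).
Proof.
split=> [|v]; first exact: C1f_cst.
have -> : 'D_v (cst a) = cst 0 :> ('rV[R]_m -> R) by apply/funext => x; rewrite derive_cst.
exact: C1f_cst.
Qed.

Let derive_coord i (v : 'rV[R]_m) :
  'D_v (fun x : 'rV[R]_m => x ord0 i : R) = cst (v ord0 i).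
Proof.
apply/funext => x.
have d : derivable (id : 'rV[R]_m -> 'rV[R]_m) x v by exact: derivable_id.
have := derive_mx d.
by rewrite derive_id => /matrixP/(_ ord0 i); rewrite mxE.
Qed.

Lemma C2f_coord i : C2f (fun x : 'rV[R]_m => x ord0 i).
Proof.
split; last by move=> v; rewrite derive_coord; exact: C1f_cst.
split=> [x|v]; first exact: differentiable_coord.
by rewrite derive_coord; exact: cst_continuous.
Qed.

Let deriveDE f g v : (forall x, differentiable f x) -> (forall x, differentiable g x) ->
  'D_v (fun x => f x + g x) = (fun x => 'D_v f x + 'D_v g x).
Proof.
by move=> df dg; apply/funext => x; apply: (@deriveD _ _ _ f g); exact: diff_derivable.
Qed.

Let deriveME f g v : (forall x, differentiable f x) -> (forall x, differentiable g x) ->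
  'D_v (fun x => f x * g x) = (fun x => f x * 'D_v g x + g x * 'D_v f x).
Proof.
by move=> df dg; apply/funext => x; apply: (@deriveM _ _ f g); exact: diff_derivable.
Qed.

Lemma C1fD f g : C1f f -> C1f g -> C1f (fun x => f x + g x).
Proof.
move=> [df cf] [dg cg]; split=> [x|v]; first exact: (@differentiableD _ _ _ f g).
rewrite (deriveDE v df dg); exact: (continuous_add (cf v) (cg v)).
Qed.

Lemma C2fD f g : C2f f -> C2f g -> C2f (fun x => f x + g x).
Proof.
move=> [f1 f2] [g1 g2]; split=> [|v]; first exact: C1fD.
by rewrite (deriveDE v (proj1 f1) (proj1 g1)); exact: C1fD.
Qed.

Lemma C1fM f g : C1f f -> C1f g -> C1f (fun x => f x * g x).
Proof.
move=> f1 g1; have [df cf] := f1; have [dg cg] := g1.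
split=> [x|v]; first exact: (@differentiableM _ _ f g).
rewrite (deriveME v df dg).
apply: (@continuous_add (fun x => f x * 'D_v g x) (fun x => g x * 'D_v f x)).
  exact: (continuous_mul (C1f_continuous f1) (cg v)).
exact: (continuous_mul (C1f_continuous g1) (cf v)).
Qed.

Lemma C2fM f g : C2f f -> C2f g -> C2f (fun x => f x * g x).
Proof.
move=> [f1 f2] [g1 g2]; split=> [|v]; first exact: C1fM.
rewrite (deriveME v (proj1 f1) (proj1 g1)).
by apply: C1fD; exact: C1fM.
Qed.

Lemma C2f_sum (I : Type) (s : seq I) (F : I -> 'rV[R]_m -> R) :
  (forall i, C2f (F i)) -> C2f (fun x => \sum_(i <- s) F i x).
Proof.
move=> FC; elim: s => [|i s IH].
  rewrite (_ : (fun _ => _) = cst 0); first exact: C2f_cst.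
  by apply/funext => x; rewrite big_nil.
have -> : (fun x => \sum_(j <- i :: s) F j x) = (fun x => F i x + \sum_(j <- s) F j x).
  by apply/funext => x; rewrite big_cons.
exact: (C2fD (FC i) IH).
Qed.

Let derive_comp f h dh v : (forall x, differentiable f x) ->
  (forall x, is_derive (f x) (1:R) h (dh (f x))) ->
  'D_v (fun x => h (f x)) = (fun x => dh (f x) * 'D_v f x).
Proof.
move=> df hdh; apply/funext => x.
have dhx : differentiable h (f x) by apply/derivable1_diffP; have [] := hdh x.
have dfx : differentiable (h \o f) x by apply: differentiable_comp.
rewrite -[LHS]/('D_v (h \o f) x) deriveE// diff_comp//= diff1E// deriveE//.
by rewrite derive1E (@derive_val _ _ _ _ _ _ _ (hdh x)) /GRing.scale/= mulrC.
Qed.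

Let differentiable_compE f h dh : (forall x, differentiable f x) ->
  (forall x, is_derive (f x) (1:R) h (dh (f x))) ->
  forall x, differentiable (fun x => h (f x)) x.
Proof.
move=> df hdh x; apply: (@differentiable_comp _ _ _ _ f h) => //.
by apply/derivable1_diffP; have [] := hdh x.
Qed.

Lemma C1f_comp f h dh : C1f f -> (forall x, is_derive (f x) (1:R) h (dh (f x))) ->
  continuous (fun x => dh (f x)) -> C1f (fun x => h (f x)).
Proof.
move=> [df cf] hdh cdh; split=> [x|v]; first exact: (differentiable_compE df hdh).
rewrite (derive_comp v df hdh); exact: (continuous_mul cdh (cf v)).
Qed.

(** The derivative of the outer function is prescribed only along the values of [f]; this admits the
    inverse of a function without zeros. *)
Lemma C2f_comp f h dh : C2f f -> (forall x, is_derive (f x) (1:R) h (dh (f x))) ->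
  C1f (fun x => dh (f x)) -> C2f (fun x => h (f x)).
Proof.
move=> [f1 f2] hdh dh1; split=> [|v].
  by apply: C1f_comp f1 hdh _; exact: C1f_continuous.
by rewrite (derive_comp v (proj1 f1) hdh); apply: C1fM.
Qed.

Let is_derive_inv (u : R) : u != 0 -> is_derive u (1:R) (fun u : R => u^-1) (- u ^- 2).
Proof.
move=> u0; have d : derivable (id : R -> R) u 1 by exact: derivable_id.
apply: DeriveDef; first exact: (@derivableV _ _ id).
by rewrite (@deriveV _ _ id)// derive_id /GRing.scale/= mulr1.
Qed.

Lemma C1fV f : C1f f -> (forall x, f x != 0) -> C1f (fun x => (f x)^-1).
Proof.
move=> f1 f0; have dV x : is_derive (f x) (1:R) (fun u : R => u^-1) (- (f x) ^- 2).
  exact: is_derive_inv.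
have cV : continuous (fun x => (f x)^-1).
  move=> x; apply: (@continuous_comp _ _ _ f (@GRing.inv R)); first exact: C1f_continuous.
  exact: inv_continuous.
apply: (C1f_comp (dh := fun u => - u ^- 2) f1 dV).
have -> : (fun x => - f x ^- 2) = (fun x => cst (-1) x * ((f x)^-1 * (f x)^-1)).
  by apply/funext => x /=; rewrite mulN1r -invfM expr2.
apply: (@continuous_mul (cst (-1)) (fun x => (f x)^-1 * (f x)^-1)).
  exact: cst_continuous.
exact: (continuous_mul cV cV).
Qed.

Lemma C2fV f : C2f f -> (forall x, f x != 0) -> C2f (fun x => (f x)^-1).
Proof.
move=> f2 f0; have dV x : is_derive (f x) (1:R) (fun u : R => u^-1) (- (f x) ^- 2).
  exact: is_derive_inv.
apply: (C2f_comp (dh := fun u => - u ^- 2) f2 dV).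
have -> : (fun x => - f x ^- 2) = (fun x => cst (-1) x * ((f x)^-1 * (f x)^-1)).
  by apply/funext => x /=; rewrite mulN1r -invfM expr2.
apply: C1fM; first exact: C1f_cst.
by apply: C1fM; apply: C1fV => //; case: f2.
Qed.

End SmoothFunctions.

Section CubePlusSmooth.
Context {R : realType}.

(** At the kink of the positive part the usual differentiation rules do not apply; a quadratic
    remainder covers both sides at once. *)
Lemma quadratic_is_derive (f : R -> R) (x a C : R) :
  (forall h, `|h| <= 1 -> `|f (x + h) - f x - a * h| <= C * h ^+ 2) ->
  is_derive x (1:R) f a.
Proof.
move=> fC; have C0 : 0 <= C.
  have n1 : `|1 : R| <= 1 by rewrite normr1.
  by have := fC 1 n1; rewrite expr1n !mulr1; apply: le_trans.
have lim : h^-1 *: (f (h *: (1:R) + x) - f x) @[h --> (0:R)^'] --> a.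
  apply/cvgrPdist_le => /= e e0; near=> h.
  have h0 : h != 0 by near: h; exact: nbhs_dnbhs_neq.
  have h1 : `|h| <= 1 by near: h; exact: dnbhs0_le.
  have h2 : `|h| <= e / (C + 1).
    by near: h; apply: dnbhs0_le; rewrite divr_gt0// ltr_wpDl.
  rewrite /GRing.scale/= mulr1 [h + x]addrC.
  have -> : a - h^-1 * (f (x + h) - f x) = - (h^-1 * (f (x + h) - f x - a * h)) by field.
  rewrite normrN normrM normfV ler_pdivrMl ?normr_gt0//.
  apply: le_trans (fC h h1) _; rewrite -real_normK ?num_real// expr2 mulrCA.
  rewrite ler_wpM2l//; move: h2; rewrite ler_pdivlMr ?ltr_wpDl// mulrDr mulr1 mulrC => h2.
  by apply: le_trans h2; rewrite lerDl.
apply: DeriveDef; first by apply/cvg_ex; exists a.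
exact: cvg_lim lim.
Unshelve. all: by end_near. Qed.

Lemma is_derive_pos_sq (u : R) :
  is_derive u (1:R) (fun u : R => Num.max u 0 ^+ 2) (2 * Num.max u 0).
Proof.
apply: (@quadratic_is_derive _ _ _ 1) => h _; rewrite mul1r ler_norml.
case: (leP u 0) => u0; case: (leP (u + h) 0) => h0; apply/andP; split; nra.
Qed.

Lemma is_derive_cube_plus (u : R) :
  is_derive u (1:R) (@cube_plus R) (3 * Num.max u 0 ^+ 2).
Proof.
(* For u and u + h positive the remainder is (3 u + h) h^2, with |h| <= 1. *)
apply: (@quadratic_is_derive _ _ _ (3 * `|u| + 1)) => h; rewrite ler_norml => /andP[h1 h2].
rewrite /cube_plus; case: (leP u 0) => u0; case: (leP (u + h) 0) => h0.
- rewrite !expr0n/= subrr mulr0 mul0r subr0 normr0.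
  by apply: mulr_ge0; [rewrite addr_ge0// mulr_ge0|exact: sqr_ge0].
- rewrite !expr0n/= mulr0 mul0r !subr0 ger0_norm ?exprn_ge0 ?(ltW h0)//.
  have k1 : (u + h) ^+ 2 <= h ^+ 2 by nra.
  have k2 : u + h <= 1 by lra.
  have k3 : (u + h) ^+ 3 <= h ^+ 2.
    by rewrite exprS; apply: le_trans k1; rewrite ler_piMl ?sqr_ge0.
  apply: le_trans k3 _; rewrite ler_peMl ?sqr_ge0//.
  by rewrite lerDr mulr_ge0.
- have k0 : 0 <= u by exact: ltW.
  have -> : 0 ^+ 3 - u ^+ 3 - 3 * u ^+ 2 * h = - (u ^+ 2 * u + 3 * (u ^+ 2 * h)) by ring.
  rewrite normrN (gtr0_norm u0).
  have k1 : u <= - h by lra.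
  have k2 : u ^+ 2 <= h ^+ 2 by nra.
  have k3 : 0 <= u ^+ 2 * (- h - u) by rewrite mulr_ge0 ?sqr_ge0//; lra.
  have k4 : 0 <= u ^+ 2 * u by rewrite mulr_ge0 ?sqr_ge0.
  have k5 : u ^+ 2 * - h <= h ^+ 2 * - h by rewrite ler_wpM2r//; lra.
  have k6 : 0 <= h ^+ 2 * (1 + h) by rewrite mulr_ge0 ?sqr_ge0//; lra.
  have k7 : 0 <= h ^+ 2 * u by rewrite mulr_ge0 ?sqr_ge0.
  have k8 : 0 <= (u + h) ^+ 2 * u by rewrite mulr_ge0 ?sqr_ge0.
  rewrite ler_norml; apply/andP; split; nra.
have k0 : 0 <= u by exact: ltW.
have -> : (u + h) ^+ 3 - u ^+ 3 - 3 * u ^+ 2 * h = (3 * u + h) * h ^+ 2 by ring.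
rewrite normrM (ger0_norm (sqr_ge0 h)); apply: ler_wpM2r; first exact: sqr_ge0.
by rewrite (gtr0_norm u0) ler_norml; apply/andP; split; lra.
Qed.

Lemma C2f_cube_plus m (f : 'rV[R]_m -> R) : C2f f -> C2f (fun x => cube_plus (f x)).
Proof.
move=> f2; have cf : continuous f by apply: C1f_continuous; case: f2.
apply: (@C2f_comp _ _ f (@cube_plus R) (fun u => 3 * Num.max u 0 ^+ 2) f2).
  by move=> x; exact: is_derive_cube_plus.
apply: (@C1fM _ _ (cst 3) (fun x => Num.max (f x) 0 ^+ 2)); first exact: C1f_cst.
apply: (@C1f_comp _ _ f (fun u => Num.max u 0 ^+ 2) (fun u => 2 * Num.max u 0) (proj1 f2)).
  by move=> x; exact: is_derive_pos_sq.
apply: (@continuous_mul _ _ (cst 2) (fun x => Num.max (f x) 0)).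
  exact: cst_continuous.
move=> x; apply: (@continuous_max _ _ f (cst 0)); first exact: cf.
exact: cst_continuous.
Qed.

End CubePlusSmooth.

Section SmoothMaps.
Context {R : realType} {m p : nat}.
Implicit Type phi : 'rV[R]_m -> 'rV[R]_p.

Let rowE phi : phi = \sum_(j < p) (fun x => phi x ord0 j *: delta_mx ord0 j).
Proof.
apply/funext => x; rewrite {1}(row_sum_delta (phi x)) fct_sumE.
by [].
Qed.

Let continuous_row phi : (forall j, continuous (fun x => phi x ord0 j)) -> continuous phi.
Proof.
move=> h x; rewrite (rowE phi).
elim/big_ind : _ => [|f g cf cg|j _]; first exact: cst_continuous.
  exact: continuousD.
exact: (cvgZr_tmp (h j x)).
Qed.

Let differentiable_row phi x :
  (forall j, differentiable (fun x => phi x ord0 j) x) -> differentiable phi x.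
Proof.
move=> h; rewrite (rowE phi); apply: differentiable_sum => j.
exact: differentiableZl.
Qed.

Let derive_row phi v : (forall x j, differentiable (fun x => phi x ord0 j) x) ->
  forall j, (fun x => 'D_v phi x ord0 j) = 'D_v (fun x => phi x ord0 j).
Proof.
move=> h j; apply/funext => x; rewrite derive_mx ?mxE//.
by apply/derivable_mxP => i k; rewrite (ord1 i); exact: diff_derivable.
Qed.

Let C1_on_components phi : (forall j, C1f (fun x => phi x ord0 j)) -> C1_on setT phi.
Proof.
move=> h; have d x j : differentiable (fun x => phi x ord0 j) x by case: (h j).
split=> [x _|v]; first exact: differentiable_row.
apply: continuous_subspaceT; apply: continuous_row => j.
by rewrite derive_row//; case: (h j).
Qed.

Lemma C2_on_components phi : (forall j, C2f (fun x => phi x ord0 j)) -> C2_on setT phi.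
Proof.
move=> h; split=> [|v]; first by apply: C1_on_components => j; case: (h j).
apply: C1_on_components => j; rewrite derive_row; first by case: (h j).
by move=> x k; case: (h k) => -[].
Qed.

(** Difference quotients in direction v have norm at least c |v|, and so has their limit; charts are
    thus seen to be immersions without computing a differential. *)
Lemma expanding_diff_inj phi x (c : R) : differentiable phi x -> 0 < c ->
  (forall y, enorm (y - x) <= 1 -> c * enorm (y - x) <= enorm (phi y - phi x)) ->
  forall v, 'd phi x v = 0 -> v = 0.
Proof.
move=> dphi c0 hc v dv0; apply: contrapT => /eqP v0.
have ev : 0 < enorm v by exact: enorm_gt0.
have /cvg_ex[l hl] : derivable phi x v by exact: diff_derivable.
have l0 : l = 0 by rewrite -dv0 -deriveE//; apply/esym; exact: cvg_lim hl.
have /cvgrPdist_lt cl : enorm (h^-1 *: (phi (h *: v + x) - phi x)) @[h --> (0:R)^'] --> (0:R).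
  rewrite -[X in _ --> X](@enorm0 R p) -l0; apply: continuous_cvg; first exact: continuous_enorm.
  exact: hl.
have /cl near_v : 0 < c * enorm v by rewrite mulr_gt0.
have : \forall h \near (0:R)^', False.
  near=> h.
  have h0 : h != 0 by near: h; exact: nbhs_dnbhs_neq.
  have h1 : `|h| <= (enorm v)^-1 by near: h; apply: dnbhs0_le; rewrite invr_gt0.
  have : `|0 - enorm (h^-1 *: (phi (h *: v + x) - phi x))| < c * enorm v.
    by near: h; exact: near_v.
  rewrite sub0r normrN ger0_norm ?enorm_ge0// enormZ normfV ltr_pdivrMl ?normr_gt0//.
  apply/negP; rewrite -leNgt mulrCA.
  have := hc (h *: v + x); rewrite addrK enormZ; apply.
  by rewrite -ler_pdivlMr// mul1r.
by move=> /filter_ex[].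
Unshelve. all: by end_near. Qed.

End SmoothMaps.

(** * Stereographic charts *)

Section LipschitzTopology.
Context {R : realType} {m n : nat}.

Lemma mx_norm_le_enorm (x : 'rV[R]_n) : `|x| <= enorm x.
Proof.
rewrite /Num.norm/= mx_normrE; apply: bigmax_le => [|[i j] _ /=]; first exact: enorm_ge0.
by rewrite (ord1 i) coord_le_enorm.
Qed.

Lemma near_enorm_lt (x : 'rV[R]_m) (e : R) : 0 < e -> \forall y \near x, enorm (y - x) < e.
Proof.
move=> e0; apply: open_nbhs_nbhs; split; first exact: open_eball.
by rewrite /= subrr enorm0.
Qed.

Lemma enorm_lipschitz_continuous (f : 'rV[R]_m -> 'rV[R]_n) (L : R) :
  (forall x y, enorm (f y - f x) <= L * enorm (y - x)) -> continuous f.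
Proof.
move=> fL x; apply: (iffRL (@cvgrPdist_le _ _ _ (nbhs x) _ f (f x))) => /= e e0.
have L0 : 0 < `|L| + 1 by rewrite ltr_wpDl.
have h : \forall y \near x, enorm (y - x) < e / (`|L| + 1).
  by apply: near_enorm_lt; rewrite divr_gt0.
near=> y.
have hy : enorm (y - x) < e / (`|L| + 1) by near: y; exact: h.
move: hy; rewrite ltr_pdivlMr// => hy.
rewrite -normrN opprB; apply: le_trans (mx_norm_le_enorm _) _.
apply: le_trans (fL _ _) _; apply: le_trans (ltW hy); rewrite mulrC.
apply: ler_wpM2l; first exact: enorm_ge0.
by apply: le_trans (ler_norm _) _; rewrite lerDl.
Unshelve. all: by end_near. Qed.

Lemma connected_rV : connected [set: 'rV[R]_m].
Proof.
have -> : [set: 'rV[R]_m] = \bigcup_(v in setT) ((fun t : R => t *: v) @` `[0, 1]).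
  apply/seteqP; split=> // v _; exists v => //; exists 1; last by rewrite scale1r.
  by rewrite /= in_itv/= ler01 lexx.
apply: bigcup_connected.
  by exists 0 => v _; exists 0; [rewrite /= in_itv/= lexx ler01|rewrite scale0r].
move=> v _; apply: connected_continuous_connected; first exact: segment_connected.
apply: continuous_subspaceT => t; exact: (cvgZr_tmp cvg_id).
Qed.

End LipschitzTopology.

Section Stereographic.
Context {R : realType} {d : nat}.
Implicit Types (s : R) (y z : 'rV[R]_d).

(** Inverse of the stereographic projection from the pole [pole_mx s 0], where s is 1 or -1, encoded
    below as [s ^+ 2 = 1]. *)
Definition stereo s y : 'rV[R]_d.+1 :=
  pole_mx (s * ((dotp y y - 1) / (dotp y y + 1))) (2 / (dotp y y + 1) *: y).

Let den_gt0 y : 0 < dotp y y + 1.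
Proof. by rewrite ltr_wpDl ?dotp_ge0. Qed.

Lemma dotp_stereo s y z : s ^+ 2 = 1 -> dotp (stereo s y) (stereo s z) =
  1 - 2 * dotp (y - z) (y - z) / ((dotp y y + 1) * (dotp z z + 1)).
Proof.
move=> s1; rewrite /stereo dotp_pole dotpZl dotpZr.
have -> : dotp (y - z) (y - z) = dotp y y - 2 * dotp y z + dotp z z.
  by rewrite dotp_sqrD dotpNr dotpNl dotpNr opprK; ring.
have dy := den_gt0 y; have dz := den_gt0 z.
rewrite mulrACA -expr2 s1 mul1r.
move: dy dz; move: (dotp y y) (dotp z z) (dotp y z) => A B p A0 B0.
by field; rewrite !gt_eqF.
Qed.

Lemma enorm_stereo s y : s ^+ 2 = 1 -> enorm (stereo s y) = 1.
Proof.
move=> s1; rewrite enormE dotp_stereo// subrr dotp0l mulr0 mul0r subr0.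
exact: sqrtr1.
Qed.

Lemma stereo_dist s y z : s ^+ 2 = 1 -> enorm (stereo s y - stereo s z) ^+ 2 =
  4 * enorm (y - z) ^+ 2 / ((dotp y y + 1) * (dotp z z + 1)).
Proof.
move=> s1; rewrite !enorm_sq dotp_sqrD dotpNr dotpNl dotpNr opprK -!(enorm_sq (stereo _ _)).
rewrite !enorm_stereo// dotp_stereo//.
have dy := den_gt0 y; have dz := den_gt0 z.
move: dy dz; move: (dotp y y) (dotp z z) (dotp (y - z) (y - z)) => A B p A0 B0.
by field; rewrite !gt_eqF.
Qed.

(** This one expansion estimate gives injectivity, immersivity and openness of the charts. It
    follows from the chordal distance formula by 1 + |y|^2 <= (1 + |y|)^2. *)
Lemma stereo_lower s y z : s ^+ 2 = 1 ->
  2 * enorm (y - z) <= (1 + enorm y) * (1 + enorm z) * enorm (stereo s y - stereo s z).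
Proof.
move=> s1; have y0 := enorm_ge0 y; have z0 := enorm_ge0 z.
apply: ler_of_sqr; first by rewrite !mulr_ge0 ?enorm_ge0// addr_ge0.
rewrite exprMn [X in _ <= X]exprMn stereo_dist//.
have dy := den_gt0 y; have dz := den_gt0 z.
have e0 : 0 <= enorm (y - z) ^+ 2 by exact: sqr_ge0.
rewrite [X in _ <= X]mulrA ler_pdivlMr ?mulr_gt0//.
have hy : dotp y y + 1 <= (1 + enorm y) ^+ 2 by rewrite -enorm_sq; nra.
have hz : dotp z z + 1 <= (1 + enorm z) ^+ 2 by rewrite -enorm_sq; nra.
have -> : (((1 + enorm y) * (1 + enorm z)) ^+ 2 * (4 * enorm (y - z) ^+ 2)) =
   2 ^+ 2 * enorm (y - z) ^+ 2 * ((1 + enorm y) ^+ 2 * (1 + enorm z) ^+ 2) by ring.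
apply: ler_wpM2l; first by rewrite mulr_ge0.
by apply: ler_pM => //; exact: ltW.
Qed.

Lemma stereo_neq_pole s y : s ^+ 2 = 1 -> stereo s y <> pole_mx s 0.
Proof.
move=> s1 /(congr1 pole_l); rewrite !pole_mxKl => h.
have s0 : s != 0 by apply/eqP => s0; move: s1; rewrite s0 expr0n/= => /eqP; rewrite eq_sym oner_eq0.
have := mulfI s0 (etrans h (esym (mulr1 s))) => /eqP.
have dy := den_gt0 y.
by rewrite eq_sym -subr_eq0 => /eqP; move: dy; move: (dotp y y) => A A0 e;
  have : (1 - (A - 1) / (A + 1)) * (A + 1) = 2 by [field; rewrite gt_eqF]; rewrite e mul0r; lra.
Qed.

Lemma stereo_surj s x : s ^+ 2 = 1 -> enorm x = 1 -> x <> pole_mx s 0 ->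
  exists y, stereo s y = x.
Proof.
move=> s1 x1 xs; pose t := pole_l x; pose w := pole_r x.
have xE : x = pole_mx t w by rewrite pole_mxK.
have tw : t ^+ 2 + dotp w w = 1.
  have : dotp x x = 1 by rewrite -enorm_sq x1 expr1n.
  by rewrite -{1 2}(pole_mxK x) dotp_pole -expr2.
have w0 := dotp_ge0 w.
have st : s * t != 1.
  apply/eqP => st; apply: xs; rewrite xE.
  have tE : t = s by rewrite -[t]mul1r -s1 expr2 -mulrA st mulr1.
  by rewrite tE (@dotp_eq0 _ _ w)//; move: tw; rewrite tE s1; lra.
have st1 : 1 - s * t != 0 by rewrite subr_eq0 eq_sym.
exists ((1 - s * t)^-1 *: w).
rewrite xE /stereo; set A := dotp _ _.
have AE : A = (1 - t ^+ 2) / (1 - s * t) ^+ 2.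
  by rewrite /A dotpZl dotpZr (_ : dotp w w = 1 - t ^+ 2); [field|lra].
have A1 : A + 1 = 2 / (1 - s * t).
  rewrite AE; apply: (mulIf (expf_neq0 2 st1)); rewrite mulrDl divfK ?expf_neq0// mul1r.
  have -> : 2 / (1 - s * t) * (1 - s * t) ^+ 2 = 2 * (1 - s * t) by field.
  have -> : (1 - s * t) ^+ 2 = 1 - 2 * (s * t) + s ^+ 2 * t ^+ 2 by ring.
  by rewrite s1; ring.
have A2 : A - 1 = 2 * (s * t) / (1 - s * t).
  have -> : A - 1 = (A + 1) - 2 by ring.
  by rewrite A1; field.
have -> : s * ((A - 1) / (A + 1)) = t.
  have -> : (A - 1) / (A + 1) = s * t by rewrite A1 A2; field; rewrite st1.
  by rewrite mulrA -expr2 s1 mul1r.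
by rewrite scalerA (_ : _ * _ = 1) ?scale1r// A1; field.
Qed.

Lemma C2f_stereo s (j : 'I_d.+1) : C2f (fun y : 'rV[R]_d => stereo s y ord0 j).
Proof.
have dC : C2f (fun y : 'rV[R]_d => dotp y y).
  by apply: C2f_sum => i; apply: C2fM; exact: C2f_coord.
have d1C : C2f (fun y : 'rV[R]_d => (dotp y y + 1)^-1).
  apply: (C2fV (C2fD dC (C2f_cst 1))) => y /=.
  by rewrite gt_eqF.
case: (@split_ordP 1 d j) => j' jE.
  have -> : (fun y => stereo s y ord0 j) =
      (fun y => cst s y * ((dotp y y + cst (-1) y) * (dotp y y + 1)^-1)).
    apply/funext => y; rewrite jE (ord1 j') /stereo /pole_mx (@row_mxEl R 1 1 d) mxE eqxx mulr1n.
    by [].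
  exact: (C2fM (C2f_cst s) (C2fM (C2fD dC (C2f_cst (-1))) d1C)).
have -> : (fun y => stereo s y ord0 j) =
      (fun y => (cst 2 y * (dotp y y + 1)^-1) * y ord0 j').
  by apply/funext => y; rewrite jE /stereo /pole_mx (@row_mxEr R 1 1 d) mxE.
exact: (C2fM (C2fM (C2f_cst 2) d1C) (C2f_coord j')).
Qed.

End Stereographic.

(** * Perturbed spheres *)

(** For the openness of charts, with Y = |y|, w = |z|, t = |z - y| and u the distance of the images.
    The expansion factor decays with t; but if t were at least e, then (1 + Y + t) e <= (2 + Y) t,
    as e <= 1, which contradicts the smallness of u. *)
Lemma small_distance (R : realFieldType) (A e Y u t w : R) :
  0 < A -> 0 < e -> e <= 1 -> 0 <= Y -> 0 <= u -> 0 <= t -> w <= t + Y ->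
  A * t <= (1 + Y) * (1 + w) * u -> u * ((1 + Y) * (2 + Y)) < A * e -> t < e.
Proof.
move=> A0 e0 e1 Y0 u0 t0 wt h1 h2; rewrite ltNge; apply/negP => et.
have h3 : (1 + Y) * (1 + w) * u <= (1 + Y) * (1 + Y + t) * u.
  by apply: ler_wpM2r => //; apply: ler_wpM2l; lra.
have h4 : A * t <= (1 + Y) * (1 + Y + t) * u by exact: le_trans h3.
have h5 : (1 + Y + t) * e <= (2 + Y) * t by nra.
have h6 : (1 + Y) * u * ((1 + Y + t) * e) <= (1 + Y) * u * ((2 + Y) * t).
  by apply: ler_wpM2l => //; rewrite mulr_ge0//; lra.
have h7 : A * t * e <= (1 + Y) * (1 + Y + t) * u * e.
  by apply: ler_wpM2r => //; exact: ltW.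
have t1 : 0 < t by exact: lt_le_trans et.
have h8 : u * ((1 + Y) * (2 + Y)) * t < A * e * t by rewrite ltr_pM2r.
nra.
Qed.

(** First-order condition at a minimum, tested at s = A / (|B| + 1). *)
Lemma linear_le_quadratic (R : realFieldType) (A B : R) :
  (forall s, 2 * s * A <= B * s ^+ 2) -> A = 0.
Proof.
move=> h; apply/eqP; apply/negP => /negP A0.
have A2 : 0 < A ^+ 2 by rewrite exprn_even_gt0.
pose K := `|B| + 1.
have K0 : 0 < K by rewrite ltr_wpDl.
have BK : B <= K by apply: le_trans (ler_norm _) _; rewrite lerDl.
have := h (A / K); rewrite expr_div_n.
have -> : 2 * (A / K) * A = 2 * (A ^+ 2 / K) by field; rewrite gt_eqF.
apply/negP; rewrite -ltNge.
apply: le_lt_trans (_ : K * (A ^+ 2 / K ^+ 2) < _).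
  by apply: ler_wpM2r => //; rewrite divr_ge0 ?sqr_ge0.
have -> : K * (A ^+ 2 / K ^+ 2) = A ^+ 2 / K by field; rewrite gt_eqF.
have : 0 < A ^+ 2 / K by rewrite divr_gt0.
lra.
Qed.

Section PerturbedSphere.
Context {R : realType} {d k : nat}.
Let E := 'rV[R]_(d.+1 + k).
Variables (r a b : R) (g : E -> E) (G : E -> E -> E) (c : E).
Hypotheses (r_gt0 : 0 < r) (a_ge0 : 0 <= a) (a_lt1 : a < 1) (b_ge0 : 0 <= b).
Hypothesis g_lip : forall x y, enorm (g y - g x) <= a * enorm (y - x).
Hypothesis GD : forall x w w', G x (w + w') = G x w + G x w'.
Hypothesis GZ : forall x t w, G x (t *: w) = t *: G x w.
Hypothesis G_le : forall x w, enorm (G x w) <= a * enorm w.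
Hypothesis g_taylor : forall x y,
  enorm (g y - g x - G x (y - x)) <= b * enorm (y - x) ^+ 2.
Hypothesis g_smooth : forall h : 'rV[R]_d -> E,
  (forall j, C2f (fun y => h y ord0 j)) -> forall j, C2f (fun y => g (h y) ord0 j).

(** [g] is a displacement of slope at most [a], [G x] its differential at x and [b] the constant of
    its second-order remainder. The translation by [c] serves to bring the surface through the
    origin. *)
Definition perturb (z : E) : E := r *: (z + g z) - c.

Definition perturbed_sphere : set E := perturb @` usphere.

Let perturbB x y : perturb y - perturb x = r *: ((y - x) + (g y - g x)).
Proof.
by rewrite /perturb opprB addrA subrK -scalerBr opprD addrACA.
Qed.

Lemma perturb_upper x y : enorm (perturb y - perturb x) <= r * (1 + a) * enorm (y - x).
Proof.
rewrite perturbB enormZ gtr0_norm// -mulrA ler_pM2l//.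
by apply: le_trans (enormD _ _) _; rewrite mulrDl mul1r lerD2l.
Qed.

Lemma perturb_lower x y : r * (1 - a) * enorm (y - x) <= enorm (perturb y - perturb x).
Proof.
rewrite perturbB enormZ gtr0_norm// -mulrA ler_pM2l//.
rewrite mulrBl mul1r lerBlDr.
have := enormD (y - x + (g y - g x)) (- (g y - g x)); rewrite addrK enormN => h.
by apply: le_trans h _; rewrite lerD2l.
Qed.

Lemma perturb_inj x y : perturb x = perturb y -> x = y.
Proof.
move=> xy; apply/eqP; rewrite -subr_eq0; apply/eqP/enorm_eq0/eqP.
rewrite eq_le enorm_ge0 andbT.
have p : 0 < r * (1 - a) by rewrite mulr_gt0// subr_gt0.
by rewrite -(ler_pM2l p) mulr0; apply: le_trans (perturb_lower _ _) _; rewrite xy subrr enorm0.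
Qed.

Let emb (x : 'rV[R]_d.+1) : E := row_mx x 0.

Let embB x y : emb x - emb y = emb (x - y).
Proof. by rewrite /emb row_mxB subrr. Qed.

Let enorm_emb x : enorm (emb x) = enorm x.
Proof. exact: enorm_row_mx0. Qed.

Lemma compact_usphere : compact (@usphere R d k).
Proof.
apply: continuous_compact.
  apply: continuous_subspaceT; apply: (@enorm_lipschitz_continuous _ _ _ _ 1) => x y.
  by rewrite embB enorm_emb mul1r.
apply: (@enorm_bounded_closed_compact _ _ _ 1); first by move=> x /= ->.
apply: (@closed_comp _ _ (@enorm R d.+1) [set u | u = 1]); last exact: closed_eq.
by move=> x _; exact: continuous_enorm.
Qed.

Let continuous_perturb : continuous perturb.
Proof. by apply: (@enorm_lipschitz_continuous _ _ _ _ (r * (1 + a))); exact: perturb_upper. Qed.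

Lemma compact_perturbed_sphere : compact perturbed_sphere.
Proof.
apply: continuous_compact; last exact: compact_usphere.
exact: continuous_subspaceT.
Qed.

Let chart (s : R) (y : 'rV[R]_d) : E := perturb (emb (stereo s y)).

Let chart_C2f s j : C2f (fun y => chart s y ord0 j).
Proof.
have embC i : C2f (fun y => emb (stereo s y) ord0 i).
  case: (split_ordP i) => i' ->.
    have -> : (fun y => emb (stereo s y) ord0 (lshift k i')) = (fun y => stereo s y ord0 i').
      by apply/funext => y; rewrite row_mxEl.
    exact: C2f_stereo.
  have -> : (fun y => emb (stereo s y) ord0 (rshift d.+1 i')) = cst 0.
    by apply/funext => y; rewrite row_mxEr mxE.
  exact: C2f_cst.
have -> : (fun y => chart s y ord0 j) =
    (fun y => cst r y * (emb (stereo s y) ord0 j + g (emb (stereo s y)) ord0 j) + cst (- c ord0 j) y).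
  by apply/funext => y; rewrite /chart /perturb !mxE.
exact: (C2fD (C2fM (C2f_cst r) (C2fD (embC j) (g_smooth embC j))) (C2f_cst _)).
Qed.

Let chart_lower s y z : s ^+ 2 = 1 -> 2 * (r * (1 - a)) * enorm (z - y) <=
  (1 + enorm y) * (1 + enorm z) * enorm (chart s z - chart s y).
Proof.
move=> s1; have y0 := enorm_ge0 y; have z0 := enorm_ge0 z.
have p : 0 < r * (1 - a) by rewrite mulr_gt0// subr_gt0.
have := ler_wpM2l (ltW p) (stereo_lower z y s1).
have h := perturb_lower (emb (stereo s y)) (emb (stereo s z)).
rewrite embB enorm_emb in h.
have q : 0 <= (1 + enorm z) * (1 + enorm y) by rewrite mulr_ge0// addr_ge0.
have := ler_wpM2l q h; rewrite -/(chart s y) -/(chart s z); nra.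
Qed.

Let chart_inj s y z : s ^+ 2 = 1 -> chart s y = chart s z -> y = z.
Proof.
move=> s1 yz; apply/eqP; rewrite eq_sym -subr_eq0; apply/eqP/enorm_eq0/eqP.
rewrite eq_le enorm_ge0 andbT.
have p : 0 < 2 * (r * (1 - a)) by rewrite !mulr_gt0// subr_gt0.
rewrite -(ler_pM2l p) mulr0; apply: le_trans (chart_lower _ _ s1) _.
by rewrite yz subrr enorm0 mulr0.
Qed.

Let chart_range s : s ^+ 2 = 1 -> range (chart s) =
  perturbed_sphere `&` [set z | 0 < enorm (z - perturb (emb (pole_mx s 0)))].
Proof.
move=> s1; apply/seteqP; split=> [_ [y _ <-]|_ [[_ [x x1 <-] <-] /= xP]].
  split; first by exists (emb (stereo s y)) => //; exists (stereo s y) => //=; exact: enorm_stereo.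
  rewrite /= enorm_gt0// subr_eq0; apply/eqP => /perturb_inj /eqP.
  rewrite -subr_eq0 embB => /eqP e.
  apply: (@stereo_neq_pole _ _ s y s1); apply/eqP; rewrite -subr_eq0; apply/eqP/enorm_eq0.
  by rewrite -enorm_emb e enorm0.
have [|y yx] := stereo_surj s1 x1; last by exists y => //; rewrite /chart yx.
by move=> e; move: xP; rewrite e subrr enorm0 ltxx.
Qed.

Let pole_neq : pole_mx 1 0 <> pole_mx (-1) 0 :> 'rV[R]_d.+1.
Proof. by move=> /(congr1 pole_l); rewrite !pole_mxKl => h; have : (1 : R) + 1 = 0 by [rewrite {2}h subrr]; lra. Qed.

Let sq1 : (1 : R) ^+ 2 = 1. Proof. by rewrite expr1n. Qed.
Let sqN1 : (-1 : R) ^+ 2 = 1. Proof. by rewrite sqrrN expr1n. Qed.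

Let chart_cover p : perturbed_sphere p -> exists2 s : R, s ^+ 2 = 1 &
  0 < enorm (p - perturb (emb (pole_mx s 0))).
Proof.
have key s : p <> perturb (emb (pole_mx s 0)) -> 0 < enorm (p - perturb (emb (pole_mx s 0))).
  by move=> /eqP h; rewrite enorm_gt0// subr_eq0.
move=> _; have [e|h] := pselect (p = perturb (emb (pole_mx 1 0))); last by exists 1 => //; exact: key.
exists (-1) => //; apply: key; rewrite e => /perturb_inj.
by move=> /(congr1 lsubmx); rewrite !row_mxKl; exact: pole_neq.
Qed.

Lemma C2_perturbed_sphere : C2_submanifold d perturbed_sphere.
Proof.
move=> p Mp; have [s s1 ps] := chart_cover Mp.
exists [set z | 0 < enorm (z - perturb (emb (pole_mx s 0)))], setT, (chart s).
have C2c : C2_on setT (chart s) by apply: C2_on_components; exact: chart_C2f.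
split; split.
- have -> : [set z : E | 0 < enorm (z - perturb (emb (pole_mx s 0)))] =
      (fun z => enorm (z - perturb (emb (pole_mx s 0)))) @^-1` [set u | 0 < u] by [].
  apply: open_comp; last exact: open_gt.
  move=> z _; apply: (@continuous_comp _ _ _ (fun z : E => z - _) (@enorm R _)); last exact: continuous_enorm.
  by apply: continuousB; [exact: cvg_id|exact: cst_continuous].
- exact: ps.
- exact: openT.
- exact: C2c.
- by move=> y z _ _; exact: chart_inj.
- exact: chart_range.
(* For |z - y| <= 1 the factor (1 + |y|) (1 + |z|) is at most [K]. *)
- move=> y _; pose K := (1 + enorm y) * (2 + enorm y).
  have y0 := enorm_ge0 y.
  have K0 : 0 < K by rewrite mulr_gt0; lra.
  apply: (@expanding_diff_inj _ _ _ _ _ (2 * (r * (1 - a)) / K)).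
  + by case: C2c => -[h _] _; exact: h.
  + by rewrite divr_gt0// !mulr_gt0// subr_gt0.
  move=> z zy; rewrite mulrAC ler_pdivrMr//; apply: le_trans (chart_lower _ _ s1) _.
  rewrite mulrC; apply: ler_wpM2l; first exact: enorm_ge0.
  apply: ler_wpM2l; first lra.
  by have := enormD (z - y) y; rewrite subrK; lra.
move=> W oW _.
(* [rad y e] says that the ambient ball of radius e about the image of y meets the range of the
   chart only in images of [W]; the union of these balls is the required open set. *)
pose rad y e := 0 < e /\ forall z, enorm (chart s z - chart s y) < e -> W z.
exists (\bigcup_(ye in [set ye : 'rV[R]_d * R | rad ye.1 ye.2])
   [set q | enorm (q - chart s ye.1) < ye.2]); split.
  by apply: bigcup_open => ye _; exact: open_eball.
rewrite -chart_range//; apply/seteqP; split=> [_ [y Wy <-]|q [[[y e] /= [e0 hr] yq] [z _ zq]]].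
  split; last by exists y.
  suff [e [e0 he]] : exists e, rad y e.
    by exists (y, e) => //=; rewrite subrr enorm0.
  have [e1 e10 e1W] : exists2 e1 : R, 0 < e1 & forall z, enorm (z - y) < e1 -> W z.
    have /nbhs_ballP[e1 /= e10 e1W] : nbhs y W by apply: open_nbhs_nbhs.
    exists e1 => // z zy; apply: e1W; rewrite mx_norm_ball /ball_/=.
    by rewrite -normrN opprB (le_lt_trans (mx_norm_le_enorm _)).
  have y0 := enorm_ge0 y.
  pose A := 2 * (r * (1 - a)).
  have A0 : 0 < A by rewrite !mulr_gt0// subr_gt0.
  pose e2 := Num.min e1 1.
  have e20 : 0 < e2 by rewrite lt_min e10 ltr01.
  pose e := A * e2 / ((1 + enorm y) * (2 + enorm y)).
  have q0 : 0 < (1 + enorm y) * (2 + enorm y) by rewrite mulr_gt0; lra.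
  exists e; split; first by rewrite divr_gt0// mulr_gt0.
  move=> z ze; apply: e1W; apply: lt_le_trans (_ : e2 <= _); last by rewrite ge_min lexx.
  have := chart_lower y z s1; rewrite -/A.
  have zy : enorm z <= enorm (z - y) + enorm y by have := enormD (z - y) y; rewrite subrK.
  move: ze; rewrite ltr_pdivlMr//.
  have u0 := enorm_ge0 (chart s z - chart s y); have t0 := enorm_ge0 (z - y).
  have e21 : e2 <= 1 by rewrite ge_min lexx orbT.
  move=> h2 h1; exact: (small_distance A0 e20 e21 y0 u0 t0 zy h1 h2).
by exists z => //; apply: hr; rewrite zq.
Qed.

Lemma connected_perturbed_sphere : (0 < d)%N -> connected perturbed_sphere.
Proof.
move=> d0.
have -> : perturbed_sphere = range (chart 1) `|` range (chart (-1)).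
  apply/seteqP; split=> [p Mp|p]; last by rewrite !chart_range// => -[[]|[]].
  have [e|h] := pselect (p = perturb (emb (pole_mx 1 0))).
    right; rewrite chart_range//; split=> //=.
    rewrite enorm_gt0// e subr_eq0; apply/eqP => /perturb_inj.
    by move=> /(congr1 lsubmx); rewrite !row_mxKl; exact: pole_neq.
  by left; rewrite chart_range//; split=> //=; rewrite enorm_gt0// subr_eq0; apply/eqP.
have cc s : continuous (chart s).
  move=> y; apply: (@differentiable_continuous _ _ _ _ (chart s)).
  by have [[h _] _] := C2_on_components (chart_C2f s); exact: h.
apply: connectedU.
(* A unit vector, available because d > 0, goes to the equator, where the charts for s = 1 and s =
   -1 agree. *)
- pose e0 : 'rV[R]_d := delta_mx ord0 (Ordinal d0).
  have e1 : dotp e0 e0 = 1.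
    rewrite /dotp (bigD1 (Ordinal d0))//= big1 ?addr0; first by rewrite !mxE !eqxx mulr1.
    by move=> i /negPf ij; rewrite !mxE ij andbF mulr0.
  exists (chart 1 e0); split; exists e0 => //.
  by rewrite /chart /stereo e1 subrr mul0r !mulr0.
- by apply: connected_continuous_connected; [exact: connected_rV|exact: continuous_subspaceT].
by apply: connected_continuous_connected; [exact: connected_rV|exact: continuous_subspaceT].
Qed.

Section Reach.
Variable rch : R.
Hypothesis rch_le : rch * (1 + a + 2 * b) <= r * (1 - a) ^+ 2.

Let foot (x y nu : E) : usphere x -> usphere y -> x <> y ->
  (forall y', usphere y' -> 2 * dotp nu (perturb y' - perturb x) <=
      enorm (perturb y' - perturb x) ^+ 2) ->
  enorm (perturb y - perturb x) ^+ 2 <= 2 * dotp nu (perturb y - perturb x) ->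
  rch <= enorm nu.
Proof.
move=> [x0 /= x01 x0E] [y0 /= y01 y0E] xy foot_x foot_y.
have xE : emb x0 = x by [].
have yE : emb y0 = y by [].
have nu0 := enorm_ge0 nu.
(* [l] is the linearisation of y' |-> <nu, F y' - F x> / r at [x].  Since [F x]
   is a nearest point, [l] vanishes on tangent vectors of the sphere, so that
   [l (y - x)] is only quadratic in |y - x|. *)
pose l (w : E) := dotp nu (w + G x w).
have lD w w' : l (w + w') = l w + l w' by rewrite /l -dotpDr; congr (dotp _ _); rewrite GD addrACA.
have lZ t w : l (t *: w) = t * l w by rewrite /l GZ -scalerDr dotpZr.
have l_le w : `|l w| <= (1 + a) * enorm nu * enorm w.
  apply: le_trans (dotp_norm_le _ _) _; rewrite -mulrA mulrCA; apply: ler_wpM2l => //.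
  apply: le_trans (enormD _ _) _; rewrite mulrDl mul1r lerD2l; exact: G_le.
have expand y' : exists2 e, dotp nu (perturb y' - perturb x) = r * (l (y' - x) + e) &
    `|e| <= enorm nu * (b * enorm (y' - x) ^+ 2).
  exists (dotp nu (g y' - g x - G x (y' - x))).
    rewrite perturbB dotpZr -dotpDr; congr (_ * dotp _ _).
    by rewrite -[RHS]addrA (addrC (G x _)) subrK.
  by apply: le_trans (dotp_norm_le _ _) _; apply: ler_wpM2l.
pose C := r * (1 + a) ^+ 2 / 2 + enorm nu * b.
have l_quad y' : usphere y' -> l (y' - x) <= C * enorm (y' - x) ^+ 2.
  move=> Sy'; have := foot_x y' Sy'; have [e -> ] := expand y'; rewrite ler_norml => /andP[e1 e2].
  have up : enorm (perturb y' - perturb x) ^+ 2 <= (r * (1 + a) * enorm (y' - x)) ^+ 2.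
    rewrite ler_sqr ?nnegrE ?perturb_upper ?enorm_ge0//.
    by rewrite !mulr_ge0 ?enorm_ge0// ?addr_ge0// ltW.
  move=> /le_trans/(_ up); rewrite /C !exprMn => h.
  rewrite -(ler_pM2l r_gt0); move: e1 e2 h; move: (enorm (y' - x) ^+ 2) => q e1 e2 h.
  have := ler_wpM2l (ltW r_gt0) e1; nra.
have tangent (u : 'rV[R]_d.+1) : enorm u = 1 -> dotp x0 u = 0 -> l (emb u) = 0.
  move=> u1 xu; apply: (@linear_le_quadratic _ _ (4 * C + 2 * l x)) => s.
  have q0 : 0 < 1 + s ^+ 2 by rewrite ltr_wpDr ?sqr_ge0.
  (* [x0 + w] is the point (1 - s^2) / (1 + s^2) x0 + 2 s / (1 + s^2) u of the great circle through
     x0 and u, in its rational parametrisation. *)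
  pose w := (- (2 * s ^+ 2) / (1 + s ^+ 2)) *: x0 + (2 * s / (1 + s ^+ 2)) *: u.
  have x02 : dotp x0 x0 = 1 by rewrite -enorm_sq x01 expr1n.
  have u2 : dotp u u = 1 by rewrite -enorm_sq u1 expr1n.
  have w2 : dotp w w = 4 * s ^+ 2 / (1 + s ^+ 2).
    rewrite /w dotp_sqrD !dotpZl !dotpZr x02 u2 xu.
    by field; rewrite gt_eqF.
  have xw : dotp x0 w = - (2 * s ^+ 2) / (1 + s ^+ 2).
    by rewrite /w dotpDr !dotpZr x02 xu mulr0 addr0 mulr1.
  have S1 : usphere (emb (x0 + w)).
    exists (x0 + w) => //=; rewrite enormE dotp_sqrD x02 w2 xw.
    by rewrite -[RHS]sqrtr1; congr Num.sqrt; field; rewrite gt_eqF.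
  have e1 : emb (x0 + w) - x = emb w by rewrite -xE embB addrAC subrr add0r.
  have := l_quad _ S1; rewrite e1 enorm_emb enorm_sq w2.
  have -> : emb w = (- (2 * s ^+ 2) / (1 + s ^+ 2)) *: x + (2 * s / (1 + s ^+ 2)) *: emb u.
    by rewrite -xE /emb /w !scale_row_mx add_row_mx !scaler0 addr0.
  rewrite lD !lZ => h; rewrite -subr_ge0.
  have : 0 <= (1 + s ^+ 2) * (C * (4 * s ^+ 2 / (1 + s ^+ 2)) -
     (- (2 * s ^+ 2) / (1 + s ^+ 2) * l x + 2 * s / (1 + s ^+ 2) * l (emb u))).
    by rewrite mulr_ge0 ?subr_ge0// ltW.
  congr (_ <= _); field; by rewrite gt_eqF.
have tangentZ (u : 'rV[R]_d.+1) : dotp x0 u = 0 -> l (emb u) = 0.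
  move=> xu; have [->|u0] := eqVneq u 0.
    by rewrite /emb row_mx0 -[0](scale0r 0) lZ mul0r.
  have up := enorm_gt0 u0.
  have -> : emb u = enorm u *: emb ((enorm u)^-1 *: u).
    by rewrite /emb scale_row_mx scaler0 scalerA mulfV ?gt_eqF// scale1r.
  rewrite lZ tangent ?mulr0//.
    by rewrite enormZ ger0_norm ?invr_ge0 ?enorm_ge0// mulVf// gt_eqF.
  by rewrite dotpZr xu mulr0.
pose q := enorm (y - x) ^+ 2.
have q_gt0 : 0 < q.
  by rewrite exprn_gt0// enorm_gt0// subr_eq0 eq_sym; apply/eqP.
have x02 : dotp x0 x0 = 1 by rewrite -enorm_sq x01 expr1n.
have y02 : dotp y0 y0 = 1 by rewrite -enorm_sq y01 expr1n.
have qE : q = 2 - 2 * dotp x0 y0.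
  by rewrite /q -xE -yE embB enorm_emb enorm_sq dotp_sqrD dotpNr dotpNl dotpNr opprK x02 y02 (dotpC y0); ring.
have ly : l (y - x) <= q / 2 * ((1 + a) * enorm nu).
  (* A chord of squared length [q] of the unit sphere has normal component - q / 2 along x; the rest
     is tangent at x, where [l] vanishes. *)
  have -> : y - x = (- (q / 2)) *: x + emb (y0 - x0 + (q / 2) *: x0).
    have -> : y - x = emb (y0 - x0) by rewrite -xE -yE embB.
    by rewrite -xE /emb scale_row_mx add_row_mx scaler0 addr0 addrCA scaleNr addNr addr0.
  rewrite lD tangentZ ?addr0; last first.
    by rewrite dotpDr dotpBr dotpZr x02 qE; field.
  rewrite lZ mulNr -mulrN; apply: ler_wpM2l; first by rewrite divr_ge0// ltW.
  apply: le_trans (ler_norm _) _; rewrite normrN; apply: le_trans (l_le _) _.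
  by rewrite -xE enorm_emb x01 mulr1.
have low : (r * (1 - a)) ^+ 2 * q <= enorm (perturb y - perturb x) ^+ 2.
  rewrite -exprMn ler_sqr ?nnegrE ?perturb_lower ?enorm_ge0//.
  by rewrite !mulr_ge0 ?enorm_ge0// ?subr_ge0 ltW.
have [e eE] := expand y; rewrite ler_norml => /andP[_ e2].
have main : (r * (1 - a)) ^+ 2 * q <= 2 * (r * (q / 2 * ((1 + a) * enorm nu) + enorm nu * (b * q))).
  apply: le_trans low _; apply: le_trans foot_y _; rewrite eE.
  apply: ler_wpM2l => //; apply: ler_wpM2l; [exact: ltW|exact: lerD].
(* Dividing by r q leaves |nu| >= r (1 - a)^2 / (1 + a + 2 b); for a = b = 0 this is r, the reach of
   the round sphere. *)
have main2 : r * (1 - a) ^+ 2 <= enorm nu * (1 + a + 2 * b).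
  rewrite -(ler_pM2r (mulr_gt0 r_gt0 q_gt0)).
  by move: main; congr (_ <= _); [ring|field].
have K0 : 0 < 1 + a + 2 * b by rewrite ltr_wpDr ?mulr_ge0// ltr_wpDr.
by rewrite -(ler_pM2r K0); apply: le_trans rch_le main2.
Qed.

(** With nu = z - p, the minimality of p and the equality of |q - z| and |p - z| become, by the
    polarisation identity [foot_eq], the two inequalities that [foot] assumes. *)
Lemma reach_perturbed_sphere : (rch%:E <= reach perturbed_sphere)%E.
Proof.
apply: le_ereal_inf_tmp => _ [z [p [q [[x Sx xp] [y Sy yq] pq pz qz]]] <-].
have xy : x <> y by move=> xy; apply: pq; rewrite -xp -yq xy.
rewrite -pz lee_fin (enormB p z).
have foot_eq (v : E) : enorm (v - z) ^+ 2 =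
    enorm (p - z) ^+ 2 + enorm (v - p) ^+ 2 - 2 * dotp (z - p) (v - p).
  have -> : v - z = (v - p) - (z - p) by rewrite opprB addrA subrK.
  rewrite !enorm_sq dotp_sqrD !dotpNr dotpNl opprK (dotpC (v - p)).
  rewrite -(opprB z p) dotpNl !dotpNr opprK; ring.
apply: (@foot x y) => //.
- move=> y' Sy'; rewrite xp.
  have : ((enorm (p - z))%:E <= (enorm (perturb y' - z))%:E)%E.
    by rewrite pz; apply: ereal_inf_lbound; exists (perturb y') => //; exists y'.
  rewrite lee_fin => h; have : enorm (p - z) ^+ 2 <= enorm (perturb y' - z) ^+ 2.
    by rewrite ler_sqr ?nnegrE ?enorm_ge0.
  rewrite (foot_eq (perturb y')); lra.
rewrite xp yq; have e : enorm (q - z) = enorm (p - z).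
  by have [] : (enorm (q - z))%:E = (enorm (p - z))%:E by rewrite qz pz.
have := foot_eq q; rewrite e; lra.
Qed.

Lemma manifold_class_perturbed_sphere : (0 < d)%N -> manifold_class d rch perturbed_sphere.
Proof.
move=> d0; split.
- exact: compact_perturbed_sphere.
- exact: connected_perturbed_sphere.
- exact: C2_perturbed_sphere.
- exact: reach_perturbed_sphere.
Qed.

End Reach.

End PerturbedSphere.

Section DisplaceSmooth.
Context {R : realType} {m n : nat} {I : finType}.
Variables (delta lam : R) (c v : I -> 'rV[R]_n).

Lemma C2f_displace (h : 'rV[R]_m -> 'rV[R]_n) :
  (forall j, C2f (fun y => h y ord0 j)) ->
  forall j, C2f (fun y => displace delta lam c v (h y) ord0 j).
Proof.
move=> hC j.
have coordC i l : C2f (fun y => h y ord0 l + cst (- c i ord0 l) y).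
  exact: (C2fD (hC l) (C2f_cst _)).
have bumpC i : C2f (fun y => bump delta (c i) (h y)).
  have -> : (fun y => bump delta (c i) (h y)) = (fun y => cube_plus (cst 1 y + cst (- delta ^- 2) y *
      \sum_(l < n) (h y ord0 l + cst (- c i ord0 l) y) * (h y ord0 l + cst (- c i ord0 l) y))).
    apply/funext => y; rewrite /bump expr_div_n enorm_sq /= mulNr mulrC.
    by congr (cube_plus (1 - _ * _)); apply: eq_bigr => l _; rewrite !mxE.
  apply: C2f_cube_plus; apply: C2fD (C2f_cst _) _; apply: C2fM (C2f_cst _) _.
  by apply: C2f_sum => l; exact: (C2fM (coordC i l) (coordC i l)).
have -> : (fun y => displace delta lam c v (h y) ord0 j) =
    (fun y => \sum_i cst (lam * v i ord0 j) y * bump delta (c i) (h y)).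
  by apply/funext => y; rewrite /displace summxE; apply: eq_bigr => i _; rewrite mxE /= mulrAC.
by apply: C2f_sum => i; exact: (C2fM (C2f_cst _) (bumpC i)).
Qed.

End DisplaceSmooth.

(** * Constant densities and the measure of a perturbed sphere *)

Section ConstantDensity.
Context {R : realType} {n d : nat}.

(** The layer-cake integrand is m on ]0, a[ and beyond that H^d of the empty set, which is 0 because
    d > 0. *)
Lemma hint_cst (M : set 'rV[R]_n) (a m : R) : (0 < d)%N -> 0 < a ->
  hausdorff d M = m%:E -> hint d M (cst a) = (a * m)%:E.
Proof.
move=> d0 a0 Mm.
have m0 : 0 <= m by rewrite -lee_fin -Mm hausdorff_ge0.
rewrite /hint.
have -> : (fun t : R => hausdorff d (M `&` [set x | t < cst a x])) =
    (fun t => m%:E * (\1_[set t : R | t < a] t)%:E)%E.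
  apply/funext => t; rewrite indicE; case: (ltP t a) => ta.
    by rewrite mem_set// mule1 -Mm; congr hausdorff; apply/seteqP; split=> x; [case|].
  rewrite memNset/=; last by rewrite ltNge ta.
  by rewrite mule0 -(@hausdorff_set0 R n d d0); congr hausdorff; apply/seteqP; split=> x // [].
have e1 : [set t : R | 0 < t] = `]0, +oo[%classic by apply/seteqP; split=> t /=; rewrite in_itv/= andbT.
have e2 : [set t : R | t < a] = `]-oo, a[%classic by apply/seteqP; split=> t /=; rewrite in_itv/=.
rewrite e1 e2 ge0_integralZl_EFin//; last first.
  by apply/measurable_realfun.measurable_EFinP; exact: measurable_realfun.measurable_indic.
rewrite integral_indic// mulrC EFinM; congr (_ * _)%E.
have -> : `]-oo, a[%classic `&` `]0, +oo[%classic = `]0, a[%classic :> set R.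
  by apply/seteqP; split=> t /=; rewrite !in_itv/= andbT; [case=> -> ->|case/andP=> -> ->].
by apply: eq_trans (lebesgue_measure_itv _) _; rewrite /= lte_fin a0 sube0.
Qed.

Lemma constant_density_in_model (rch fmin fmax L : R) (M : set 'rV[R]_n) (m : R) :
  (0 < d)%N -> 0 < m -> 0 <= L -> manifold_class d rch M -> M 0 ->
  hausdorff d M = m%:E -> fmin <= m^-1 <= fmax ->
  in_model d rch fmin fmax L M (cst m^-1).
Proof.
move=> d0 m0 L0 Mc M0 Mm fm; split=> //.
  by move=> x y _ _; rewrite subrr normr0 mulr_ge0// enorm_ge0.
by rewrite (hint_cst d0 _ Mm) ?invr_gt0// mulVf// gt_eqF.
Qed.

End ConstantDensity.

Section PerturbedMeasure.
Context {R : realType}.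

(** [f] is injective on [A], and its inverse [k] on the image is L-Lipschitz. *)
Lemma hausdorff_expanding {m n d : nat} (f : 'rV[R]_n -> 'rV[R]_m) (A : set 'rV[R]_n) (L : R) :
  0 < L ->
  (forall x y, A x -> A y -> enorm (x - y) <= L * enorm (f x - f y)) ->
  (hausdorff d A <= (L ^+ d)%:E * hausdorff d (f @` A))%E.
Proof.
move=> L0 fL; pose k q := xget 0 [set x | A x /\ f x = q].
have kP x : A x -> A (k (f x)) /\ f (k (f x)) = f x.
  by move=> Ax; rewrite /k; case: xgetP => [y -> //|/(_ x)]; case.
have {1}<- : k @` (f @` A) = A.
  have kE x : A x -> k (f x) = x.
    move=> Ax; have [Ak fk] := kP x Ax; apply/eqP; rewrite -subr_eq0; apply/eqP/enorm_eq0.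
    apply/eqP; rewrite eq_le enorm_ge0 andbT; apply: le_trans (fL _ _ Ak Ax) _.
    by rewrite fk subrr enorm0 mulr0.
  apply/seteqP; split=> [_ [_ [x Ax <-] <-]|x Ax]; first by rewrite kE.
  by exists (f x); [exists x|exact: kE].
apply: hausdorff_lipschitz => // _ _ [x Ax <-] [y Ay <-].
have [Ax' fx] := kP x Ax; have [Ay' fy] := kP y Ay.
by rewrite -{2}fx -{2}fy; exact: fL.
Qed.

Lemma hausdorff_perturbed_sphere {d k : nat} (r a h : R) (g : 'rV[R]_(d.+1 + k) -> _) (c : 'rV[R]_(d.+1 + k)) :
  0 < r -> 0 <= a -> a < 1 ->
  (forall x y, enorm (g y - g x) <= a * enorm (y - x)) ->
  hausdorff d (@usphere R d k) = h%:E ->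
  exists m, [/\ hausdorff d (perturbed_sphere r g c) = m%:E,
    (r * (1 - a)) ^+ d * h <= m & m <= (r * (1 + a)) ^+ d * h].
Proof.
move=> r0 a0 a1 gl hh.
have ra : 0 < r * (1 + a) by rewrite mulr_gt0// ltr_wpDr.
have rb : 0 < r * (1 - a) by rewrite mulr_gt0// subr_gt0.
have up : (hausdorff d (perturbed_sphere r g c) <= ((r * (1 + a)) ^+ d * h)%:E)%E.
  rewrite EFinM -hh; apply: hausdorff_lipschitz => // x y _ _.
  by apply: perturb_upper.
have lo : (h%:E <= ((r * (1 - a)) ^- d)%:E * hausdorff d (perturbed_sphere r g c))%E.
  rewrite -hh -exprVn; apply: hausdorff_expanding; first by rewrite invr_gt0.
  move=> x y _ _; rewrite ler_pdivlMl//; exact: perturb_lower.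
have := @hausdorff_ge0 R _ d (perturbed_sphere r g c).
case: (hausdorff d (perturbed_sphere r g c)) up lo => // m up lo _; exists m; split=> //.
by move: lo; rewrite -EFinM lee_fin ler_pdivlMl// exprn_gt0.
Qed.

End PerturbedMeasure.

(** * Separation of perturbed spheres *)

(** The distance functions of [M1] and [M2] would differ by at most 2 eps at [p], but there the
    first is 0 and the second at least 21/10 eps. *)
Lemma hausdorff_dist_apart {R : realType} {n : nat} (K M1 M2 : set 'rV[R]_n) p (eps : R) :
  0 < eps -> M1 p -> (forall q, M2 q -> 21 / 10 * eps <= enorm (q - p)) ->
  (hausdorff_dist M1 K <= eps%:E)%E -> (hausdorff_dist M2 K <= eps%:E)%E -> False.
Proof.
move=> eps0 M1p M2p h1 h2.
have dist_le M : (hausdorff_dist M K <= eps%:E)%E ->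
    (`|dist_set p M - dist_set p K| <= eps%:E)%E.
  by apply: le_trans; apply: ereal_sup_ubound; exists p.
have d1 : dist_set p M1 = 0%E.
  apply/eqP; rewrite eq_le; apply/andP; split.
    by apply: ereal_inf_lbound; exists p => //; rewrite subrr enorm0.
  by apply: le_ereal_inf_tmp => _ [q _ <-]; rewrite lee_fin enorm_ge0.
have d2 : ((21 / 10 * eps)%:E <= dist_set p M2)%E.
  by apply: le_ereal_inf_tmp => _ [q /M2p ? <-]; rewrite lee_fin.
have {h1} := dist_le _ h1; have {h2} := dist_le _ h2; rewrite d1 sub0e.
case: (dist_set p K) => [t| |] //=; case: (dist_set p M2) d2 => [u| |] //=.
rewrite !lee_fin normrN !ler_norml => h /andP[_ h1] /andP[_ h2]; lra.
Qed.

Section NormalVectors.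
Context {R : realType} {d k : nat}.
Implicit Types (x y : 'rV[R]_d.+1) (u v : 'rV[R]_k.+1).

(** For a unit vector x, an isometry of R^(k+1) onto the normal space of the sphere at (x, 0): the
    first coordinate is radial, the others are the last k of the ambient space. *)
Definition normal_vec x v : 'rV[R]_(d.+1 + k) := row_mx (pole_l v *: x) (pole_r v).

Lemma enorm_normal_vec x v : enorm x = 1 -> enorm (normal_vec x v) = enorm v.
Proof.
move=> x1; rewrite !enormE -{3 4}(pole_mxK v) dotp_pole dotp_row_mx dotpZl dotpZr.
by rewrite -(enorm_sq x) x1 expr1n mulr1.
Qed.

Lemma normal_vecB x u v : normal_vec x u - normal_vec x v = normal_vec x (u - v).
Proof.
rewrite row_mxB -scalerBl; congr row_mx; first by rewrite /pole_l !mxE.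
by rewrite /pole_r linearB.
Qed.

Lemma normal_vec0 x : normal_vec x 0 = 0.
Proof. by rewrite -(subrr (0 : 'rV[R]_k.+1)) -normal_vecB subrr. Qed.

Lemma pole_l_le v : `|pole_l v| <= enorm v.
Proof.
apply: ler_of_sqr; first exact: enorm_ge0.
rewrite real_normK ?num_real// enorm_sq -{2 3}(pole_mxK v) dotp_pole -expr2 lerDl.
exact: dotp_ge0.
Qed.

(** A chord of the sphere leaves the tangent space only to second order: its radial component is -
    |y - x|^2 / 2. *)
Lemma dotp_normal_vec x y v : enorm x = 1 -> enorm y = 1 ->
  `|dotp (row_mx (y - x) 0) (normal_vec x v)| <= enorm v / 2 * enorm (y - x) ^+ 2.
Proof.
move=> x1 y1; rewrite dotp_row_mx dotp0l addr0 dotpZr dotpBl.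
have x2 : dotp x x = 1 by rewrite -enorm_sq x1 expr1n.
have y2 : dotp y y = 1 by rewrite -enorm_sq y1 expr1n.
have -> : dotp y x - dotp x x = - (enorm (y - x) ^+ 2 / 2).
  by rewrite enorm_sq dotp_sqrD dotpNr dotpNl dotpNr opprK x2 y2; field.
rewrite mulrN normrN normrM (ger0_norm (divr_ge0 (sqr_ge0 _) _))// [leRHS]mulrAC -mulrA.
apply: ler_wpM2r; last exact: pole_l_le.
by rewrite divr_ge0 ?sqr_ge0.
Qed.

End NormalVectors.

(** After division by e W the left side exceeds 10/4, while the right side is at most 21/10 + 265 e
    + 23 a <= 249/100. *)
Lemma no_small_displacement (R : realFieldType) (e a t W : R) :
  0 < e -> 0 <= a -> 0 <= t -> t <= 23 * e -> 4^-1 < W -> 265 * e + 23 * a <= 39 / 100 ->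
  10 * e * W ^+ 2 <= 21 / 10 * e * W + W / 2 * t ^+ 2 + a * t * W -> False.
Proof.
move=> e0 a0 t0 te W4 ea h.
have W0 : 0 < W by lra.
have h1 : 10 * e * W <= 21 / 10 * e + t ^+ 2 / 2 + a * t.
  by rewrite -(ler_pM2r W0); move: h; congr (_ <= _); field.
have h2 : t ^+ 2 <= 529 * e ^+ 2 by nra.
have h3 : a * t <= a * (23 * e) by exact: ler_wpM2l.
have h4 : e * (10 * W) <= e * (21 / 10 + (265 * e + 23 * a)).
  have := sqr_ge0 e; nra.
by rewrite ler_pM2l// in h4; lra.
Qed.

Section Separation.
Context {R : realType} {d k : nat} {I : finType}.
Variables (delta e : R) (x : I -> 'rV[R]_d.+1) (u v : I -> 'rV[R]_k.+1).
Let c i : 'rV[R]_(d.+1 + k) := row_mx (x i) 0.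
Let g w := displace delta (10 * e) c (fun i => normal_vec (x i) (w i)).
Let a := 12 * (10 * e) / delta.
Hypotheses (delta_gt0 : 0 < delta) (e_gt0 : 0 < e).
Hypothesis small : 265 * e + 23 * a <= 39 / 100.
Hypothesis x1 : forall i, enorm (x i) = 1.
Hypothesis x_sep : forall i j, i != j -> 2 * delta < enorm (x i - x j).
Hypotheses (u1 : forall i, enorm (u i) <= 1) (v1 : forall i, enorm (v i) <= 1).

(** The gap [z] is tested against the normal vector [W] between the two code words at site i: the
    scalar product is 10 e |W|^2 up to the curvature of the sphere and the slope of the bump, both
    small because y must lie near the site. *)
Lemma displaced_apart i y : 4^-1 < enorm (v i - u i) -> usphere y ->
  21 / 10 * e <= enorm (y + g v y - (c i + g u (c i))).
Proof.
move=> vu [y0 /= y01 yE]; rewrite leNgt; apply/negP => close.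
have e10 : 0 <= 10 * e by rewrite mulr_ge0// ltW.
have c_sep i' j : i' != j -> 2 * delta < enorm (c i' - c j).
  by move=> /x_sep; rewrite row_mxB subrr enorm_row_mx0.
have nv (w : I -> 'rV[R]_k.+1) : (forall i, enorm (w i) <= 1) ->
    forall i, enorm (normal_vec (x i) (w i)) <= 1 :> R.
  by move=> w1 i'; rewrite enorm_normal_vec.
have gu : g u (c i) = 10 * e *: normal_vec (x i) (u i) by exact: displace_center.
have gv : g v (c i) = 10 * e *: normal_vec (x i) (v i) by exact: displace_center.
pose z := y + g v y - (c i + g u (c i)).
pose t := enorm (y - c i).
have tE : t = enorm (y0 - x i) by rewrite /t -yE row_mxB subrr enorm_row_mx0.
(* 21/10 e comes from [close] and 10 e from each of the two displacements. *)
have t23 : t <= 23 * e.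
  have -> : t = enorm (z + (- g v y + g u (c i))).
    by rewrite /t /z opprD (addrACA y) (addrC (- g v y)) -(opprB (g v y)) addrK.
  apply: le_trans (enormD _ _) _; have := enormD (- g v y) (g u (c i)).
  rewrite enormN.
  have : enorm (g v y) <= 10 * e by apply: displace_le => //; exact: nv.
  have : enorm (g u (c i)) <= 10 * e by apply: displace_le => //; exact: nv.
  by move: close; rewrite -/z; lra.
pose W := normal_vec (x i) (v i - u i).
have WE : enorm W = enorm (v i - u i) by exact: enorm_normal_vec.
have a0 : 0 <= a by rewrite divr_ge0 ?mulr_ge0 ?(ltW delta_gt0) ?(ltW e_gt0).
have key : 10 * e * enorm W ^+ 2 = dotp z W - dotp (y - c i) W - dotp (g v y - g v (c i)) W.
  have -> : z = (y - c i) + (g v y - g v (c i)) + (10 * e) *: W.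
    by rewrite /z /W -normal_vecB gu gv scalerBr opprD (addrACA y) -[RHS]addrA subrKA.
  by rewrite !dotpDl dotpZl -enorm_sq; ring.
apply: (@no_small_displacement _ e a t (enorm W)) => //.
- exact: enorm_ge0.
- by rewrite WE.
rewrite key -addrA -[leRHS]addrA; apply: lerD.
  apply: le_trans (dotp_le _ _) _; apply: ler_wpM2r; first exact: enorm_ge0.
  exact: ltW.
rewrite -!dotpNl; apply: lerD.
  rewrite dotpNl; apply: le_trans (ler_norm _) _; rewrite normrN tE WE -yE row_mxB subrr.
  exact: dotp_normal_vec.
rewrite dotpNl; apply: le_trans (ler_norm _) _; rewrite normrN.
apply: le_trans (dotp_norm_le _ _) _; apply: ler_wpM2r; first exact: enorm_ge0.
by apply: displace_lip => //; exact: nv.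
Qed.

End Separation.

(** * Nets of the sphere and codes in the ball *)

Section Nets.
Context {R : realType}.

(** By maximality the balls of radius s about [X] cover the sphere, so those of radius 2 s cover the
    shell of half-width s; in the comparison of volumes [shell_ge] supplies the factor d + 1. *)
Lemma sphere_net (d : nat) (s : R) : 0 < s -> s < 1 -> exists X : seq 'rV[R]_d.+1,
  [/\ separated_seq s X, forall x, x \in X -> enorm x = 1 &
      d.+1%:R <= (size X)%:R * (2 * s) ^+ d].
Proof.
move=> s0 s1; have t0 : 0 < s / 2 by rewrite divr_gt0.
have t1 : s / 2 < 1 by lra.
have sE : 2 * (s / 2) = s by field.
pose B := Num.truncn (2 * d.+1%:R * (1 + s / 2) ^+ d / (s / 2) ^+ d).
have [X Xs X1|X [Xs X1 Xc]] := @maximal_separated R d.+1 [set x | enorm x = 1] s B.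
  rewrite truncn_ge_nat; last by rewrite !mulr_ge0 ?invr_ge0 ?exprn_ge0 ?addr_ge0// ltW.
  rewrite ler_pdivlMr ?exprn_gt0//; apply: separated_sphere_size => //.
  by rewrite sE.
exists X; split=> //.
have ss0 : 0 < 2 * s by rewrite mulr_gt0.
have h1 : (1 + s) ^+ d.+1 - (1 - s) ^+ d.+1 <= (size X)%:R * (2 * s) ^+ d.+1.
  apply: cover_ball_count; [lra|lra|exact: ltW|lra|].
  move=> y y1 y2.
  have y0 : 0 < enorm y by lra.
  have [|x xX xy] := Xc ((enorm y)^-1 *: y).
    by rewrite /= enormZ ger0_norm ?invr_ge0 ?enorm_ge0// mulVf// gt_eqF.
  exists x => //; apply: le_trans (enorm_sub _ ((enorm y)^-1 *: y) _) _.
  have -> : 2 * s = s + s by ring.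
  apply: lerD => //.
  have -> : y - (enorm y)^-1 *: y = (1 - (enorm y)^-1) *: y by rewrite scalerBl scale1r.
  rewrite enormZ -[X in _ * X](ger0_norm (enorm_ge0 y)) -normrM mulrBl mul1r mulVf ?gt_eqF//.
  by rewrite ler_norml; apply/andP; split; lra.
have := le_trans (shell_ge d.+1 (ltW s0) (ltW s1)) h1.
rewrite exprS [X in _ <= X -> _]mulrCA [X in X <= _ -> _](_ : _ = 2 * s * d.+1%:R); last by ring.
by rewrite ler_pM2l.
Qed.

(** A maximal code covers the unit ball by balls of radius 1/4, so it has at least 4^p words. It
    exists thanks to the bound 9^p, from disjoint balls of radius 1/8 inside the ball of radius
    9/8. *)
Lemma ball_code (p : nat) : exists X : seq 'rV[R]_p,
  [/\ separated_seq 4^-1 X, forall x, x \in X -> enorm x <= 1 & 4 ^+ p <= (size X)%:R :> R].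
Proof.
have [X Xs X1|X [Xs X1 Xc]] := @maximal_separated R p [set x | enorm x <= 1] 4^-1 (9 ^ p).
  have q0 : 0 < (8^-1 : R) by rewrite invr_gt0.
  have := @ball_sum_le R p [seq (1, x, 8^-1) | x <- X] [:: (1, 0, 9 / 8)].
  rewrite big_map/= sum_const_size mul1r big_seq1/= mul1r => h.
  rewrite -(ler_nat R) natrX -(ler_pM2r (exprn_gt0 p q0)) -exprMn; apply: h.
  - by move=> _ /mapP[x _ ->] /=; exact: ltW.
  - by move=> q; rewrite mem_seq1 => /eqP -> /=; rewrite divr_ge0.
  move=> y; rewrite big_map big_seq1 /= subr0 mul1r.
  under eq_bigr do rewrite mul1r.
  rewrite sum_indic_count; case: (leP (enorm y) (9 / 8)) => y1.
    rewrite /= -[X in _ <= X]/(1%:R : R) ler_nat; apply: separated_count_le1.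
    by rewrite (_ : 2 * 8^-1 = 4^-1)//; field.
  rewrite /= -[X in _ <= X]/(0%:R : R) ler_nat leqn0 eqn0Ngt -has_count; apply/negP => /hasP[x xX xy].
  have := X1 _ xX; have := enorm_sub y x 0; rewrite !subr0 /=; lra.
exists X; split=> //.
have q0 : 0 < (4^-1 : R) by rewrite invr_gt0.
have := @cover_ball_sum R p [seq (x, 4^-1) | x <- X] 1 ler01.
rewrite expr1n big_map/= sum_const_size => h.
rewrite -[leLHS]mul1r -ler_pdivlMr ?exprn_gt0// -exprVn; apply: h.
  by move=> _ /mapP[x _ ->] /=; exact: ltW.
by move=> y /Xc[x xX xy]; exists (x, 4^-1) => //; exact: map_f.
Qed.

End Nets.

(** * The family of manifolds *)

Section SmallParameters.
Context {R : realFieldType}.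
Variable u : R.
Hypotheses (u_gt0 : 0 < u) (u_le : u <= 1000^-1).

(** The left side is at most 8/9 + 3 u + 1/10 and the right side at least 1 - 6 u; the gap 1/90
    exceeds 9 u. *)
Lemma reach_parameters (rho : R) : 0 < rho -> rho <= 8 / 9 ->
  rho * (1 + 3 * u + 2 * (20 * rho)^-1) <= (1 - 3 * u) ^+ 2.
Proof.
move=> rho0 rho1.
have -> : rho * (1 + 3 * u + 2 * (20 * rho)^-1) = rho + 3 * (u * rho) + 10^-1.
  by field; rewrite gt_eqF.
have h1 : u * rho <= u * 1 by rewrite ler_pM2l//; lra.
have -> : (1 - 3 * u) ^+ 2 = 1 - 6 * u + 9 * u ^+ 2 by ring.
have h2 := sqr_ge0 u; move: u_gt0 u_le; lra.
Qed.

Lemma separation_parameters (rho : R) : 0 < rho -> rho <= 8 / 9 ->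
  265 * (u ^+ 2 * rho) + 23 * (3 * u) <= 39 / 100.
Proof.
move=> rho0 rho1.
have h : u ^+ 2 * rho <= u * 1.
  rewrite expr2 -mulrA ler_pM2l//; apply: le_trans (_ : 1 * rho <= _); last lra.
  by rewrite ler_pM2r//; move: u_le; lra.
move: u_gt0 u_le; lra.
Qed.

Lemma slope_lt1 : 3 * u < 1.
Proof. by move: u_le; lra. Qed.

End SmallParameters.

Section Family.
Context {R : realType} {d k N m : nat}.
Variables (r rho u : R) (x : 'I_N.+1 -> 'rV[R]_d.+1) (code : 'I_m -> 'rV[R]_k.+1).
Let F := {ffun 'I_N -> 'I_m}.
Implicit Type w : F.
Let e := u ^+ 2 * rho.
Let delta := 40 * u * rho.
Let c i : 'rV[R]_(d.+1 + k) := row_mx (x i) 0.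

(* The site [ord0] keeps the displacement 0, so that all members pass through
   the origin. *)
Definition site_code w (i : 'I_N.+1) : 'rV[R]_k.+1 :=
  if unlift ord0 i is Some j then code (w j) else 0.

Definition bumpy w := displace delta (10 * e) c (fun i => normal_vec (x i) (site_code w i)).

Definition family w : set 'rV[R]_(d.+1 + k) :=
  perturbed_sphere r (bumpy w) (r *: c ord0).

Hypotheses (r_gt0 : 0 < r) (rho_gt0 : 0 < rho) (rho_le : rho <= 8 / 9).
Hypotheses (u_gt0 : 0 < u) (u_le : u <= 1000^-1).
Hypothesis x1 : forall i, enorm (x i) = 1.
Hypothesis x_sep : forall i j, i != j -> 2 * delta < enorm (x i - x j).
Hypothesis code1 : forall j, enorm (code j) <= 1.
Hypothesis code_sep : forall i j, i != j -> 4^-1 < enorm (code i - code j).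

Let delta_gt0 : 0 < delta.
Proof. by rewrite !mulr_gt0. Qed.

Let e_gt0 : 0 < e.
Proof. by rewrite mulr_gt0// exprn_gt0. Qed.

Let aE : 12 * (10 * e) / delta = 3 * u.
Proof. by rewrite /e /delta; field; rewrite !gt_eqF. Qed.

(** Free of u, as the height and the squared radius of a bump shrink at the same rate. The factor 40
    in the radius makes the curvature cost 2 [rho] b in [reach_parameters] equal to 1/10. *)
Let bE : 8 * (10 * e) / delta ^+ 2 = (20 * rho)^-1.
Proof. by rewrite /e /delta; field; rewrite !gt_eqF. Qed.

Let c_sep i j : i != j -> 2 * delta < enorm (c i - c j).
Proof. by move=> /x_sep; rewrite row_mxB subrr enorm_row_mx0. Qed.

Let site_code_le1 w i : enorm (site_code w i) <= 1.
Proof. by rewrite /site_code; case: unliftP => [j _|_]; [exact: code1|rewrite enorm0]. Qed.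

Let vec_le1 w i : enorm (normal_vec (x i) (site_code w i)) <= 1 :> R.
Proof. by rewrite enorm_normal_vec. Qed.

Let e10 : 0 <= 10 * e.
Proof. by rewrite mulr_ge0// ltW. Qed.

Lemma bumpy_lip w y z : enorm (bumpy w z - bumpy w y) <= 3 * u * enorm (z - y).
Proof. by rewrite -aE; exact: displace_lip. Qed.

Lemma family0 w : family w 0.
Proof.
exists (c ord0); first by exists (x ord0) => //=; exact: x1.
rewrite /perturb /bumpy displace_center// /site_code unlift_none normal_vec0 scaler0 addr0.
exact: subrr.
Qed.

Lemma family_manifold w : (0 < d)%N -> manifold_class d (rho * r) (family w).
Proof.
move=> d0.
have a0 : 0 <= 3 * u by rewrite mulr_ge0// ltW.
have b0 : 0 <= (20 * rho)^-1 by rewrite invr_ge0 mulr_ge0// ltW.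
have reach_le : rho * r * (1 + 3 * u + 2 * (20 * rho)^-1) <= r * (1 - 3 * u) ^+ 2.
  by rewrite mulrAC mulrC ler_pM2l//; exact: reach_parameters.
apply: (manifold_class_perturbed_sphere (a := 3 * u) (b := (20 * rho)^-1)
  (G := ddisplace delta (10 * e) c (fun i => normal_vec (x i) (site_code w i)))
  _ r_gt0 a0 (slope_lt1 u_le) b0 _ _ _ _ _ _ reach_le d0).
- exact: bumpy_lip.
- by move=> y z z'; exact: ddisplaceD.
- by move=> y t z; exact: ddisplaceZ.
- by move=> y z; rewrite -aE; exact: ddisplace_le.
- by move=> y z; rewrite -bE; exact: displace_taylor.
- by move=> h hC; exact: C2f_displace.
Qed.

(** Two members carry different code words at some free site; the tip of the first bump there is the
    point [p] of [hausdorff_dist_apart]. *)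
Lemma family_apart w w' K : w != w' ->
  (hausdorff_dist (family w) K <= (u ^+ 2 * rho * r)%:E)%E ->
  (hausdorff_dist (family w') K <= (u ^+ 2 * rho * r)%:E)%E -> False.
Proof.
move=> ww'; have [j wj] : exists j, w j != w' j.
  apply/existsP; move: ww'; apply: contraR; rewrite negb_exists => /forallP h.
  by apply/eqP/ffunP => j; apply/eqP; move: (h j); rewrite negbK.
pose i := lift ord0 j.
apply: (@hausdorff_dist_apart _ _ K _ _ (perturb r (bumpy w) (r *: c ord0) (c i))).
- by rewrite !mulr_gt0// exprn_gt0.
- by exists (c i) => //; exists (x i) => //=; exact: x1.
move=> _ [y Sy <-]; rewrite /perturb opprB addrA subrK -scalerBr enormZ (gtr0_norm r_gt0).
have -> : 21 / 10 * (u ^+ 2 * rho * r) = r * (21 / 10 * e) by rewrite /e; ring.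
rewrite ler_pM2l//.
apply: (displaced_apart delta_gt0 e_gt0 _ x1 x_sep) => //.
  by rewrite aE; exact: separation_parameters.
by rewrite /site_code liftK; apply: code_sep; rewrite eq_sym.
Qed.

Lemma family_hausdorff w h : hausdorff d (@usphere R d k) = h%:E ->
  exists M, [/\ hausdorff d (family w) = M%:E,
    (r * (1 - 3 * u)) ^+ d * h <= M & M <= (r * (1 + 3 * u)) ^+ d * h].
Proof.
apply: hausdorff_perturbed_sphere => //; last exact: bumpy_lip.
  by rewrite mulr_ge0// ltW.
exact: slope_lt1.
Qed.

End Family.

(** * Numerical estimates *)

Section Numerics.
Context {R : realType}.

(** exp (-11/10) is the 20th power of exp (-55/1000), which is at least 945/1000 by exp x >= 1 +
    x. *)
Lemma ln4_ge : 11 / 10 <= ln 4 :> R.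
Proof.
rewrite -ler_expR lnK ?posrE//.
have h : expR (- (55 / 1000)) >= 945 / 1000 :> R.
  by apply: le_trans (expR_ge1Dx _); lra.
have -> : 11 / 10 = - (- (55 / 1000) * 20%:R) :> R by field.
rewrite expRN expRM_natr -[leRHS]invrK lef_pV2 ?posrE ?exprn_gt0 ?expR_gt0 ?invr_gt0//.
have h0 : 0 <= 945 / 1000 :> R by lra.
apply: le_trans (_ : (945 / 1000) ^+ 20 <= _); last by rewrite lerXn2r ?nnegrE ?expR_ge0.
by lra.
Qed.

(** 256/81 is the square of 2 / (9/8) and 225/64 that of 15/8, as they occur in [radius_ge]. The
    induction step asks for d + 1 >= 3, hence two base cases. *)
Lemma cube_le_geometric (d : nat) : (0 < d)%N ->
  121 / 100 * d.+1%:R ^+ 3 <= 225 / 64 * (256 / 81) ^+ d :> R.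
Proof.
case: d => // d _; elim: d => [|[|d] IH]; [by lra|by lra|].
rewrite [_ ^+ d.+3]exprS; have h0 : 3 <= d.+3%:R :> R by rewrite ler_nat.
rewrite -[d.+4%:R]natr1; move: IH h0; move: (d.+3%:R : R) => D IH h0.
have h : (D + 1) ^+ 3 <= 256 / 81 * D ^+ 3.
  have : 0 <= (D - 3) * D ^+ 2 by rewrite mulr_ge0 ?sqr_ge0//; lra.
  have : 0 <= (D - 3) * D by rewrite mulr_ge0; lra.
  nra.
by move: IH h; move: ((256 / 81) ^+ d.+2) (D ^+ 3) ((D + 1) ^+ 3) => A B C; lra.
Qed.

(** Nearly tight at d = 1, where 8.8 stands against about 9.19; the base 9 fixes the constant 1440 =
    160 * 9 of [count_bound]. *)
Lemma square_le_geometric (d : nat) : (0 < d)%N ->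
  11 / 5 * d.+1%:R ^+ 2 <= 11 / 10 * (99 / 100) * (15 / 16) * 9 ^+ d :> R.
Proof.
case: d => // d _; elim: d => [|d IH]; first by lra.
rewrite [_ ^+ d.+2]exprS; have h0 : 2 <= d.+2%:R :> R by rewrite ler_nat.
rewrite -[d.+3%:R]natr1; move: IH h0; move: (d.+2%:R : R) (9 ^+ d.+1) => D A IH h0.
nra.
Qed.

Lemma exists_root (d : nat) (y : R) : (0 < d)%N -> 0 < y -> exists2 r, 0 < r & r ^+ d = y.
Proof.
move=> d0 y0; exists (y `^ d%:R^-1); first exact: powR_gt0.
by rewrite -powR_mulrn ?powR_ge0// -powRrM mulVf ?pnatr_eq0 -?lt0n// powRr1// ltW.
Qed.

(** The claim is (9/8 rch)^d fmin h <= 15/16. The covering bound and [ball_vol_ratio] bound h by w'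
    at the cost of a factor of order (d + 1)^(5/2); the area hypothesis takes one factor d + 1, and
    (16/9)^d absorbs the rest. [key] is proved squared, so that no square root of d + 1 appears. *)
Lemma radius_ge (d : nat) (h w w' fmin rch r : R) : (0 < d)%N ->
  0 < h -> 0 < w -> 0 < w' -> 0 < fmin -> 0 < rch -> 0 < r ->
  4 * w ^+ 2 <= d.+1%:R * w' ^+ 2 -> h <= w * (11 / 5 * d.+1%:R ^+ 2) ->
  2 ^+ d.+1 * (d.+1%:R * w') * fmin * rch ^+ d <= 1 ->
  r ^+ d = 15 / 16 / (fmin * h) -> 9 / 8 * rch <= r.
Proof.
move=> d0 h0 w0 w'0 f0 rch0 r0 ww hw small rE.
have D0 : 0 < d.+1%:R :> R by [].
have fh : 0 < fmin * h by exact: mulr_gt0.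
have q0 : 0 <= 9 / 8 * rch by rewrite mulr_ge0// ltW.
rewrite -(ler_pXn2r d0) ?nnegrE ?(ltW r0)// rE ler_pdivlMr// exprMn.
have key : 11 / 5 * d.+1%:R * (w * (9 / 8) ^+ d) <= 15 / 8 * (2 ^+ d * w').
  have q1 : 0 <= 15 / 8 * (2 ^+ d * w') by rewrite !mulr_ge0 ?exprn_ge0// ltW.
  have q2 : 0 <= 11 / 5 * d.+1%:R * (w * (9 / 8) ^+ d) by rewrite !mulr_ge0 ?exprn_ge0// ltW.
  rewrite -ler_sqr ?nnegrE//.
  have e1 : (11 / 5 * d.+1%:R * (w * (9 / 8) ^+ d)) ^+ 2 =
      (121 / 100 * d.+1%:R ^+ 2 * ((9 / 8) ^+ d) ^+ 2) * (4 * w ^+ 2) by field.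
  have e2 : (15 / 8 * (2 ^+ d * w')) ^+ 2 =
      225 / 64 * (256 / 81) ^+ d * (((9 / 8) ^+ d) ^+ 2 * w' ^+ 2).
    have e3 : (256 / 81) ^+ d * ((9 / 8) ^+ d) ^+ 2 = (2 ^+ d) ^+ 2 :> R.
      by rewrite -!exprM mulnC !exprM -exprMn; congr (_ ^+ _); field.
    by rewrite mulrA -(mulrA (225 / 64)) e3; field.
  rewrite e1 e2.
  apply: le_trans (_ : 121 / 100 * d.+1%:R ^+ 2 * ((9 / 8) ^+ d) ^+ 2 * (d.+1%:R * w' ^+ 2) <= _).
    by apply: ler_wpM2l ww; rewrite !mulr_ge0 ?sqr_ge0.
  have -> : 121 / 100 * d.+1%:R ^+ 2 * ((9 / 8) ^+ d) ^+ 2 * (d.+1%:R * w' ^+ 2) =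
     121 / 100 * d.+1%:R ^+ 3 * (((9 / 8) ^+ d) ^+ 2 * w' ^+ 2) :> R by ring.
  by apply: ler_wpM2r (cube_le_geometric d0); rewrite mulr_ge0 ?sqr_ge0.
have p0 : 0 <= (9 / 8) ^+ d * rch ^+ d * fmin by rewrite !mulr_ge0 ?exprn_ge0// ltW.
apply: le_trans (_ : (9 / 8) ^+ d * rch ^+ d * fmin * (w * (11 / 5 * d.+1%:R ^+ 2)) <= _).
  by rewrite mulrA; exact: ler_wpM2l.
have s0 : 0 <= rch ^+ d * fmin * d.+1%:R by rewrite !mulr_ge0 ?exprn_ge0// ltW.
have := ler_wpM2l s0 key.
have -> : rch ^+ d * fmin * d.+1%:R * (15 / 8 * (2 ^+ d * w')) =
   15 / 16 * (2 ^+ d.+1 * (d.+1%:R * w') * fmin * rch ^+ d) by rewrite [2 ^+ d.+1]exprS; field.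
have -> : rch ^+ d * fmin * d.+1%:R * (11 / 5 * d.+1%:R * (w * (9 / 8) ^+ d)) =
  (9 / 8) ^+ d * rch ^+ d * fmin * (w * (11 / 5 * d.+1%:R ^+ 2)) by ring.
move: small; move: (2 ^+ d.+1 * _ * _ * _) ((9 / 8) ^+ d * _ * _ * _) => A B; lra.
Qed.

Lemma powR_half_le (x y : R) (d : nat) : 0 <= x -> 0 <= y -> x <= y ^+ 2 ->
  x `^ (d%:R / 2) <= y ^+ d.
Proof.
move=> x0 y0 xy; apply: le_trans (_ : (y ^+ 2) `^ (d%:R / 2) <= _).
  by apply: ge0_ler_powR => //; rewrite ?nnegrE ?sqr_ge0 ?divr_ge0.
rewrite -(powR_mulrn 2 y0) -powRrM mulrCA mulfV// mulr1 powR_mulrn//.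
Qed.

Lemma count_bound (d k N : nat) (h w fmin rch r u eps : R) : (0 < d)%N ->
  0 < h -> 0 < w -> 0 < fmin -> 0 < rch -> 0 < r -> 0 < u -> 100 * (100 * u) <= 1 ->
  rch / r <= 8 / 9 -> h <= w * (11 / 5 * d.+1%:R ^+ 2) ->
  r ^+ d = 15 / 16 / (fmin * h) -> eps = u ^+ 2 * rch ->
  d.+1%:R <= N.+1%:R * (2 * (80 * u * (rch / r))) ^+ d ->
  (d.+1 + k)%:R / (w * fmin * rch ^+ d) * (rch / (2 ^+ 21 * eps)) `^ (d%:R / 2)
    <= N%:R * (k.+1%:R * ln 4).
Proof.
move=> d0 h0 w0 f0 rch0 r0 u0 u1 rr hw rE epsE hN.
(* One site is spent on the origin. As N + 1 >= (d + 1) / s^d >= 100, at least 99/100 of the sites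
   remain. *)
have N100 : N.+1%:R <= 100 / 99 * N%:R :> R.
  pose s := 2 * (80 * u * (rch / r)).
  have s0 : 0 <= s by rewrite !mulr_ge0 ?invr_ge0// ltW.
  have s1 : s <= 50^-1.
    have := ler_wpM2l (ltW u0) rr; rewrite /s; move: (rch / r) => rho; nra.
  have sd : s ^+ d <= 50^-1.
    have s2 : s <= 1 by lra.
    by apply: le_trans s1; case: (d) d0 => // d' _; rewrite exprS ler_piMr// exprn_ile1.
  have D2 : 2 <= d.+1%:R :> R by rewrite ler_nat ltnS.
  have := ler_wpM2l (ler0n R N.+1) sd; move: hN; rewrite -/s -[N.+1%:R]natr1.
  move: (d.+1%:R : R) D2 => D D2; move: (s ^+ d) => S; move: (N%:R : R) => n; lra.
have D0 : 0 < d.+1%:R :> R by [].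
have c0 : 0 < 1440 :> R by rewrite ltr0n.
have c1 : 0 < 160 :> R by rewrite ltr0n.
pose P := w * fmin * rch ^+ d.
have P0 : 0 < P by rewrite !mulr_gt0// exprn_gt0.
pose Q := u ^+ d; have Q0 : 0 < Q by rewrite exprn_gt0.
(* 1440^2 = 2073600 is just below 2^21 = 2097152. *)
have powle : (rch / (2 ^+ 21 * eps)) `^ (d%:R / 2) <= (1440 ^+ d * Q)^-1.
  have : 1440 ^+ 2 <= 2 ^+ 21 :> R by lra.
  have : 0 < 2 ^+ 21 :> R by apply: exprn_gt0; exact: ltr0n.
  move: (2 ^+ 21) => T T0 hT.
  have T1 : 0 < T * u ^+ 2 by rewrite mulr_gt0// exprn_gt0.
  have y0 : 0 < 1440 * u by exact: (mulr_gt0 c0 u0).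
  have xE : rch / (T * eps) = (T * u ^+ 2)^-1 by rewrite epsE; field; rewrite !gt_eqF.
  rewrite /Q -exprMn -exprVn xE; apply: powR_half_le.
  - by rewrite invr_ge0; exact: (ltW T1).
  - by rewrite invr_ge0; exact: (ltW y0).
  rewrite exprVn lef_pV2 ?posrE ?T1 ?(exprn_gt0 2 y0)//.
  by rewrite exprMn; apply: ler_wpM2r hT; exact: sqr_ge0.
(* The net bound with r^d eliminated: 16/15 comes from the definition of r, the last factor from the
   bound on h. *)
have sites : d.+1%:R <= N.+1%:R * 160 ^+ d * Q * (16 / 15) * (P * (11 / 5 * d.+1%:R ^+ 2)).
  apply: le_trans hN _.
  have -> : (2 * (80 * u * (rch / r))) ^+ d = 160 ^+ d * Q * (16 / 15) * (fmin * rch ^+ d * h).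
    have -> : 2 * (80 * u * (rch / r)) = 160 * u * rch / r by field; rewrite gt_eqF.
    by rewrite expr_div_n rE !exprMn -/Q; field; rewrite !gt_eqF.
  have c2 : 0 <= N.+1%:R * 160 ^+ d * Q * (16 / 15).
    by apply: mulr_ge0 => //; apply: (mulr_ge0 _ (ltW Q0)); apply: (mulr_ge0 _ (exprn_ge0 d (ltW c1))).
  have -> : N.+1%:R * (160 ^+ d * Q * (16 / 15) * (fmin * rch ^+ d * h)) =
    N.+1%:R * 160 ^+ d * Q * (16 / 15) * (fmin * rch ^+ d * h) by ring.
  apply: (ler_wpM2l c2); rewrite /P.
  have -> : w * fmin * rch ^+ d * (11 / 5 * d.+1%:R ^+ 2) =
     fmin * rch ^+ d * (w * (11 / 5 * d.+1%:R ^+ 2)) by ring.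
  by apply: ler_wpM2l hw; rewrite mulr_ge0 ?exprn_ge0// ltW.
have nle : (d.+1 + k)%:R <= d.+1%:R * k.+1%:R :> R.
  by rewrite -natrM ler_nat mulnS leq_add2l leq_pmull.
have A0 : 0 < 1440 ^+ d * Q := mulr_gt0 (exprn_gt0 d c0) Q0.
apply: le_trans (_ : d.+1%:R * k.+1%:R / P * (1440 ^+ d * Q)^-1 <= _).
  apply: ler_pM; [by rewrite divr_ge0// ltW|exact: powR_ge0| |exact: powle].
  by apply: ler_wpM2r nle; rewrite invr_ge0 ltW.
have k0 : 0 < k.+1%:R :> R by [].
have PA : 0 < P * (1440 ^+ d * Q) by exact: mulr_gt0.
have -> : d.+1%:R * k.+1%:R / P / (1440 ^+ d * Q) = k.+1%:R * (d.+1%:R / (P * (1440 ^+ d * Q))).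
  by rewrite [(P * _)^-1]invfM !mulrA [d.+1%:R * _]mulrC.
rewrite [leRHS]mulrCA (ler_pM2l k0) (ler_pdivrMr _ _ PA).
apply: le_trans sites _.
have -> : N.+1%:R * 160 ^+ d * Q * (16 / 15) * (P * (11 / 5 * d.+1%:R ^+ 2)) =
    N.+1%:R * (16 / 15) * (160 ^+ d * Q * P) * (11 / 5 * d.+1%:R ^+ 2) by ring.
have B0 : 0 < 160 ^+ d * Q * P := mulr_gt0 (mulr_gt0 (exprn_gt0 d c1) Q0) P0.
apply: le_trans (_ : N.+1%:R * (16 / 15) * (160 ^+ d * Q * P) *
    (11 / 10 * (99 / 100) * (15 / 16) * 9 ^+ d) <= _).
  by apply: ler_wpM2l (square_le_geometric d0); apply: (mulr_ge0 _ (ltW B0)); rewrite mulr_ge0.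
have -> : 1440 ^+ d = 160 ^+ d * 9 ^+ d :> R by rewrite -exprMn; congr (_ ^+ _); ring.
have -> : N.+1%:R * (16 / 15) * (160 ^+ d * Q * P) * (11 / 10 * (99 / 100) * (15 / 16) * 9 ^+ d) =
    99 / 100 * N.+1%:R * (11 / 10) * (160 ^+ d * Q * P * 9 ^+ d) by field.
have -> : N%:R * ln 4 * (P * (160 ^+ d * 9 ^+ d * Q)) =
    N%:R * ln 4 * (160 ^+ d * Q * P * 9 ^+ d) :> R by ring.
apply: ler_wpM2r; first by apply: mulr_ge0; [exact: ltW|exact: exprn_ge0].
by apply: ler_pM; [rewrite mulr_ge0| |clear - N100; lra|exact: ln4_ge].
Qed.

(** The factor 15/16 in r^d leaves room for the bumps to increase the measure, as (1 + 3 u)^d <=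
    16/15; downwards the factor 4 between fmin and fmax is ample. *)
Lemma density_bounds (d : nat) (u r h fmin M : R) : 0 <= u -> 100 * (d%:R * u) <= 1 ->
  u <= 100^-1 -> 0 < h -> 0 < fmin -> 0 < r -> r ^+ d = 15 / 16 / (fmin * h) ->
  (r * (1 - 3 * u)) ^+ d * h <= M -> M <= (r * (1 + 3 * u)) ^+ d * h ->
  [/\ 0 < M, fmin <= M^-1 & M^-1 <= 4 * fmin].
Proof.
move=> u0 du u1 h0 f0 r0 rE; rewrite !exprMn rE => lo hi.
have u31 : -1 <= - (3 * u) by lra.
have b1 := bernoulli_ge d u31.
have b2 : (1 + 3 * u) ^+ d <= (1 - d%:R * (3 * u))^-1.
  apply: expr1D_le; lra.
have b3 : (1 - d%:R * (3 * u))^-1 <= 16 / 15.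
  by rewrite -[leRHS]invrK lef_pV2 ?posrE ?invr_gt0 ?invf_div; lra.
have E t : 15 / 16 / (fmin * h) * t * h = 15 / 16 * t / fmin by field; rewrite !gt_eqF.
move: lo hi; rewrite !E => lo hi.
have M1 : M <= fmin^-1.
  apply: le_trans hi _; rewrite -[leRHS]mul1r; apply: ler_wpM2r; first by rewrite invr_ge0 ltW.
  lra.
have M2 : (4 * fmin)^-1 <= M.
  apply: le_trans lo; rewrite invfM; apply: ler_wpM2r; first by rewrite invr_ge0 ltW.
  lra.
have M0 : 0 < M by apply: lt_le_trans M2; rewrite invr_gt0 mulr_gt0.
split=> //; first by rewrite -[leLHS]invrK lef_pV2 ?posrE ?invr_gt0.
by rewrite -[leRHS]invrK lef_pV2 ?posrE ?invr_gt0 ?mulr_gt0.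
Qed.

End Numerics.

Section FinalCount.
Context {R : realType}.

(** u is sqrt (eps / rch), and 2^34 >= 10^8 gives 10^4 d u <= 1. *)
Lemma small_ratio (d : nat) (rch eps : R) : (0 < d)%N -> 0 < rch -> 0 < eps ->
  eps <= rch / (2 ^+ 34 * d%:R ^+ 2) ->
  exists u, [/\ 0 < u, eps = u ^+ 2 * rch & 100 * (100 * (d%:R * u)) <= 1].
Proof.
move=> d0 rch0 eps0.
have : (100 * 100) ^+ 2 <= 2 ^+ 34 :> R by lra.
have : 0 < 2 ^+ 34 :> R by apply: exprn_gt0; exact: ltr0n.
move: (2 ^+ 34) => T T0 hT; have D0 : 0 < d%:R :> R by rewrite ltr0n.
rewrite ler_pdivlMr; last by apply: mulr_gt0 => //; exact: exprn_gt0.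
move=> small; exists (Num.sqrt (eps / rch)).
have u2 : Num.sqrt (eps / rch) ^+ 2 = eps / rch by rewrite sqr_sqrtr// divr_ge0// ltW.
split; [by rewrite sqrtr_gt0 divr_gt0|by rewrite u2 divfK// gt_eqF|].
apply: ler_of_sqr => //; rewrite expr1n mulrA exprMn [(d%:R * _) ^+ 2]exprMn u2 mulrA mulrA.
rewrite ler_pdivrMr// mul1r; apply: le_trans small; rewrite mulrC; apply: ler_wpM2l; first exact: ltW.
by apply: ler_wpM2r hT; exact: sqr_ge0.
Qed.

Lemma small_parameter (u : R) : 0 < u -> 100 * (100 * u) <= 1 -> u <= 1000^-1.
Proof.
move=> u0 h; have p : 0 < 1000 :> R by rewrite ltr0n.
by rewrite -[leRHS]div1r (ler_pdivlMr _ _ p); lra.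
Qed.

(** m is the size of the code and N the number of free sites, so m^N is the size of the family. *)
Lemma ln_packing_bound (k N m q : nat) (p t : R) : 4 ^+ k.+1 <= m%:R :> R -> 0 < p -> 0 < t ->
  (m ^ N)%:R * p <= (1 + t) ^+ q ->
  N%:R * (k.+1%:R * ln 4) + ln p <= q%:R * ln (1 + t).
Proof.
move=> hm p0 t0 h.
have c0 : 0 < 4 :> R by rewrite ltr0n.
have c1 : 0 < (4 : R) ^+ k.+1 by exact: exprn_gt0.
have c2 : 0 < ((4 : R) ^+ k.+1) ^+ N by exact: exprn_gt0.
have t1 : 0 < 1 + t by exact: addr_gt0.
have h1 : ((4 : R) ^+ k.+1) ^+ N * p <= (1 + t) ^+ q.
  apply: le_trans h; apply: ler_wpM2r; first exact: ltW.
  by rewrite natrX; apply: lerXn2r => //; rewrite nnegrE ?ler0n// ltW.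
have := h1; rewrite -ler_ln ?posrE; [|exact: mulr_gt0|exact: exprn_gt0].
by rewrite lnM ?posrE// !lnXn// mulr_natl mulr_natl mulr_natl.
Qed.

End FinalCount.

Theorem theorem5p3 (R : realType) (n d : nat) (rch fmin fmax L tau alpha eps : R)
  (q : nat) (dO : measure_display) (Omega : measurableType dO)
  (P : probability Omega R) (A : Omega -> sq_alg R n) :
  (1 <= d)%N -> (d < n)%N ->
  0 < rch -> 0 < fmin -> fmin <= fmax / 4 -> 0 <= L -> 0 < tau -> alpha < 1 ->
  0 < eps -> eps <= rch / (2 ^+ 34 * (d%:R) ^+ 2) ->
  2 ^+ d.+1 * sphere_area R d * fmin * rch ^+ d <= 1 ->
  rand_sq_estimates d rch fmin fmax L q eps tau alpha P A ->
  (n%:R / (ball_vol R d * fmin * rch ^+ d) * powR (rch / (2 ^+ 21 * eps)) (d%:R / 2)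
     + ln (1 - alpha)) / ln (1 + tau^-1) <= q%:R.
Proof.
move=> d0 dn rch0 fmin0 fmax4 L0 tau0 alpha1 eps0 eps_le area_le est.
(* k + 1 = n - d is the dimension of the normal spaces. *)
have [k nE] : exists k, n = (d.+1 + k)%N by exists (n - d.+1)%N; rewrite subnKC.
subst n.
have [h [h0 hw hE]] := @usphere_hausdorff R d k d0.
have w0 := @ball_vol_gt0 R d; have w'0 := @ball_vol_gt0 R d.+1.
have fh0 : 0 < 15 / 16 / (fmin * h) by rewrite divr_gt0 ?mulr_gt0.
have [r r0 rE] := exists_root d0 fh0.
have r_ge : 9 / 8 * rch <= r.
  exact: (radius_ge d0 h0 w0 w'0 fmin0 rch0 r0 (ball_vol_ratio d) hw area_le rE).
have [u [u0 epsE du]] := small_ratio d0 rch0 eps0 eps_le.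
clear eps_le area_le.
have u_small : 100 * (100 * u) <= 1.
  apply: le_trans du; apply: ler_wpM2l => //; apply: ler_wpM2l => //.
  by rewrite ler_peMl ?ler1n// ltW.
pose rho := rch / r.
have rho0 : 0 < rho by exact: divr_gt0.
have rhor : rho * r = rch by rewrite divfK// gt_eqF.
have rho_le : rho <= 8 / 9.
  by rewrite (ler_pdivrMr _ _ r0); clear - r_ge; lra.
have u_le := small_parameter u0 u_small.
(* Twice the bump radius, so that bumps at the points of an s-separated net have disjoint
   supports. *)
pose s := 2 * (40 * u * rho).
have s0 : 0 < s by rewrite mulr_gt0// mulr_gt0// mulr_gt0.
have s1 : s < 1.
  have urho : u * rho <= 1000^-1 * (8 / 9).
    by apply: ler_pM; [exact: ltW|exact: ltW|exact: u_le|exact: rho_le].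
  have -> : s = 80 * (u * rho) by rewrite /s; ring.
  by clear - urho; lra.
have [X [X_sep X1 X_count]] := sphere_net d s0 s1.
have [C [C_sep C1 C_count]] := @ball_code R k.+1.
(* The net is nonempty; its first point becomes the site at the origin. *)
have [N XN] : exists N, size X = N.+1.
  case: (size X) X_count => [|N]; last by exists N.
  by rewrite mul0r lern0.
pose x (i : 'I_N.+1) : 'rV[R]_d.+1 := X`_i.
pose code (j : 'I_(size C)) : 'rV[R]_k.+1 := C`_j.
have x1 i : enorm (x i) = 1 by apply: X1; rewrite mem_nth// XN.
have x_sep i j : i != j -> s < enorm (x i - x j).
  by move=> ij; apply: separated_nth => //; rewrite XN.
have code1 j : enorm (code j) <= 1 by apply: C1; rewrite mem_nth.
have code_sep i j : i != j -> 4^-1 < enorm (code i - code j).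
  by move=> ij; apply: separated_nth.
pose M := @family R d k N (size C) r rho u x code.
have model w : in_model d rch fmin fmax L (M w) (cst (fine (hausdorff d (M w)))^-1).
  have [m [mE m_ge m_le]] :=
    family_hausdorff r0 rho0 u0 u_le x1 x_sep code1 w hE.
  have u100 : u <= 100^-1 by clear - u_le; lra.
  have du100 : 100 * (d%:R * u) <= 1.
    have : 0 <= d%:R * u by rewrite mulr_ge0// ltW.
    by clear - du; lra.
  have [m0 m1 m2] := density_bounds (ltW u0) du100 u100 h0 fmin0 r0 rE m_ge m_le.
  rewrite mE; apply: constant_density_in_model => //.
  - by rewrite -rhor; exact: family_manifold.
  - exact: family0.
  - by rewrite m1/=; apply: le_trans m2 _; clear - fmax4; lra.
have apart w w' K : w != w' -> (hausdorff_dist (M w) K <= eps%:E)%E ->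
    (hausdorff_dist (M w') K <= eps%:E)%E -> False.
  rewrite epsE -rhor mulrA.
  exact: family_apart.
have := sq_packing_bound est tau0 (ltW fmin0) model apart.
rewrite card_ffun !card_ord => packing.
have alpha0 : 0 < 1 - alpha by rewrite subr_gt0.
have taui : 0 < tau^-1 by rewrite invr_gt0.
have tau1 : 0 < ln (1 + tau^-1) by rewrite ln_gt0// ltrDl.
rewrite ler_pdivrMr//.
apply: le_trans (ln_packing_bound C_count alpha0 taui packing).
rewrite lerD2r. have count := @count_bound R d k N h _ fmin rch r u eps d0 h0 w0 fmin0 rch0 r0 u0 u_small rho_le hw rE epsE.
apply: count.
(* 2 s is the radius of the balls whose volumes are counted in [sphere_net]. *)
have -> : 2 * (80 * u * (rch / r)) = 2 * s by rewrite /s /rho; ring.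
by rewrite -XN.
Qed.
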